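(* Let $W$ be a finite Coxeter group with set of simple reflections $S$, $|S|\ge 3$, and let $L\subseteq S$ with $|L|=2$. Then for each $W_L$-conjugacy class $C$ of cuspidal elements of $W_L$, with fixed representative $w_C\in C$, there exist linear characters $\widetilde\varphi_{w_C}$ and $\widetilde\psi_{w_C}$ of $C_W(w_C)$ such that (i) $\widetilde\Phi_L=\sum_{C\in\mathcal C_L}\operatorname{Ind}_{C_W(w_C)}^{N_W(W_L)}\widetilde\varphi_{w_C}$; (ii) $\widetilde\Psi_L=\sum_{C\in\mathcal C_L}\operatorname{Ind}_{C_W(w_C)}^{N_W(W_L)}\widetilde\psi_{w_C}$; (iii) $\widetilde\psi_{w_C}=\widetilde\varphi_{w_C}\,\epsilon\,\alpha_L$ (restricted to $C_W(w_C)$) for all $C\in\mathcal C_L$.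
   Context: $W$ has length function $\ell$ and acts on the right as a reflection group on $V=\mathbb R^{|S|}$ (and $V_{\mathbb C}=\mathbb C^{|S|}$). Write $x^w=w^{-1}xw$ and $J^w=\{s^w:s\in J\}$. $\epsilon$ is the sign character $w\mapsto\det(w|_V)$. For $J\subseteq S$: $W_J=\langle J\rangle$; $X_J=\{w\in W:\ell(sw)>\ell(w)\ \forall s\in J\}$; $x_J=\sum_{x\in X_J}x^{-1}\in\mathbb CW$; $X_J^\sharp=\{x\in X_J:J^x\subseteq S\}$; $N_J=\{x\in X_J:J^x=J\}$, a subgroup with $N_W(W_J)=W_J\rtimes N_J$. For $K,L\subseteq S$ put $m_{KL}=|X_K\cap X_L^\sharp|$ if $L\subseteq K$ and $m_{KL}=0$ otherwise; this matrix is invertible and elements $e_L\in\mathbb CW$ are defined by $x_K=\sum_{L\subseteq S}m_{KL}e_L$ for all $K\subseteq S$. For $L\subseteq S$, let $e_L^L$ be the element $e_L$ constructed in the Coxeter group $(W_L,L)$; $\Phi_L$ is the character of $W_L$ acting by right multiplication on $e^L_L\mathbb CW_L$, and $\widetilde\Phi_L$ is the character of $N_W(W_L)$ acting by right multiplication on $e_L\mathbb CW_L$ (this space is $N_W(W_L)$-stable and its character extends $\Phi_L$). Orlik–Solomon algebra: $T=\{s^w\}$ is the set of reflections, $H_t\subseteq V_{\mathbb C}$ the hyperplane fixed by $t$. $A(W)$ is the $\mathbb C$-algebra generated by $a_t$ ($t\in T$) subject to $a_ta_{t'}=-a_{t'}a_t$ and $\sum_{i=1}^p(-1)^ia_{t_1}\cdots\widehat{a_{t_i}}\cdots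 a_{t_p}=0$ whenever $\{H_{t_1},\dots,H_{t_p}\}$ is linearly dependent; $W$ acts by $a_t.w=a_{t^w}$. For $X=\operatorname{Fix}(W_L)\subseteq V_{\mathbb C}$ of codimension $p$, $A_X$ is the span of all $a_{t_1}\cdots a_{t_p}$ with $H_{t_1}\cap\dots\cap H_{t_p}=X$; it is $N_W(W_L)$-stable, and $\widetilde\Psi_L$ denotes the character of $N_W(W_L)$ on $A_X$ (it extends the character $\Psi_L$ of $W_L$ on the top component of the Orlik–Solomon algebra of $W_L$). $\alpha_L$ is the linear character of $N_W(W_L)$ given by $\alpha_L(w)=\det(w|_{\operatorname{Fix}(W_L)})$. An element $w\in W_L$ is cuspidal in $W_L$ if it has no nonzero fixed vector in the orthogonal complement of $\operatorname{Fix}(W_L)$ in $V$; $\mathcal C_L$ is the set of $W_L$-conjugacy classes of cuspidal elements of $W_L$. For cuspidal $w$, $C_W(w)\le N_W(W_L)$. *)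

(* Defs.v *)
From HB Require Import structures.
From mathcomp Require Import all_boot all_order all_algebra all_fingroup.
From mathcomp Require Import all_solvable all_field all_character.
Set Implicit Arguments. Unset Strict Implicit. Unset Printing Implicit Defensive.
Import Order.TTheory GRing.Theory Num.Theory.
Local Open Scope ring_scope.

Section Coxeter.
Variable gT : finGroupType.

Definition coxeter_system (S : {set gT}) : Prop :=
  (forall s, s \in S -> #[s]%g = 2%N) /\
  forall (hT : finGroupType) (f : gT -> hT),
    (forall s t, s \in S -> t \in S -> ((f s * f t) ^+ #[(s * t)%g])%g = 1%g) ->
    exists g : gT -> hT,
      {in <<S>>%g &, {morph g : x y / (x * y)%g}} /\ {in S, g =1 f}.

Fixpoint words (S : {set gT}) (k : nat) : {set gT} :=
  if k is k'.+1 then (S * words S k')%g else [set 1%g].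

Definition len (S : {set gT}) (w : gT) : nat :=
  find (fun k => w \in words S k) (iota 0 #|gT|.+1).

Definition Xset (S J : {set gT}) : {set gT} :=
  [set w in <<S>>%g | [forall s in J, len S w < len S (s * w)%g]]%N.

Definition Xsharp (S J : {set gT}) : {set gT} :=
  [set x in Xset S J | (J :^ x \subset S)%g].

(* ---------- group algebra CW as row vectors indexed by gT ---------- *)
Definition gN := #|gT|.
Definition gvec (g : gT) : 'rV[algC]_gN := delta_mx 0 (enum_rank g).

Definition rmul (h : gT) : 'M[algC]_gN :=
  \sum_(g : gT) (gvec g)^T *m gvec (g * h)%g.

Definition xJ (S J : {set gT}) : 'rV[algC]_gN :=
  \sum_(x in Xset S J) gvec (x^-1)%g.

Definition mKL (S K L : {set gT}) : algC :=
  if L \subset K then (#|Xset S K :&: Xsharp S L|)%:R else 0.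

Definition Pset (S : {set gT}) := powerset S.

Lemma set0_Pset (S : {set gT}) : set0 \in Pset S.
Proof. by rewrite powersetE sub0set. Qed.

Definition Mmat (S : {set gT}) : 'M[algC]_#|Pset S| :=
  \matrix_(i, j) mKL S (enum_val i) (enum_val j).

(* e_L, defined by x_K = sum_L m_{KL} e_L for all K, i.e. e = M^{-1} x *)
Definition eL (S L : {set gT}) : 'rV[algC]_gN :=
  \sum_(K in Pset S)
    (if (L \in Pset S) && (K \in Pset S) then
       invmx (Mmat S) (enum_rank_in (set0_Pset S) L)
                      (enum_rank_in (set0_Pset S) K)
     else 0) *: xJ S K.

Definition restr (m : nat) (X F : 'M[algC]_m) : 'M[algC]_(\rank X) :=
  row_base X *m F *m pinvmx (row_base X).

(* character of N_W(W_L) on e_L CW_L (right multiplication) *)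
Definition eLCWL (S L : {set gT}) : 'M[algC]_gN :=
  (\sum_(h in <<L>>%g) <<eL S L *m rmul h>>)%MS.

Definition PhiT (S L : {set gT}) (g : gT) : algC :=
  \tr (restr (eLCWL S L) (rmul g)).

Variable n : nat.
Variable sv : 'I_n -> gT.
Variable rho : gT -> 'M[algC]_n.

(* B(alpha_i, alpha_j) = - cos (pi / m_ij), with cos(pi/m) = Re (m.-root (-1)) *)
Definition Gram : 'M[algC]_n :=
  \matrix_(i, j) (- 'Re ((#[sv i * sv j])%g.-root (-1))).

(* reflection s_i on row vectors: alpha_j |-> alpha_j - 2 B(alpha_i,alpha_j) alpha_i *)
Definition refl (i : 'I_n) : 'M[algC]_n :=
  1%:M - \matrix_(j, k) (2 * Gram i j * (k == i)%:R).

Definition geom_rep : Prop :=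
  {in <<[set sv i | i : 'I_n]>>%g &, forall x y, rho (x * y)%g = rho x *m rho y}
  /\ forall i, rho (sv i) = refl i.

Definition Fix (A : {set gT}) : 'M[algC]_n :=
  (\bigcap_(a in A) kermx (rho a - 1%:M))%MS.

Definition perpB (X : 'M[algC]_n) : 'M[algC]_n := kermx (Gram *m X^T).

Definition epsilon (w : gT) : algC := \det (rho w).

Definition alphaL (L : {set gT}) (w : gT) : algC :=
  \det (restr (Fix <<L>>%g) (rho w)).

Definition cuspidal (L : {set gT}) (w : gT) : bool :=
  (w \in <<L>>%g) && (\rank (kermx (rho w - 1%:M) :&: perpB (Fix <<L>>%g))%MS == 0%N).

Definition cusp_classes (L : {set gT}) : {set {set gT}} :=
  [set C in classes <<L>>%g | [forall w in C, cuspidal L w]].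

Definition Tset (S : {set gT}) : {set gT} := [set (s ^ w)%g | s in S, w in <<S>>%g].

Definition capH (R : {set gT}) : 'M[algC]_n :=
  (\bigcap_(t in R) kermx (rho t - 1%:M))%MS.

(* {H_t : t in R} linearly dependent: rank (= codim of intersection) < |R| *)
Definition dependent (R : {set gT}) : bool := (n - \rank (capH R) < #|R|)%N.

(* exterior algebra on generators e_t (t in gT), with basis e_R, R a set,
   e_R = e_{t1} ^ ... ^ e_{tp} for t1 < ... < tp in the enumeration order *)
Definition eN := #|{set gT}|.
Definition ebas (R : {set gT}) : 'rV[algC]_eN := delta_mx 0 (enum_rank R).

Definition inversions (s : seq gT) : nat :=
  (\sum_(i < size s) \sum_(j < size s | (i < j)%N)
     (enum_rank (nth 1%g s j) < enum_rank (nth 1%g s i))%N)%N.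

Definition wedge (s : seq gT) : 'rV[algC]_eN :=
  if uniq s then (-1) ^+ inversions s *: ebas [set x in s] else 0.

Definition osact (w : gT) : 'M[algC]_eN :=
  \sum_(R : {set gT}) (ebas R)^T *m wedge [seq (t ^ w)%g | t <- enum R].

Definition dropi (i : nat) (s : seq gT) := take i s ++ drop i.+1 s.

(* e_U ^ d(e_R) *)
Definition rel (U R : {set gT}) : 'rV[algC]_eN :=
  \sum_(i < #|R|) (-1) ^+ i *: wedge (enum U ++ dropi i (enum R)).

Definition OSideal (S : {set gT}) (p : nat) : 'M[algC]_eN :=
  (\sum_(U in powerset (Tset S))
     \sum_(R in powerset (Tset S) | dependent R && (#|U| + #|R| == p.+1)%N)
        <<rel U R>>)%MS.

Definition EX (S : {set gT}) (p : nat) (X : 'M[algC]_n) : 'M[algC]_eN :=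
  (\sum_(R in powerset (Tset S) | (#|R| == p) && (capH R == X)%MS)
      <<wedge (enum R)>>)%MS.

(* character of N_W(W_L) on A_X = (EX + I^p)/I^p, X = Fix(W_L), p = codim X *)
Definition PsiT (S L : {set gT}) (w : gT) : algC :=
  let X := Fix <<L>>%g in
  let p := (n - \rank X)%N in
  \tr (restr (EX S p X + OSideal S p)%MS (osact w))
  - \tr (restr (OSideal S p) (osact w)).

End Coxeter.

(* Main.v *)
Require Import Defs.
From HB Require Import structures.
From mathcomp Require Import all_boot all_order all_algebra all_fingroup.
From mathcomp Require Import all_solvable all_field all_character.
From mathcomp Require Import ring lra zify.
Import Order.TTheory GRing.Theory Num.Theory.
Set Implicit Arguments. Unset Strict Implicit. Unset Printing Implicit Defensive.
Local Open Scope group_scope.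
Local Open Scope ring_scope.

(* A root [alpha i * w] is a nonnegative or a nonpositive combination of the
   simple roots according to the length of [s_i w] (Tits).  Hence the pointwise
   stabilizer of [Fix W_L] is [W_L], and [N_W(W_L)] is the product of [W_L] with
   the dominant elements, which permute the two simple roots of [L].

   Let [L = {s, t}], [r = s t], and let [w_L] be the longest element of [W_L].
   Up to a nonzero scalar [e_L] is [x_L ((1 + w_L) / 2 - (sum of W_L) / |W_L|)],
   so [Phi~_L + 1] is the permutation character of [N_W(W_L)] on the cosets of
   [<w_L>] in [W_L]; and [A_X] is the sum-zero part of the permutation module on
   the reflections of [W_L], by [a_u a_v |-> v - u].

   The cuspidal elements of [W_L] are the nontrivial powers of [r].  Fix a perfect
   pairing of the cyclic group [<r>] with itself, invariant under [N_W(W_L)], and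
   put [psi_x g = <x, s s^g>] on the centralizer of [x].  Both permutation
   characters are then computed by Fourier inversion on [<r>], because
   [epsilon * alpha_L] is the determinant on the plane spanned by the roots of [L],
   that is, the sign by which [g] acts on [<r>]. *)

Lemma sum_powersetU1 (T : finType) (V : nmodType) (x : T) (A : {set T}) (F : {set T} -> V) :
    x \notin A ->
  \sum_(J in powerset (x |: A)) F J =
  \sum_(J in powerset A) F J + \sum_(J in powerset A) F (x |: J).
Proof.
move=> xA; rewrite (bigID (fun J : {set T} => x \in J)) /= addrC; congr (_ + _).
  apply: eq_bigl => J; rewrite !powersetE; apply/andP/idP => [[JxA xJ]|JA].
    apply/subsetP => y yJ; have /setU1P[yx|//] := subsetP JxA y yJ.
    by rewrite -yx yJ in xJ.
  by rewrite (subset_trans JA (subsetUr _ _)); split=> //; apply: contra xA; apply: (subsetP JA).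
rewrite (reindex_onto (fun J => x |: J) (fun J => J :\ x)) => [|J /andP[_ xJ]]; last exact: setD1K.
apply: eq_bigl => J; rewrite !powersetE setU11 andbT.
apply/andP/idP => [[JxA /eqP JE]|JA].
  apply/subsetP => y yJ; have /setU1P[yx|//] := subsetP JxA y (setU1r x yJ).
  by move: yJ; rewrite -JE yx setD11.
by rewrite setUS // setU1K //; apply: contra xA; apply: (subsetP JA).
Qed.

Lemma oppr1_eq1 : (-1 == 1 :> algC) = false.
Proof. by rewrite -subr_eq0 -opprD oppr_eq0 -mulr2n pnatr_eq0. Qed.

(** * The root of unity [m.-root (-1)] *)

Lemma unit_circle_rotate (R : realFieldType) (a b x y : R) :
    a ^+ 2 + b ^+ 2 = 1 -> x ^+ 2 + y ^+ 2 = 1 -> 0 < b -> 0 <= y -> x <= a ->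
  0 <= y * a - x * b /\ x < x * a + y * b.
Proof.
move=> ab xy b0 y0 xa.
have a1 : a < 1 by rewrite ltNge; apply/negP => ?; nra.
have b_le_y : 0 <= x -> b <= y by move=> x0; rewrite leNgt; apply/negP => ?; nra.
split; case: (lerP 0 x) => x0.
- by have := b_le_y x0; nra.
- case: (lerP 0 a) => a0; first by nra.
  have : y <= b by rewrite leNgt; apply/negP => ?; nra.
  nra.
- by have := b_le_y x0; nra.
by nra.
Qed.

Section RootOfMinusOne.
Variable m : nat.
Hypothesis m_gt1 : (1 < m)%N.
Let z : algC := m.-root (-1).
Let m_gt0 : (0 < m)%N. Proof. exact: ltnW. Qed.
Let m2_gt0 : (0 < m.*2)%N. Proof. by rewrite double_gt0. Qed.

Let z_expm : z ^+ m = -1. Proof. exact: rootCK. Qed.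

Let z_unity : z ^+ m.*2 = 1.
Proof. by rewrite -mul2n mulnC exprM z_expm sqrrN expr1n. Qed.

Let unity_circle (w : algC) : w ^+ m.*2 = 1 -> 'Re w ^+ 2 + 'Im w ^+ 2 = 1.
Proof.
move=> w1; rewrite -normC2_Re_Im; suff -> : `|w| = 1 by rewrite expr1n.
by apply/eqP; rewrite -(@pexpr_eq1 _ _ m.*2) // -normrX w1 normr1.
Qed.

Let unity_real (w : algC) : w ^+ m.*2 = 1 -> 'Im w = 0 -> w = 1 \/ w = -1.
Proof.
move=> w1 Iw0; have := unity_circle w1.
rewrite Iw0 expr0n addr0 -['Re w](_ : w = _); last by rewrite [LHS]Crect Iw0 mulr0 addr0.
by move/eqP; rewrite sqrf_eq1 => /orP[]/eqP; [left | right].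
Qed.

Let rotate_by_conj (u w : algC) :
    u ^+ m.*2 = 1 -> w ^+ m.*2 = 1 -> 0 < 'Im u -> 0 <= 'Im w -> 'Re w <= 'Re u ->
  0 <= 'Im (w * u^*) /\ 'Re w < 'Re (w * u^*).
Proof.
move=> u1 w1 Iu Iw le_wu.
have := @unit_circle_rotate algR (in_algR (Creal_Re u)) (in_algR (Creal_Im u))
  (in_algR (Creal_Re w)) (in_algR (Creal_Im w)).
case=> // [||Im_ge0 Re_lt]; try by apply: val_inj; apply: unity_circle.
by rewrite ReM ImM Re_conj Im_conj !mulrN opprK addrC mulrC.
Qed.

Let exists_primitive_upper :
  exists2 w : algC, (m.*2).-primitive_root w & 0 < 'Im w.
Proof.
have [w w_prim] := C_prim_root_exists m2_gt0; have w1 := prim_expr_order w_prim.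
have Iw_neq0 : 'Im w != 0.
  apply/eqP => /(unity_real w1) w_pm; have := prim_order_dvd w_prim 2.
  by case: w_pm => ->; rewrite ?sqrrN expr1n eqxx => /dvdn_leq; rewrite -mul2n; lia.
have := Creal_Im w; rewrite realE => /orP[] Iw.
  by exists w => //; rewrite lt0r Iw_neq0.
exists w^*; first by rewrite fmorph_primitive_root.
by rewrite Im_conj oppr_gt0 lt_neqAle Iw_neq0.
Qed.

Lemma rootN1_Im_gt0 : 0 < 'Im z.
Proof.
rewrite lt0r Im_rootC_ge0 // andbT; apply/eqP => /(unity_real z_unity)[] z_pm.
  by move/eqP: z_expm; rewrite z_pm expr1n eq_sym oppr1_eq1.
have [w w_prim Iw] := exists_primitive_upper; have w1 := prim_expr_order w_prim.
have wm : w ^+ m = -1.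
  have /eqP : (w ^+ m) ^+ 2 = 1 by rewrite -exprM muln2.
  rewrite sqrf_eq1 => /orP[|/eqP//]; rewrite -(prim_order_dvd w_prim) => /dvdn_leq.
  by rewrite -mul2n; lia.
have Re_le : 'Re w <= -1.
  have := rootC_Re_max m_gt0 wm (ltW Iw); rewrite -/z z_pm raddfN /=.
  by rewrite (Creal_ReP 1 _) ?rpred1.
have : 'Re w ^+ 2 < 1 by rewrite -(unity_circle w1) ltrDl exprn_gt0.
rewrite -sqrrN expr_lt1 //; last by rewrite oppr_ge0 (le_trans Re_le) ?lerN10.
by rewrite ltrNl => /(le_lt_trans Re_le); rewrite ltxx.
Qed.

Let z_Re_max (w : algC) : w ^+ m.*2 = 1 -> 0 <= 'Im w -> w != 1 -> 'Re w <= 'Re z.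
Proof.
move=> w1 Iw w_neq1; rewrite real_leNgt ?Creal_Re //; apply/negP => lt_zw.
have /eqP : (w ^+ m) ^+ 2 = 1 by rewrite -exprM muln2.
rewrite sqrf_eq1 => /orP[]/eqP wm; last first.
  by have := lt_le_trans lt_zw (rootC_Re_max m_gt0 wm Iw); rewrite ltxx.
have Iw_gt0 : 0 < 'Im w.
  rewrite lt0r Iw andbT; apply/eqP => /(unity_real w1)[]; first by move/eqP: w_neq1.
  move=> wN1; have := unity_circle z_unity; rewrite wN1 raddfN /= in lt_zw.
  rewrite (Creal_ReP 1 _) ?rpred1 // in lt_zw => circle.
  have : 'Re z ^+ 2 <= 1 by rewrite -circle lerDl real_exprn_even_ge0 ?Creal_Im.
  rewrite -sqrrN expr_le1 //; first by rewrite lerNl => /(lt_le_trans lt_zw); rewrite ltxx.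
  by rewrite oppr_ge0 ltW // (lt_trans lt_zw) ?ltrN10.
have [Im_ge0 Re_lt] := rotate_by_conj w1 z_unity Iw_gt0 (ltW rootN1_Im_gt0) (ltW lt_zw).
have zw_expm : (z * w^*) ^+ m = -1.
  by rewrite exprMn z_expm -rmorphXn wm /= rmorph1 mulr1.
by have := lt_le_trans Re_lt (rootC_Re_max m_gt0 zw_expm Im_ge0); rewrite ltxx.
Qed.

Let rotate_up (w : algC) : w ^+ m.*2 = 1 -> 0 <= 'Im w -> w != 1 ->
  0 <= 'Im (w * z^*) /\ 'Re w < 'Re (w * z^*).
Proof.
by move=> w1 Iw w_neq1; apply: rotate_by_conj => //; [exact: rootN1_Im_gt0 | exact: z_Re_max].
Qed.

Let z_conj : z * z^* = 1.
Proof. by rewrite -normCK normC2_Re_Im unity_circle. Qed.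

(* Rotating by [z^*] moves a root of unity of the upper half plane towards [1], and
   stays in the upper half plane; so it must stop at [1]. *)
Lemma rootN1_primitive : (m.*2).-primitive_root z.
Proof.
have [w w_prim Iw] := exists_primitive_upper; have w1 := prim_expr_order w_prim.
have wz_unity i : (w * z^* ^+ i) ^+ m.*2 = 1.
  by rewrite exprMn w1 exprAC -rmorphXn z_unity /= rmorph1 expr1n mulr1.
have [i Ii imax] : exists2 i : 'I_m.*2, 0 <= 'Im (w * z^* ^+ i) & forall k : 'I_m.*2,
    0 <= 'Im (w * z^* ^+ k) -> 'Re (w * z^* ^+ k) <= 'Re (w * z^* ^+ i).
  have := @arg_maxP _ algR _ (Ordinal m2_gt0) (fun i : 'I_m.*2 => 0 <= 'Im (w * z^* ^+ i))
    (fun i => in_algR (Creal_Re (w * z^* ^+ i))).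
  by rewrite expr0 mulr1 => /(_ (ltW Iw))[i Ii imax]; exists i => // k /imax.
have wzi : w * z^* ^+ i = 1.
  apply/eqP/contraT => /(rotate_up (wz_unity i) Ii)[Im_ge0 Re_lt].
  have zc_unity : z^* ^+ m.*2 = 1 by rewrite -rmorphXn z_unity /= rmorph1.
  have iS_lt : (i.+1 %% m.*2 < m.*2)%N by rewrite ltn_pmod.
  have := imax (Ordinal iS_lt); rewrite /= (expr_mod _ zc_unity) exprSr mulrA.
  by move=> /(_ Im_ge0)/(lt_le_trans Re_lt); rewrite ltxx.
have wE : w = z ^+ i by rewrite -[LHS]mulr1 -(expr1n _ i) -z_conj mulrC exprMn -mulrA
  [_ * w]mulrC wzi mulr1.
have [k k_prim k_dvd] := prim_order_exists m2_gt0 z_unity.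
suff -> : m.*2 = k by [].
apply/eqP; rewrite eqn_dvd k_dvd (prim_order_dvd w_prim) wE exprAC.
by rewrite (prim_expr_order k_prim) expr1n eqxx.
Qed.

Lemma rootN1_exp_Im_ge0 k : (k <= m)%N -> 0 <= 'Im (z ^+ k).
Proof.
move=> k_le_m; rewrite -(subKn k_le_m); elim: (m - k)%N (leq_subr k m) => [_|i IHi lt_im].
  by rewrite subn0 z_expm raddfN /= (Creal_ImP 1 _) ?rpred1 ?oppr0.
have := IHi (ltnW lt_im); rewrite -subSS subSn // => Im_ge0.
have zk_unity : (z ^+ (m - i.+1).+1) ^+ m.*2 = 1 by rewrite exprAC z_unity expr1n.
have [|Im_rot _] := rotate_up zk_unity Im_ge0; last by rewrite exprSr -mulrA z_conj mulr1 in Im_rot.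
rewrite -(prim_order_dvd rootN1_primitive); apply/negP => /dvdn_leq.
by rewrite -mul2n; lia.
Qed.

End RootOfMinusOne.

(** The Chebyshev numbers [sin (k pi / m) / sin (pi / m)], for [c = cos (pi / m)]. *)
Fixpoint chebU (c : algC) (k : nat) : algC :=
  if k is k1.+1 then (if k1 is k2.+1 then 2 * c * chebU c k1 - chebU c k2 else 1)
  else 0.

Lemma chebUSS c k : chebU c k.+2 = 2 * c * chebU c k.+1 - chebU c k.
Proof. by []. Qed.

Lemma chebU_Im (z : algC) k : `|z| = 1 -> chebU ('Re z) k * 'Im z = 'Im (z ^+ k).
Proof.
move=> z1; have circle : 'Re z ^+ 2 + 'Im z ^+ 2 = 1 by rewrite -normC2_Re_Im z1 expr1n.
suff [] : chebU ('Re z) k * 'Im z = 'Im (z ^+ k) /\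
  chebU ('Re z) k.+1 * 'Im z = 'Im (z ^+ k.+1) by [].
elim: k => [|k [IHk IHk1]]; first by rewrite mul0r mul1r expr0 expr1 (Creal_ImP _ _) ?rpred1.
split=> //; rewrite chebUSS mulrBl -[2 * _ * _ * _]mulrA IHk1 IHk !exprS !ImM !ReM.
set y := 'Im (z ^+ k); have yE : y = y * ('Re z ^+ 2 + 'Im z ^+ 2) by rewrite circle mulr1.
by rewrite [X in _ - X = _]yE; ring.
Qed.

Lemma chebU_ge0 m k : (1 < m)%N -> (k <= m)%N -> 0 <= chebU ('Re (m.-root (-1))) k.
Proof.
move=> m_gt1 k_le_m; rewrite -(pmulr_lge0 _ (rootN1_Im_gt0 m_gt1)) chebU_Im.
  exact: rootN1_exp_Im_ge0.
apply/eqP; rewrite -(@pexpr_eq1 _ _ m) ?(ltnW m_gt1) //.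
by rewrite -normrX rootCK ?(ltnW m_gt1) // normrN1.
Qed.

(** * Words in a generating set *)

Lemma gen_ind (gT : finGroupType) (A : {set gT}) (P : gT -> Prop) :
    P 1%g -> (forall a w, a \in A -> w \in <<A>>%g -> P w -> P (a * w)%g) ->
  forall w, w \in <<A>>%g -> P w.
Proof.
move=> P1 PM _ /gen_prodgP[k [c cA ->]].
elim: k c cA => [|k IHk] c cA; first by rewrite big_ord0.
rewrite big_ord_recl; apply: PM; [exact: cA | | by apply: IHk => i; apply: cA].
by apply: group_prod => i _; apply/mem_gen/cA.
Qed.

Section Words.
Variables (gT : finGroupType) (S : {set gT}).
Implicit Types (u v w s x y : gT) (k : nat).

Lemma words_sub k : words S k \subset <<S>>.
Proof.
elim: k => [|k IHk] /=; first by rewrite sub1set group1.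
by rewrite mul_subG ?subset_gen.
Qed.

Lemma words_gen k w : w \in words S k -> w \in <<S>>%g.
Proof. exact: (subsetP (words_sub k)). Qed.

Lemma words_mul j k u v : u \in words S j -> v \in words S k -> (u * v)%g \in words S (j + k).
Proof.
elim: j u => [|j IHj] u /=; first by move/set1P->; rewrite mul1g.
by case/mulsgP=> s u' sS u'j -> vk; rewrite -mulgA mem_mulg ?IHj.
Qed.

Lemma words1 s : s \in S -> s \in words S 1.
Proof. by move=> sS; rewrite /= mulg1. Qed.

Lemma exists_words w : w \in <<S>> -> exists k, w \in words S k.
Proof.
move: w; apply: gen_ind => [|s w sS _ [k wk]]; first by exists 0; apply: set11.
by exists k.+1; apply: mem_mulg.
Qed.

(* The suffixes of a shortest word are pairwise distinct, so it has at most [#|gT|] letters. *)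
Lemma exists_short_words w : w \in <<S>> -> exists2 k, (k <= #|gT|)%N & w \in words S k.
Proof.
move=> wW; case: (ex_minnP (exists_words wW)) => k wk kmin; exists k => //.
have suffix j : (j <= k)%N -> exists v, (v \in words S j) && [forall i : 'I_j, v \notin words S i].
  move=> le_jk; rewrite -(subKn le_jk).
  elim: (k - j)%N (leq_subr j k) => [_|i IHi lt_ik].
    by exists w; rewrite subn0 wk; apply/forallP => i; apply/negP => /kmin; rewrite leqNgt ltn_ord.
  have [v /andP[]] := IHi (ltnW lt_ik).
  have -> : (k - i = (k - i.+1).+1)%N by lia.
  case/mulsgP=> s u sS uk -> /forallP vmin; exists u; rewrite uk; apply/forallP => l.
  apply/negP => ul; have := vmin (lift ord0 l); rewrite lift0 => /negP; apply.
  exact: mem_mulg.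
have /fin_all_exists[f fP] : forall j : 'I_k.+1, exists v, (v \in words S j) && [forall i : 'I_j,
    v \notin words S i].
  by move=> j; apply: suffix; rewrite -ltnS.
have f_neq (i j : 'I_k.+1) : (i < j)%N -> f i != f j.
  move=> lt_ij; apply/eqP => fij; have /andP[_ /forallP/(_ (Ordinal lt_ij))] := fP j.
  by have /andP[fi _] := fP i; rewrite -fij fi.
have f_inj : injective f.
  by move=> i j fij; apply: val_inj; case: (ltngtP i j) => // /f_neq; rewrite fij eqxx.
by have := leq_card _ f_inj; rewrite card_ord => /ltnW.
Qed.

Lemma len_words w : w \in <<S>> -> w \in words S (len S w).
Proof.
case/exists_short_words=> k k_le wk.
have found : has (fun j => w \in words S j) (iota 0 #|gT|.+1).
  by apply/hasP; exists k; rewrite // mem_iota.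
by have := nth_find 0 found; rewrite nth_iota // -[X in (_ < X)%N](size_iota 0) -has_find.
Qed.

Lemma len_le w k : w \in words S k -> (len S w <= k)%N.
Proof.
move=> wk; rewrite leqNgt; apply/negP => lt.
have := before_find 0 lt; rewrite nth_iota ?add0n ?wk //.
by rewrite -[X in (_ < X)%N](size_iota 0); apply: leq_trans lt (find_size _ _).
Qed.

Lemma len_mull k u v : u \in words S k -> v \in <<S>> -> (len S (u * v)%g <= k + len S v)%N.
Proof. by move=> uk vW; apply/len_le/words_mul/len_words. Qed.

Lemma len_genl s v : s \in S -> v \in <<S>> -> (len S (s * v)%g <= (len S v).+1)%N.
Proof. by move=> sS; rewrite -add1n; apply: len_mull; apply: words1. Qed.

Fixpoint alternating x y k : gT := if k is k'.+1 then (x * alternating y x k')%g else 1%g.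

Lemma alternatingSr x y k :
  alternating x y k.+1 = (alternating x y k * (if odd k then y else x))%g.
Proof.
elim: k x y => [|k IHk] x y; first by rewrite /= mulg1 mul1g.
by rewrite [LHS]/= -/(alternating y x k.+1) IHk mulgA /=; case: odd.
Qed.

Lemma alternating_words x y k : x \in S -> y \in S -> alternating x y k \in words S k.
Proof.
elim: k x y => [|k IHk] x y xS yS /=; first exact: set11.
by rewrite mem_mulg ?IHk.
Qed.

Lemma alternatingD x y j k : alternating x y (j + k) =
  (alternating x y j * (if odd j then alternating y x k else alternating x y k))%g.
Proof.
elim: j x y => [|j IHj] x y; first by rewrite /= mul1g.
by rewrite addSn /= IHj mulgA; case: odd.
Qed.

Lemma alternating_swap x y k : (x * x = 1)%g -> (y * y = 1)%g ->
  alternating x y k = ((x * y) ^+ k * alternating y x k)%g.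
Proof.
move=> x2 y2; elim: k x y x2 y2 => [|k IHk] x y x2 y2; first by rewrite expg0 mul1g.
have shift j : (x * (y * x) ^+ j = (x * y) ^+ j * x)%g.
  by elim: j => [|j IHj]; rewrite ?expg0 ?mul1g ?mulg1 // !expgS -!mulgA IHj !mulgA.
rewrite [LHS]/= IHk // mulgA shift expgSr /= -!mulgA; congr (_ * (_ * _))%g.
by rewrite mulgA y2 mul1g.
Qed.

End Words.

(** * Nonnegative vectors and reflections *)

Section NonnegativeVectors.
Variable R : numDomainType.

Definition nonneg n (v : 'rV[R]_n) : bool := [forall j, 0 <= v 0 j].

Variable n : nat.
Implicit Types u v : 'rV[R]_n.

Lemma nonnegP v : reflect (forall j, 0 <= v 0 j) (nonneg v).
Proof. exact: forallP. Qed.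

Lemma nonnegD u v : nonneg u -> nonneg v -> nonneg (u + v).
Proof. by move=> /nonnegP hu /nonnegP hv; apply/nonnegP => j; rewrite mxE addr_ge0. Qed.

Lemma nonnegZ a v : 0 <= a -> nonneg v -> nonneg (a *: v).
Proof. by move=> a0 /nonnegP hv; apply/nonnegP => j; rewrite mxE mulr_ge0. Qed.

Lemma nonneg_sum I (r : seq I) (P : pred I) (F : I -> 'rV[R]_n) :
  (forall i, P i -> nonneg (F i)) -> nonneg (\sum_(i <- r | P i) F i).
Proof.
move=> F_ge0; elim/big_ind: _ => // [|u v]; last exact: nonnegD.
by apply/nonnegP => j; rewrite mxE.
Qed.

Lemma nonneg_anti v : nonneg v -> nonneg (- v) -> v = 0.
Proof.
move=> /nonnegP v_ge0 /nonnegP v_le0; apply/rowP => j; rewrite mxE; apply/eqP.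
by rewrite eq_le v_ge0 andbT -oppr_ge0; have := v_le0 j; rewrite mxE.
Qed.

Lemma nonneg_sum_delta (I : finType) (P : pred I) (F : I -> 'rV[R]_n) i j k :
    (forall l, P l -> nonneg (F l)) -> \sum_(l | P l) F l = delta_mx 0 i ->
  j != i -> P k -> F k 0 j = 0.
Proof.
move=> F_ge0 sumF ji Pk; have := congr1 (fun v : 'rV_n => v 0 j) sumF.
rewrite /= summxE mxE (negPf ji) andbF => /eqP.
rewrite psumr_eq0 => [/allP/(_ k)|l /F_ge0/nonnegP//].
by rewrite mem_index_enum Pk => /(_ isT)/eqP.
Qed.

Lemma nonneg_delta i : nonneg (delta_mx 0 i : 'rV[R]_n).
Proof. by apply/nonnegP => j; rewrite mxE ler0n. Qed.

Lemma nonneg_deltaN i : nonneg (- delta_mx 0 i : 'rV[R]_n) = false.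
Proof. by apply/nonnegP => /(_ i); rewrite !mxE !eqxx oppr_ge0 ler10. Qed.

End NonnegativeVectors.

Lemma det_1addMC (R : comNzRingType) (m n : nat) (A : 'M[R]_(m, n)) (B : 'M[R]_(n, m)) :
  \det (1%:M + A *m B) = \det (1%:M + B *m A).
Proof.
have block_eq : block_mx (1%:M + A *m B) (- A) 0 1%:M *m block_mx 1%:M 0 B 1%:M
       = block_mx 1%:M 0 B 1%:M *m block_mx 1%:M (- A) 0 (1%:M + B *m A).
  rewrite !mulmx_block !mulmx1 !mul1mx !mulmx0 !mul0mx !addr0 !add0r.
  by rewrite mulNmx addrK mulmxN (addrC (- _)) addrK.
have := congr1 determinant block_eq.
by rewrite !det_mulmx !det_ublock !det_lblock !det1 !mul1r !mulr1.
Qed.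

Section Reflections.
Variables (F : numFieldType) (n : nat) (G : 'M[F]_n).
Hypothesis G_sym : G^T = G.
Implicit Types b c v : 'rV[F]_n.

Definition reflmx b : 'M[F]_n := 1%:M - (2 *: (G *m b^T)) *m b.

Lemma mul_reflmx v b : v *m reflmx b = v - (2 * (v *m G *m b^T) 0 0) *: b.
Proof.
rewrite mulmxBr mulmx1 mulmxA -scalemxAr [v *m (G *m _)]mulmxA; congr (_ - _).
by rewrite -scalemxAl {1}[v *m G *m b^T]mx11_scalar mul_scalar_mx scalerA.
Qed.

Lemma reflmxN b : reflmx (- b) = reflmx b.
Proof. by rewrite /reflmx [(- b)^T]raddfN /= !mulmxN scalerN mulNmx opprK. Qed.

Lemma form_tr_eq0 p q (A : 'M[F]_(p, n)) (B : 'M[F]_(q, n)) :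
  A *m G *m B^T = 0 -> B *m G *m A^T = 0.
Proof. by move/(congr1 trmx); rewrite !trmx_mul trmxK G_sym trmx0 mulmxA. Qed.

Section UnitVector.
Variable b : 'rV[F]_n.
Hypothesis b_unit : b *m G *m b^T = 1%:M.

Lemma form_unit_neq0 : b != 0.
Proof.
by apply/eqP => b0; have := b_unit; rewrite b0 !mul0mx => /matrixP/(_ 0 0)/eqP;
  rewrite !mxE eq_sym oner_eq0.
Qed.

Lemma mul_reflmx_id : b *m reflmx b = - b.
Proof. by rewrite mul_reflmx b_unit mxE mulr1 scaler_nat mulr2n opprD addrA subrr add0r. Qed.

Lemma reflmx_isometry : reflmx b *m G *m (reflmx b)^T = G.
Proof.
have -> : (reflmx b)^T = 1%:M - b^T *m (2 *: (b *m G)).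
  by rewrite /reflmx linearB /= trmx1 trmx_mul linearZ /= trmx_mul trmxK G_sym.
rewrite /reflmx !mulmxBl !mulmxBr !mulmx1 !mul1mx.
set c := G *m b^T; set d := b *m G.
have -> : G *m (b^T *m (2 *: d)) = 2 *: (c *m d) by rewrite mulmxA -scalemxAr.
have -> : 2 *: c *m b *m G *m (b^T *m (2 *: d)) = 2 *: (2 *: (c *m d)).
  rewrite -!(mulmxA _ b) -/d -!scalemxAl; congr (_ *: _).
  by rewrite -(mulmxA c) (mulmxA d) b_unit mul1mx -scalemxAr.
rewrite -(mulmxA _ b) -/d -scalemxAl; move: (2 *: (c *m d)) => y.
by rewrite scaler_nat mulr2n opprB addrK subrK.
Qed.

Lemma reflmxK : reflmx b *m reflmx b = 1%:M.
Proof.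
apply/row_matrixP => i; rewrite !rowE mulmxA [delta_mx 0 i *m reflmx b]mul_reflmx.
rewrite mulmxBl -scalemxAl mul_reflmx_id.
by rewrite mul_reflmx scalerN opprK subrK mulmx1.
Qed.

Lemma det_reflmx : \det (reflmx b) = -1.
Proof.
rewrite /reflmx -mulNmx det_1addMC mulmxN -scalemxAr mulmxA b_unit.
by rewrite det_mx11 !mxE mulr1 opprD addrA subrr add0r.
Qed.

Lemma sub_ker_reflmx m (A : 'M[F]_(m, n)) :
  (A <= kermx (reflmx b - 1%:M))%MS = (A *m G *m b^T == 0).
Proof.
rewrite sub_kermx /reflmx addrAC subrr add0r mulmxN oppr_eq0.
rewrite -scalemxAl -scalemxAr scaler_eq0 pnatr_eq0 /= !mulmxA.
apply/eqP/eqP => [Abb | ->]; last by rewrite mul0mx.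
rewrite -[LHS]mulmx1 -b_unit [_ *m (b *m _ *m _)]mulmxA [_ *m (b *m _)]mulmxA.
by rewrite Abb !mul0mx.
Qed.

Lemma form_unit_scale a c : c *m G *m c^T = 1%:M -> c = a *: b -> a = 1 \/ a = -1.
Proof.
move=> c_unit cE; have : a ^+ 2 == 1.
  move: c_unit; rewrite cE linearZ /= -!scalemxAl -scalemxAr b_unit scalerA => /matrixP/(_ 0 0).
  by rewrite !mxE mulr1 -expr2 => ->.
by rewrite sqrf_eq1 => /orP[]/eqP; [left | right].
Qed.

Lemma form_unit_sub c : c *m G *m c^T = 1%:M -> (c <= b)%MS -> c = b \/ c = - b.
Proof.
move=> c_unit /sub_rVP[a cE]; case: (form_unit_scale c_unit cE) => a1; rewrite cE a1.
  by left; rewrite scale1r.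
by right; rewrite scaleN1r.
Qed.

Lemma reflmx_sub c : c *m G *m c^T = 1%:M -> (c <= b)%MS -> reflmx c = reflmx b.
Proof. by move=> c_unit /(form_unit_sub c_unit)[]->; rewrite ?reflmxN. Qed.

End UnitVector.
End Reflections.

Lemma reflmx_inj (F : numFieldType) n (G : 'M[F]_n) (b c : 'rV[F]_n) :
    b *m G *m b^T = 1%:M -> c *m G *m c^T = 1%:M -> reflmx G b = reflmx G c ->
  b = c \/ b = - c.
Proof.
move=> b_unit c_unit bc; apply: (form_unit_sub c_unit) => //.
have := mul_reflmx_id b_unit; rewrite bc mul_reflmx => bE; apply/sub_rVP.
exists ((b *m G *m c^T) 0 0); apply: (scalerI (_ : 2 != 0)); first by rewrite pnatr_eq0.
rewrite scalerA scaler_nat mulr2n.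
by rewrite -{2}[b]opprK -bE opprB addrC subrK.
Qed.

(** * Traces and determinants on invariant subspaces *)

Lemma det_similar (R : comNzRingType) p q (P : 'M[R]_(p, q)) (Q : 'M_(q, p)) (A : 'M_q) :
  P *m Q = 1%:M -> Q *m P = 1%:M -> \det (P *m A *m Q) = \det A.
Proof.
move=> PQ QP; have -> : P *m A *m Q = 1%:M + P *m ((A - 1%:M) *m Q).
  by rewrite mulmxBl mul1mx mulmxBr PQ mulmxA addrC subrK.
by rewrite det_1addMC -mulmxA QP mulmx1 addrC subrK.
Qed.

Section Restriction.
Variable m : nat.
Implicit Types (X Y I F : 'M[algC]_m).

Lemma restrK X F : stablemx X F -> restr X F *m row_base X = row_base X *m F.
Proof. by move=> XF; rewrite mulmxKpV // stablemx_row_base. Qed.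

Lemma restr_similar k X F (B : 'M_(k, m)) (A : 'M_k) :
    row_free B -> (B :=: X)%MS -> B *m F = A *m B ->
  exists P Q, [/\ P *m Q = 1%:M, Q *m P = 1%:M & restr X F = P *m A *m Q].
Proof.
move=> Bfree BX BF; set Rb := row_base X.
have Rfree : row_free Rb by apply: row_base_free.
have RX : (Rb :=: X)%MS := eq_row_base X.
pose P := Rb *m pinvmx B; pose Q := B *m pinvmx Rb.
have PB : P *m B = Rb by rewrite mulmxKpV // RX BX.
have QR : Q *m Rb = B by rewrite mulmxKpV // RX BX.
exists P, Q; split.
- by apply: (row_free_inj Rfree); rewrite -mulmxA QR PB mul1mx.
- by apply: (row_free_inj Bfree); rewrite -mulmxA PB QR mul1mx.
by rewrite /restr -/Rb -{1}PB -(mulmxA P) BF /Q !mulmxA.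
Qed.

Lemma tr_restr_basis k X F (B : 'M_(k, m)) (A : 'M_k) :
  row_free B -> (B :=: X)%MS -> B *m F = A *m B -> \tr (restr X F) = \tr A.
Proof.
move=> Bfree BX BF; have [P [Q [_ QP ->]]] := restr_similar Bfree BX BF.
by rewrite -mulmxA mxtrace_mulC -mulmxA QP mulmx1.
Qed.

Lemma det_restr_basis k X F (B : 'M_(k, m)) (A : 'M_k) :
  row_free B -> (B :=: X)%MS -> B *m F = A *m B -> \det (restr X F) = \det A.
Proof.
move=> Bfree BX BF; have [P [Q [PQ QP ->]]] := restr_similar Bfree BX BF.
exact: det_similar.
Qed.

Lemma tr_restr_id X : \tr (restr X 1%:M) = (\rank X)%:R.
Proof.
rewrite (@tr_restr_basis _ _ _ (row_base X) 1%:M) ?row_base_free ?mulmx1 ?mul1mx ?mxtrace1 //.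
exact: eq_row_base.
Qed.

Lemma det_restr_direct X Y F :
    (X + Y :=: 1%:M)%MS -> (X :&: Y = 0)%MS -> stablemx X F -> stablemx Y F ->
  \det F = \det (restr X F) * \det (restr Y F).
Proof.
move=> XY XY0 XF YF; pose B := col_mx (row_base X) (row_base Y).
have B1 : (B :=: 1%:M)%MS.
  apply: eqmx_trans (eqmx_sym (addsmxE _ _)) (eqmx_trans _ XY).
  by apply: adds_eqmx; apply: eq_row_base.
have Bfree : row_free B.
  by rewrite /row_free B1 -XY -(mxrank_disjoint_sum XY0).
have BF : B *m F = block_mx (restr X F) 0 0 (restr Y F) *m B.
  by rewrite mul_col_mx mul_block_col !mul0mx addr0 add0r !restrK.
pose Q := pinvmx B; have BQ : B *m Q = 1%:M by apply: mulmxVp.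
have QB : Q *m B = 1%:M by rewrite -[LHS]mul1mx mulmxA mulmxKpV // B1.
rewrite -(det_similar F BQ QB) BF -mulmxA BQ mulmx1.
by rewrite det_ublock.
Qed.

Lemma tr_restr_idem k X F (E P : 'M_k) (B : 'M_(k, m)) (C : 'M_(m, k)) :
    E *m E = E -> E *m P = P *m E -> B *m F = P *m B ->
    E *m B *m C = E -> (E *m B :=: X)%MS ->
  \tr (restr X F) = \tr (E *m P).
Proof.
move=> EE EP BF EBC EX.
have [q [K [Q [KQ Qfree Kfull]]]] : exists q (K : 'M[algC]_(k, q)) (Q : 'M[algC]_(q, k)),
    [/\ K *m Q = E, row_free Q & row_full K].
  exists (\rank E), (col_base E), (row_base E).
  by rewrite mulmx_base row_base_free col_base_full.
have QK : Q *m K = 1%:M.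
  apply: (row_free_inj Qfree); apply: (row_full_inj Kfull).
  by rewrite mul1mx 2!mulmxA KQ -mulmxA KQ EE.
have QE : Q *m E = Q by rewrite -KQ mulmxA QK mul1mx.
rewrite (@tr_restr_basis _ _ _ (Q *m B) (Q *m P *m K)).
- by rewrite -mulmxA mxtrace_mulC -mulmxA KQ EP.
- apply/row_freeP; exists (C *m K).
  by rewrite mulmxA -{1}QE -!(mulmxA Q) EBC mulmxA QE.
- apply: eqmx_trans EX; apply/eqmxP/andP; split.
    by rewrite -[Q in (Q *m B <= _)%MS]QE -mulmxA submxMl.
  by rewrite -KQ -mulmxA submxMl.
rewrite -(mulmxA Q B) BF mulmxA [in RHS]mulmxA -(mulmxA _ K) KQ -(mulmxA Q P E) -EP.
by rewrite (mulmxA Q E) QE.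
Qed.

End Restriction.

Lemma row_free_lift (F : fieldType) m k l r (B : 'M[F]_(k, m)) (C : 'M_(l, m)) (D : 'M_(m, r)) :
  row_free B -> B *m D = 0 -> row_free (C *m D) -> row_free (col_mx B C).
Proof.
move=> Bfree BD CDfree; apply: inj_row_free => v.
rewrite -[v]hsubmxK mul_row_col => v0.
have v2 : rsubmx v = 0.
  apply: (row_free_inj CDfree); rewrite mul0mx -[RHS](mul0mx _ D) -v0.
  by rewrite mulmxDl -mulmxA BD mulmx0 add0r mulmxA.
have v1 : lsubmx v = 0.
  by apply: (row_free_inj Bfree); rewrite mul0mx; move: v0; rewrite v2 mul0mx addr0.
by rewrite v1 v2 row_mx0.
Qed.

Section Quotient.
Variables (m k : nat) (Y I F : 'M[algC]_m) (D : 'M[algC]_(m, k)) (Z F' : 'M[algC]_k).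
Hypotheses (sub_IY : (I <= Y)%MS) (YF : stablemx Y F) (IF : stablemx I F).
Hypothesis ID : I *m D = 0.
Hypothesis ker_D : forall v : 'rV_m, (v <= Y)%MS -> v *m D = 0 -> (v <= I)%MS.
Hypothesis ZYD : (Z :=: Y *m D)%MS.
Hypothesis YFD : Y *m F *m D = Y *m D *m F'.

Let ker_D_mx p (V : 'M_(p, m)) : (V <= Y)%MS -> V *m D = 0 -> (V <= I)%MS.
Proof.
move=> VY VD; apply/row_subP => i; apply: ker_D; first exact: submx_trans (row_sub _ _) VY.
by rewrite -row_mul VD row0.
Qed.

Lemma tr_restr_quotient : \tr (restr Y F) - \tr (restr I F) = \tr (restr Z F').
Proof.
set B := row_base I; set B' := row_base Z.
have BI : (B :=: I)%MS := eq_row_base I.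
have B'Z : (B' :=: Z)%MS := eq_row_base Z.
have B'YD : (B' :=: Y *m D)%MS := eqmx_trans B'Z ZYD.
have BD : B *m D = 0.
  by have /submxP[T ->] : (B <= I)%MS by [rewrite BI]; rewrite -mulmxA ID mulmx0.
have /submxP[K B'K] : (B' <= Y *m D)%MS by rewrite B'YD.
pose C := K *m Y; have CY : (C <= Y)%MS by apply: submxMl.
have CD : C *m D = B' by rewrite -mulmxA -B'K.
have /submxP[A eA] : (B *m F <= B)%MS by rewrite stablemx_row_base.
have /submxP[A' eA'] : (B' *m F' <= B')%MS.
  have -> : B' *m F' = K *m (Y *m F *m D) by rewrite YFD [in LHS]B'K !mulmxA.
  by rewrite B'YD mulmx_sub // submxMr.
have /submxP[T eT] : (C *m F - A' *m C <= B)%MS.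
  rewrite BI; apply: ker_D_mx.
    apply: addmx_sub; first exact: submx_trans (submxMr _ CY) YF.
    by rewrite eqmx_opp mulmx_sub.
  rewrite mulmxBl -[A' *m C *m D]mulmxA CD -eA' -CD /C -!mulmxA.
  by rewrite (mulmxA Y F) YFD -!mulmxA subrr.
have BC : (col_mx B C :=: Y)%MS.
  apply/eqmxP/andP; split; first by rewrite col_mx_sub CY BI sub_IY.
  apply/row_subP => i.
  have /submxP[w vw] : (row i Y *m D <= B')%MS by rewrite B'YD submxMr ?row_sub.
  rewrite -[row i Y](subrK (w *m C)) -addsmxE addmx_sub_adds ?submxMl // BI.
  apply: ker_D; last by rewrite mulmxBl vw -mulmxA CD subrr.
  by rewrite addmx_sub ?row_sub ?eqmx_opp ?mulmx_sub.
rewrite (@tr_restr_basis _ _ Y F (col_mx B C) (block_mx A 0 T A')) //.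
- rewrite mxtrace_block (@tr_restr_basis _ _ I F B A) ?row_base_free // addrAC subrr add0r.
  by rewrite (@tr_restr_basis _ _ _ _ B' A') ?row_base_free.
- by apply: (row_free_lift (D := D)); rewrite ?CD ?row_base_free.
by rewrite mul_col_mx mul_block_col mul0mx addr0 eA -eT subrK.
Qed.

End Quotient.

Lemma eqmx_of_sub (F : fieldType) m1 m2 n (A : 'M[F]_(m1, n)) (B : 'M[F]_(m2, n)) :
  (forall C : 'M[F]_n, (C <= A)%MS = (C <= B)%MS) -> (A :=: B)%MS.
Proof.
move=> sub_eq; apply/eqmxP/andP; split.
  by have := sub_eq <<A>>%MS; rewrite !genmxE submx_refl => <-.
by have := sub_eq <<B>>%MS; rewrite !genmxE submx_refl => ->.
Qed.

Lemma det_mx22 (R : comNzRingType) (A : 'M[R]_2) : \det A = A 0 0 * A 1 1 - A 0 1 * A 1 0.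
Proof.
rewrite (expand_det_row _ 0) !big_ord_recl big_ord0 addr0 /cofactor !det_mx11 !mxE /=.
rewrite expr0 mul1r expr1 mulN1r mulrN.
by congr (A _ _ * A _ _ - A _ _ * A _ _); apply: val_inj.
Qed.

(* Such a matrix is unipotent: [N := A - 1] is singular of trace [0], so [N ^+ 2 = 0] and
   [A ^+ k = 1 + k N]. *)
Lemma mx22_finite_order_eq1 (F : numFieldType) (A : 'M[F]_2) k :
  (0 < k)%N -> A ^+ k = 1 -> \det A = 1 -> \det (A - 1) = 0 -> A = 1.
Proof.
move=> k_gt0 Ak detA; set N := A - 1 => detN.
have AE : A = 1 + N by rewrite addrC subrK.
clearbody N.
have trN : N 0 0 + N 1 1 = 0.
  have := det_mx22 A; rewrite detA AE; have := det_mx22 N; rewrite detN.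
  rewrite !mxE /=; move: (N 0 0) (N 0 1) (N 1 0) (N 1 1) => a b c d detN_E detA_E.
  have -> : a + d = (1 + a) * (1 + d) - (0 + b) * (0 + c) - 1 - (a * d - b * c) by ring.
  by rewrite -detN_E -detA_E subr0 subrr.
have NN : N * N = 0.
  have /esym := det_mx22 N; rewrite detN => h.
  have dE : N 1 1 = - N 0 0 by apply/eqP; rewrite -addr_eq0 addrC trN.
  have n2 : N 0 0 * N 0 0 + N 0 1 * N 1 0 = 0.
    by rewrite -[RHS]oppr0 -h dE; ring.
  have ord2 (i : 'I_2) : i = 0 \/ i = 1.
    by case: i => [[|[|//]] ?]; [left | right]; apply: val_inj.
  have sum2 (f : 'I_2 -> F) : \sum_k f k = f 0 + f 1.
    by rewrite !big_ord_recl big_ord0 addr0; congr (f _ + f _); apply: val_inj.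
  apply/matrixP => i j; rewrite mxE sum2 [RHS]mxE.
  by case: (ord2 i) => ->; case: (ord2 j) => ->; rewrite ?dE; first [ring | rewrite -n2; ring].
have NkE j : A ^+ j = 1 + N *+ j.
  elim: j => [|j IHj]; first by rewrite expr0 mulr0n addr0.
  rewrite exprS IHj AE mulrDl mul1r mulrDr mulr1 mulrnAr NN mul0rn addr0 mulrS.
  by rewrite -addrA [_ + N]addrC.
have : N *+ k == 0 by rewrite -(addKr 1 (N *+ k)) -NkE Ak addNr.
by rewrite -scaler_nat scaler_eq0 pnatr_eq0 gtn_eqF //= => /eqP N0; rewrite AE N0 addr0.
Qed.

(** * Permutation modules *)

Section BasisMap.
Variables (T : finType) (F : fieldType).
Local Notation bas x := (delta_mx 0 (enum_rank x) : 'rV[F]_#|T|).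

Definition basis_map k (h : T -> 'rV[F]_k) : 'M[F]_(#|T|, k) := \matrix_i h (enum_val i).

Lemma basis_mapE k (h : T -> 'rV[F]_k) x : bas x *m basis_map h = h x.
Proof. by rewrite -rowE rowK enum_rankK. Qed.

Lemma basis_coord x y : bas x 0 (enum_rank y) = (x == y)%:R.
Proof. by rewrite mxE eqxx (inj_eq enum_rank_inj) eq_sym. Qed.

Lemma basis_ext k (A B : 'M[F]_(#|T|, k)) : (forall x, bas x *m A = bas x *m B) -> A = B.
Proof.
by move=> AB; apply/row_matrixP => i; rewrite !rowE -(enum_valK i) AB.
Qed.

Lemma basis_sub k p (A : 'M[F]_(#|T|, k)) (Z : 'M[F]_(p, k)) :
  (forall x, (bas x *m A <= Z)%MS) -> (A <= Z)%MS.
Proof. by move=> AZ; apply/row_subP => i; rewrite rowE -(enum_valK i). Qed.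

Lemma sum_basis_map k (A : pred T) (h : T -> 'rV[F]_k) :
  \sum_(x | A x) (bas x)^T *m h x = basis_map (fun x => if A x then h x else 0).
Proof.
apply: basis_ext => y; rewrite basis_mapE big_mkcond mulmx_sumr (bigD1 y) //= big1 => [|x xy].
  case: ifP => _; last by rewrite mulmx0 addr0.
  rewrite mulmxA trmx_delta mul_delta_mx addr0.
  by rewrite [X in X *m _](_ : _ = 1%:M) ?mul1mx //; apply/matrixP => a b; rewrite !ord1 !mxE.
case: ifP => _; last by rewrite mulmx0.
by rewrite mulmxA trmx_delta mul_delta_mx_0 ?mul0mx // (inj_eq enum_rank_inj) eq_sym.
Qed.

Lemma mul_basis_map k l (h : T -> 'rV[F]_k) (A : 'M_(k, l)) :
  basis_map h *m A = basis_map (fun x => h x *m A).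
Proof. by apply: basis_ext => x; rewrite mulmxA !basis_mapE. Qed.

Lemma tr_basis_map (h : T -> 'rV[F]_#|T|) : \tr (basis_map h) = \sum_x h x 0 (enum_rank x).
Proof.
rewrite /mxtrace (reindex enum_rank) /=; last exact: onW_bij (@enum_rank_bij T).
by apply: eq_bigr => x _; rewrite mxE enum_rankK.
Qed.

End BasisMap.

Section PermutationModule.
Variable T : finType.
Implicit Types (A : {set T}) (f : T -> T).
Local Notation bas x := (delta_mx 0 (enum_rank x) : 'rV[algC]_#|T|).

Definition perm_map f : 'M[algC]_#|T| := basis_map (fun x => bas (f x)).

Definition coord_proj A : 'M[algC]_#|T| := basis_map (fun x => if x \in A then bas x else 0).

Definition zero_sum A : 'M[algC]_#|T| :=
  (\sum_(x in A) \sum_(y in A) <<bas y - bas x>>)%MS.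

Lemma coord_projK A : coord_proj A *m coord_proj A = coord_proj A.
Proof.
apply: basis_ext => x; rewrite mulmxA !basis_mapE; case: ifP => xA; last by rewrite mul0mx.
by rewrite basis_mapE xA.
Qed.

Lemma zero_sum_subP A p (Z : 'M_(p, #|T|)) :
  (zero_sum A <= Z)%MS <-> (forall x y, x \in A -> y \in A -> (bas y - bas x <= Z)%MS).
Proof.
split=> [/sumsmx_subP AZ x y xA yA|AZ].
  by have /sumsmx_subP/(_ y yA) := AZ x xA; rewrite genmxE.
by apply/sumsmx_subP => x xA; apply/sumsmx_subP => y yA; rewrite genmxE AZ.
Qed.

Lemma mem_zero_sum A x y : x \in A -> y \in A -> (bas y - bas x <= zero_sum A)%MS.
Proof. by move=> xA yA; have /zero_sum_subP := submx_refl (zero_sum A); apply. Qed.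

Lemma basis_coord_proj A x : x \in A -> (bas x <= coord_proj A)%MS.
Proof. by move=> xA; have := submxMl (bas x) (coord_proj A); rewrite basis_mapE xA. Qed.

Section InvariantSubset.
Variables (A : {set T}) (f : T -> T) (a : T).
Hypotheses (fA : forall x, (f x \in A) = (x \in A)) (aA : a \in A).

Let sum_coords : 'M[algC]_(#|T|, 1) := basis_map (fun=> 1%:M).

Lemma coord_proj_perm : coord_proj A *m perm_map f = perm_map f *m coord_proj A.
Proof.
apply: basis_ext => x; rewrite !mulmxA !basis_mapE fA.
by case: ifP => xA; rewrite ?mul0mx // basis_mapE.
Qed.

Lemma tr_restr_coord_proj :
  \tr (restr (coord_proj A) (perm_map f)) = #|[set x in A | f x == x]|%:R.
Proof.
rewrite (@tr_restr_idem _ _ _ _ (coord_proj A) (perm_map f) 1%:M 1%:M).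
- rewrite mul_basis_map tr_basis_map -[#|[set x in A | _]|]sum1_card natr_sum.
  rewrite [RHS]big_mkcond.
  apply: eq_bigr => x _; rewrite inE; case: (x \in A) => /=; last by rewrite mul0mx mxE.
  by rewrite basis_mapE basis_coord; case: eqP.
- exact: coord_projK.
- exact: coord_proj_perm.
- by rewrite mulmx1 mul1mx.
- by rewrite !mulmx1.
- by rewrite mulmx1.
Qed.

(* The quotient of the permutation module by its sum-zero part is the trivial module. *)
Lemma tr_restr_zero_sum :
  \tr (restr (zero_sum A) (perm_map f)) = #|[set x in A | f x == x]|%:R - 1.
Proof.
rewrite -tr_restr_coord_proj.
suff quot : \tr (restr (coord_proj A) (perm_map f)) - \tr (restr (zero_sum A) (perm_map f)) = 1.
  by rewrite -[X in _ - X]quot opprB addrC subrK.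
have stable_A : (coord_proj A *m perm_map f <= coord_proj A)%MS.
  by rewrite coord_proj_perm submxMl.
rewrite (@tr_restr_quotient _ _ _ _ _ sum_coords 1%:M 1%:M) //.
- by rewrite tr_restr_id mxrank1.
- apply/zero_sum_subP => x y xA yA.
  by rewrite addmx_sub ?eqmx_opp ?basis_coord_proj.
- rewrite submxE -mulmxA -sub_kermx; apply/zero_sum_subP => x y xA yA.
  by rewrite sub_kermx mulmxA -submxE mulmxBl !basis_mapE mem_zero_sum ?fA.
- apply/eqP; rewrite -sub_kermx; apply/zero_sum_subP => x y _ _.
  by rewrite sub_kermx mulmxBl !basis_mapE subrr.
- move=> v vA v0; have vE : v = v *m coord_proj A.
    by case/submxP: vA => w ->; rewrite -mulmxA coord_projK.
  have -> : v = v *m (coord_proj A - sum_coords *m bas a).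
    by rewrite mulmxBr -vE mulmxA v0 mul0mx subr0.
  rewrite vE -mulmxA mulmx_sub //; apply: basis_sub => x; rewrite mulmxA basis_mapE.
  case: ifP => xA; last by rewrite mul0mx sub0mx.
  by rewrite mulmxBr mulmxA !basis_mapE xA mul1mx mem_zero_sum.
- apply/eqmxP; rewrite submx1 andbT; have := submxMl (bas a) (coord_proj A *m sum_coords).
  by rewrite mulmxA basis_mapE aA basis_mapE.
by rewrite mulmx1 -mulmxA; congr (_ *m _); apply: basis_ext => x; rewrite mulmxA !basis_mapE.
Qed.

End InvariantSubset.
End PermutationModule.

(** * Exterior products of two generators *)

Section SortedEnumeration.
Variable T : finType.
Implicit Types (a b : T) (A : {set T}).
Local Notation rk := (@enum_rank T).

Lemma enum_rank_sorted A : sorted (fun x y => rk x < rk y)%N (enum A).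
Proof.
case: (pickP (mem A)) => [x0 _|A0]; last first.
  by have -> : enum A = [::] by apply: size0nil; rewrite -cardE; apply: eq_card0.
rewrite /enum_mem; apply: sorted_filter; first by move=> y x z; apply: ltn_trans.
have : sorted ltn (map (fun x => val (rk x)) (enum T)).
  suff -> : map (fun x => val (rk x)) (enum T) = iota 0 #|T| by apply: iota_ltn_sorted.
  rewrite -val_enum_ord (map_comp val rk); congr map.
  apply: (@eq_from_nth _ (rk x0)); first by rewrite size_map -cardE size_enum_ord.
  move=> i; rewrite size_map -cardE => lt; rewrite (nth_map x0) -?cardE //.
  apply: val_inj; rewrite /= nth_enum_ord //.
  by have := enum_valK (Ordinal lt); rewrite (enum_val_nth x0) => ->.
by rewrite sorted_map enumT.
Qed.

Lemma enum_set2 a b : (rk a < rk b)%N -> enum [set a; b] = [:: a; b].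
Proof.
move=> lt; have tr : transitive (fun x y : T => rk x < rk y)%N by move=> y x z; apply: ltn_trans.
apply: (irr_sorted_eq tr) => [x|||x]; first exact: ltnn.
- exact: enum_rank_sorted.
- by rewrite /= lt.
by rewrite mem_enum !inE.
Qed.

Lemma enum_rank_wlog (P : T -> T -> Prop) :
    (forall a, P a a) -> (forall a b, P a b -> P b a) ->
    (forall a b, (rk a < rk b)%N -> P a b) ->
  forall a b, P a b.
Proof.
move=> Pdiag Psym Plt a b; have [->//|ab] := eqVneq a b.
have : val (rk a) != val (rk b) by rewrite (inj_eq val_inj) (inj_eq enum_rank_inj).
by rewrite neq_ltn => /orP[] lt; [apply: Plt | apply/Psym/Plt].
Qed.

End SortedEnumeration.

Lemma cards3_uniq (T : finType) (a b c : T) : uniq [:: a; b; c] -> #|[set a; b; c]| = 3%N.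
Proof.
move/card_uniqP=> abc_card; rewrite -[RHS]abc_card; apply: eq_card => x.
by rewrite !inE orbA.
Qed.

Section Wedge.
Variable gT : finGroupType.
Implicit Types (a b c g h w x y : gT).
Local Notation rk := (@enum_rank gT).

Lemma gvec_map k (h : gT -> 'rV[algC]_k) x : gvec x *m basis_map h = h x.
Proof. exact: basis_mapE. Qed.

Lemma gvec_coord x y : gvec x 0 (enum_rank y) = (x == y)%:R.
Proof. exact: basis_coord. Qed.

Lemma ebas_map k (h : {set gT} -> 'rV[algC]_k) R : ebas R *m basis_map h = h R.
Proof. exact: basis_mapE. Qed.

Lemma gvec_rmul x h : gvec x *m rmul h = gvec (x * h)%g.
Proof. by rewrite /rmul (sum_basis_map predT (fun y => gvec (y * h)%g)); apply: basis_mapE. Qed.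

Lemma ebas_osact (R : {set gT}) w : ebas R *m osact w = wedge [seq (t ^ w)%g | t <- enum R].
Proof.
rewrite /osact (sum_basis_map predT (fun R : {set gT} => wedge [seq (t ^ w)%g | t <- enum R])).
exact: basis_mapE.
Qed.

Lemma inversions2 a b : inversions [:: a; b] = (rk b < rk a)%N.
Proof.
rewrite /inversions /= !big_ord_recl big_ord0 !big_mkcond !big_ord_recl !big_ord0 /=.
by rewrite [X in (_ + (X + _))%N]big_mkcond !big_ord_recl big_ord0 /= !addn0.
Qed.

Lemma wedge_diag a : wedge [:: a; a] = 0.
Proof. by rewrite /wedge /= inE eqxx. Qed.

Lemma wedge_lt a b : (rk a < rk b)%N -> wedge [:: a; b] = ebas [set a; b].
Proof.
move=> lt; have ab : a != b by apply/negP => /eqP e; rewrite e ltnn in lt.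
rewrite /wedge /= inE ab inversions2 ltnNge (ltnW lt) /= expr0 scale1r.
by congr ebas; apply/setP => x; rewrite !inE.
Qed.

Lemma wedgeN a b : wedge [:: b; a] = - wedge [:: a; b].
Proof.
have [->|ab] := eqVneq a b; first by rewrite wedge_diag oppr0.
rewrite /wedge /= !inE eq_sym ab !inversions2.
have -> : [set x in [:: b; a]] = [set x in [:: a; b]] by apply/setP => x; rewrite !inE orbC.
have : val (rk a) != val (rk b) by rewrite (inj_eq val_inj) (inj_eq enum_rank_inj).
by case: ltngtP => //= _ _; rewrite ?expr0 ?expr1 ?scale1r ?scaleN1r ?opprK.
Qed.

Lemma wedge_osact a b w : wedge [:: a; b] *m osact w = wedge [:: (a ^ w)%g; (b ^ w)%g].
Proof.
move: a b; apply: enum_rank_wlog => [a|a b e|a b lt]; first by rewrite !wedge_diag mul0mx.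
  by rewrite wedgeN mulNmx e -wedgeN.
by rewrite wedge_lt // ebas_osact enum_set2.
Qed.

Definition boundary3 a b c := wedge [:: b; c] - wedge [:: a; c] + wedge [:: a; b].

Lemma boundary3_osact a b c w :
  boundary3 a b c *m osact w = boundary3 (a ^ w)%g (b ^ w)%g (c ^ w)%g.
Proof. by rewrite /boundary3 mulmxDl mulmxBl !wedge_osact. Qed.

Lemma boundary3_swap12 a b c : boundary3 b a c = - boundary3 a b c.
Proof.
by rewrite /boundary3 (wedgeN a b) !opprD opprK [in RHS]addrAC [in RHS]addrC addrA addrAC.
Qed.

Lemma boundary3_swap23 a b c : boundary3 a c b = - boundary3 a b c.
Proof.
by rewrite /boundary3 (wedgeN b c) !opprD opprK -!addrA; congr (_ + _); apply: addrC.
Qed.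

Lemma rel_set0 (R : {set gT}) a b c :
  enum R = [:: a; b; c] -> Defs.rel set0 R = boundary3 a b c.
Proof.
move=> eR; have cR : #|R| = 3%N by rewrite cardE eR.
rewrite /Defs.rel cR !big_ord_recl big_ord0 /= enum_set0 eR /= expr0 scale1r expr1 scaleN1r.
by rewrite -signr_odd expr0 scale1r addr0 addrA.
Qed.

Lemma rel_set0_sub p (Z : 'M[algC]_(p, eN gT)) a b c : uniq [:: a; b; c] ->
  (Defs.rel set0 [set a; b; c] <= Z)%MS = (boundary3 a b c <= Z)%MS.
Proof.
move=> abc_uniq.
have : perm_eq (enum [set a; b; c]) [:: a; b; c].
  by apply: uniq_perm => // [|x]; [exact: enum_uniq | rewrite mem_enum !inE orbA].
case e: (enum _) => [|x [|y [|z [|? ?]]]] xyz; have := perm_size xyz => //= _.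
rewrite (rel_set0 e).
have : uniq [:: x; y; z] by rewrite (perm_uniq xyz).
have : [/\ x \in [:: a; b; c], y \in [:: a; b; c] & z \in [:: a; b; c]].
  by rewrite -!(perm_mem xyz) !inE !eqxx !orbT.
have subN (A B : 'rV[algC]_(eN gT)) : A = - B -> (A <= Z)%MS = (B <= Z)%MS.
  by move=> ->; rewrite eqmx_opp.
rewrite !inE; case=> /or3P[]/eqP-> /or3P[]/eqP-> /or3P[]/eqP->.
all: rewrite /= ?inE ?eqxx ?orbT ?andbF //= => _.
- by apply: subN; apply: boundary3_swap23.
- by apply: subN; apply: boundary3_swap12.
- by rewrite boundary3_swap23 boundary3_swap12 opprK.
- by rewrite boundary3_swap12 boundary3_swap23 opprK.
by rewrite boundary3_swap12 boundary3_swap23 boundary3_swap12 !opprK eqmx_opp.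
Qed.

End Wedge.

(** * A self-duality of a cyclic group *)

Section CyclicPairing.
Variables (gT : finGroupType) (r : gT).
Local Notation R := <[r]>%g.
Implicit Types (x y z : gT) (k : nat).

Definition omega : algC := sval (C_prim_root_exists (order_gt0 r)).

Definition cycle_log x : nat := odflt 0%N (omap val [pick i : 'I_#[r]%g | (r ^+ i)%g == x]).

Definition pairing x y : algC := omega ^+ (cycle_log x * cycle_log y).

Lemma omega_primitive : (#[r]%g).-primitive_root omega.
Proof. exact: svalP (C_prim_root_exists (order_gt0 r)). Qed.

Lemma cycle_logK x : x \in R -> (r ^+ cycle_log x = x)%g.
Proof.
move=> xR; rewrite /cycle_log; case: pickP => [i /eqP//|no_log].
have [i lt_i xE] := cyclePmin xR.
by have := no_log (Ordinal lt_i); rewrite /= xE eqxx.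
Qed.

Lemma omega_exp i j : (r ^+ i = r ^+ j)%g -> omega ^+ i = omega ^+ j.
Proof.
move/eqP; rewrite eq_expg_mod_order => ij; apply/eqP.
by rewrite (eq_prim_root_expr omega_primitive).
Qed.

Lemma pairingC x y : pairing x y = pairing y x.
Proof. by rewrite /pairing mulnC. Qed.

Lemma pairingMr x y z : y \in R -> z \in R -> pairing x (y * z)%g = pairing x y * pairing x z.
Proof.
move=> yR zR; rewrite /pairing -exprD -mulnDr !(mulnC (cycle_log x)) !exprM.
by congr (_ ^+ _); apply: omega_exp; rewrite expgD !cycle_logK ?groupM.
Qed.

Lemma pairing1r x : pairing x 1%g = 1.
Proof.
have log1 : omega ^+ cycle_log 1%g = omega ^+ 0 by apply: omega_exp; rewrite cycle_logK ?group1.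
by rewrite /pairing mulnC exprM log1 expr0 expr1n.
Qed.

Lemma pairing1l x : pairing 1%g x = 1.
Proof. by rewrite pairingC pairing1r. Qed.

Lemma pairing_neq0 x y : pairing x y != 0.
Proof.
rewrite expf_neq0 //; apply/eqP => omega0; have := prim_expr_order omega_primitive.
by rewrite omega0 expr0n gtn_eqF ?order_gt0 // => /esym/eqP; rewrite oner_eq0.
Qed.

Lemma pairingVr x y : y \in R -> pairing x y^-1%g = (pairing x y)^-1.
Proof.
move=> yR; apply: (mulfI (pairing_neq0 x y)).
by rewrite -pairingMr ?groupV // mulgV pairing1r divff ?pairing_neq0.
Qed.

Lemma pairingVl x y : x \in R -> pairing x^-1%g y = (pairing x y)^-1.
Proof. by move=> xR; rewrite pairingC pairingVr // pairingC. Qed.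

Lemma pairingXr x y k : y \in R -> pairing x (y ^+ k)%g = pairing x y ^+ k.
Proof.
move=> yR; elim: k => [|k IHk]; first by rewrite expg0 pairing1r.
by rewrite expgS pairingMr ?groupX // IHk exprS.
Qed.

Lemma pairingXl x y k : x \in R -> pairing (x ^+ k)%g y = pairing x y ^+ k.
Proof. by move=> xR; rewrite pairingC pairingXr // pairingC. Qed.

Lemma pairing_gen_eq1 x : x \in R -> (pairing x r == 1) = (x == 1%g).
Proof.
move=> xR; rewrite /pairing mulnC exprM.
have -> : omega ^+ cycle_log r = omega.
  by rewrite -[RHS]expr1; apply: omega_exp; rewrite cycle_logK ?cycle_id.
by rewrite -(prim_order_dvd omega_primitive) order_dvdn cycle_logK.
Qed.

Lemma sum_pairing x : x \in R -> \sum_(y in R) pairing x y = (#[r]%g)%:R * (x == 1%g)%:R.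
Proof.
move=> xR; have [->|x1] := eqVneq x 1%g.
  by rewrite mulr1 (eq_bigr (fun=> 1)) ?sumr_const // => y _; rewrite pairing1l.
rewrite mulr0; apply/eqP; set c := \sum_(y in R) _.
have : c * (pairing x r - 1) == 0.
  rewrite mulrBr mulr1 subr_eq0 mulr_suml /c [X in _ == X](reindex_inj (mulIg r)) /=.
  apply/eqP; apply: eq_big => y; first by rewrite groupMr ?cycle_id.
  by move=> yR; rewrite pairingMr ?cycle_id.
by rewrite mulf_eq0 subr_eq0 pairing_gen_eq1 // (negPf x1) orbF.
Qed.

(* Expand the indicator of [z ^+ k = c] in the characters [pairing x]. *)
Lemma card_power_fiber k c : c \in R ->
  #|[set z in R | (z ^+ k)%g == c]|%:R = \sum_(x in R | (x ^+ k)%g == 1%g) pairing x c.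
Proof.
move=> cR; have r_neq0 : (#[r]%g%:R : algC) != 0 by rewrite pnatr_eq0 -lt0n order_gt0.
apply: (mulfI r_neq0).
have -> : #[r]%g%:R * #|[set z in R | (z ^+ k)%g == c]|%:R =
    \sum_(z in R) \sum_(x in R) pairing x (z ^+ k * c^-1)%g.
  rewrite -sum1_card natr_sum mulr_sumr big_mkcond [RHS]big_mkcond.
  apply: eq_bigr => z _; rewrite inE; case: (boolP (z \in R)) => //= zR.
  rewrite (eq_bigr (fun x => pairing (z ^+ k * c^-1)%g x)); last by move=> x _; apply: pairingC.
  by rewrite sum_pairing ?groupM ?groupX ?groupV // -eq_mulgV1; case: eqP; rewrite ?mulr0.
rewrite exchange_big (reindex_inj invg_inj) /= mulr_sumr [RHS]big_mkcondr /=.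
apply: eq_big => x; rewrite groupV // => xR.
transitivity (pairing x c * \sum_(z in R) pairing (x^-1 ^+ k)%g z).
  rewrite mulr_sumr; apply: eq_bigr => z zR.
  rewrite pairingMr ?groupX ?groupV // pairingVr // (pairingVl c) // invrK mulrC.
  by rewrite pairingXr // pairingXl ?groupV.
rewrite sum_pairing ?groupX ?groupV // expVgn invg_eq1.
by case: eqP => _; rewrite ?mulr1 ?mulr0 // mulrC.
Qed.

Lemma pairing_quartic x c : x \in R -> c \in R ->
  ((x ^+ 4)%g == 1%g)%:R * (2^-1 * (pairing x (c * r^-1)%g + pairing x (c * r)%g)) =
  (x == 1%g)%:R - ((x ^+ 2 == 1)%g && (x != 1%g))%:R * pairing x c.
Proof.
move=> xR cR; have rR := cycle_id r.
rewrite (pairingMr x cR (groupVr rR)) (pairingMr x cR rR) (pairingVr x rR) -mulrDr.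
set q := pairing x r; have q0 : q != 0 by apply: pairing_neq0.
have qX k : (q ^+ k == 1) = ((x ^+ k)%g == 1%g).
  by rewrite -(pairing_gen_eq1 (groupX k xR)) pairingXl.
have [x1|x1] := eqVneq x 1%g.
  have -> : q = 1 by apply/eqP; rewrite (pairing_gen_eq1 xR) x1.
  by rewrite x1 !expg1n eqxx /= pairing1l invr1 !mul1r mul0r subr0; field.
rewrite andbT; have [x2|x2] := eqVneq (x ^+ 2)%g 1%g.
  have -> : (x ^+ 4 = 1)%g by rewrite (expgM x 2 2) x2 expg1n.
  have : q ^+ 2 == 1 by rewrite qX x2.
  rewrite sqrf_eq1 => /orP[]/eqP qE.
    by have := qX 1%N; rewrite expr1 expg1 qE eqxx (negPf x1).
  by rewrite qE eqxx invrN1 /= mulr0n mulr1n; field.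
rewrite !mul0r subr0; have [x4|x4] := eqVneq (x ^+ 4)%g 1%g; last by rewrite mul0r.
have q4 : (q ^+ 2) ^+ 2 == 1 by rewrite -exprM qX x4.
move: q4; rewrite sqrf_eq1 qX (negPf x2) /= => /eqP q2.
have -> : q^-1 = - q by apply: (mulfI q0); rewrite divff // mulrN -expr2 q2 opprK.
by rewrite addNr !mulr0.
Qed.

Lemma card_quartic_fibers c : c \in R ->
  2^-1 * (#|[set z in R | (z ^+ 4)%g == (c * r^-1)%g]|%:R +
          #|[set z in R | (z ^+ 4)%g == (c * r)%g]|%:R) =
  1 - \sum_(x in R | ((x ^+ 2)%g == 1%g) && (x != 1%g)) pairing x c.
Proof.
move=> cR; have rR := cycle_id r.
rewrite !card_power_fiber ?groupM ?groupV // -big_split /= mulr_sumr big_mkcondr /=.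
rewrite (eq_bigr (fun x => (x == 1%g)%:R - ((x ^+ 2 == 1)%g && (x != 1%g))%:R * pairing x c)).
  rewrite sumrB (bigD1 1%g) ?group1 //= eqxx big1 ?addr0 => [|x /andP[_ /negPf->]] //.
  rewrite [X in _ = 1 - X]big_mkcondr; congr (_ - _).
  by apply: eq_bigr => x xR; case: (_ && _); rewrite ?mul1r ?mul0r.
by move=> x xR; rewrite -pairing_quartic //; case: eqP; rewrite ?mul1r ?mul0r.
Qed.

End CyclicPairing.

(** * Induced linear characters *)

Lemma lin_char_exists (gT : finGroupType) (K : {group gT}) (f : gT -> algC) :
    f 1%g = 1 -> {in K &, forall x y, f (x * y)%g = f x * f y} ->
  exists2 xi : 'CF(K), xi \is a linear_char & {in K, xi =1 f}.
Proof.
move=> f1 fM; have f_repr : mx_repr K (fun g => (f g)%:M : 'M[algC]_1).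
  by split=> [|x y xK yK]; rewrite ?f1 // fM // scalar_mxM.
have reprE : {in K, cfRepr (MxRepresentation f_repr) =1 f}.
  by move=> g gK; rewrite cfunE gK mulr1n /= mxtrace_scalar.
exists (cfRepr (MxRepresentation f_repr)) => //.
by rewrite qualifE /= cfRepr_char reprE ?group1 // f1 eqxx.
Qed.

Lemma sum_conj_orbit (gT : finGroupType) (K : {group gT}) (x : gT) (V : nmodType) (F : gT -> V) :
  \sum_(y in K) F (x ^ y^-1)%g = (\sum_(z in x ^: K) F z) *+ #|'C_K[x]|.
Proof.
rewrite (partition_big (fun y => (x ^ y^-1)%g) (mem (x ^: K))) /=; last first.
  by move=> y yK; apply: memJ_class; rewrite groupV.
rewrite -sumrMnl; apply: eq_bigr => _ /imsetP[z zK ->].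
rewrite (eq_bigr (fun=> F (x ^ z)%g)) => [|y /andP[_ /eqP->]] //.
rewrite sumr_const; congr (_ *+ _).
rewrite -(card_imset 'C_K[x] (mulgI z^-1%g)); apply: eq_card => y.
apply/andP/imsetP => [[yK /eqP e]|[w /setIP[wK /cent1P wx] ->]].
  exists (z * y)%g; last by rewrite mulKg.
  apply/setIP; split; first by rewrite groupM.
  by apply/cent1P; rewrite /commute (conjgC x) conjgM -e conjgKV.
rewrite groupM ?groupV //; split=> //; rewrite invMg invgK conjgM.
by rewrite [(x ^ w^-1)%g]conjgE invgK mulgA wx mulgK.
Qed.

Lemma cfInd_cent1 (gT : finGroupType) (G K : {group gT}) (x g : gT)
    (xi : 'CF('C_G[x])) (F : gT -> gT -> algC) :
    K \subset G -> 'C_G[x] \subset K -> g \in K -> {in 'C_G[x]%g, xi =1 F x} ->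
    (forall y, y \in K -> ((x ^ y^-1) ^ g = x ^ y^-1)%g -> F x (g ^ y)%g = F (x ^ y^-1)%g g) ->
  'Ind[K] xi g = \sum_(z in x ^: K | (z ^ g)%g == z) F z g.
Proof.
move=> KG CK gK xiE FJ; pose f z := if (z ^ g)%g == z then F z g else 0.
have term y : y \in K -> xi (g ^ y)%g = f (x ^ y^-1)%g.
  move=> yK; rewrite /f; have fixE : ((g ^ y)%g \in 'C_G[x]) = ((x ^ y^-1) ^ g == x ^ y^-1)%g.
    have -> : ((x ^ y^-1) ^ g == x ^ y^-1)%g = (x ^ (g ^ y) == x)%g.
      rewrite -(inj_eq (conjg_inj y)) conjgKV; congr (_ == _).
      by rewrite [(g ^ y)%g]conjgE !conjgM.
    rewrite inE groupJ ?(subsetP KG) //=; apply/cent1P/eqP => [c|c].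
      by rewrite conjgE -c mulKg.
    by rewrite /commute (conjgC x) c.
  by case: ifP => x_fix; [rewrite xiE ?fixE // FJ //; apply/eqP | rewrite cfun0 // fixE x_fix].
rewrite cfIndE // (eq_bigr (fun y => f (x ^ y^-1)%g)) //.
have -> : #|'C_G[x]| = #|'C_K[x]|.
  apply: eq_card => h; rewrite !inE; apply: andb_id2r => hx.
  by apply/idP/idP => [hG|/(subsetP KG)//]; apply: (subsetP CK); rewrite !inE hG.
rewrite sum_conj_orbit -[(\sum_(z in _) _) *+ _]mulr_natl mulKf ?neq0CG //.
by rewrite [RHS]big_mkcondr.
Qed.

(** * Roots of a finite Coxeter group *)

Record coxeter_rep (gT : finGroupType) n (sv : 'I_n -> gT) (rho : gT -> 'M[algC]_n) : Prop :=
  CoxeterRep {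
    cox_inj : injective sv;
    cox_order : forall i, #[sv i]%g = 2%N;
    cox_geom : geom_rep sv rho }.

Section CoxeterGroup.
Variables (gT : finGroupType) (n : nat) (sv : 'I_n -> gT) (rho : gT -> 'M[algC]_n).
Hypothesis cox : coxeter_rep sv rho.
Local Notation S := [set sv i | i : 'I_n].
Local Notation W := <<[set sv i | i : 'I_n]>>%g.
Local Notation G := (Gram sv).
Local Notation alpha i := (delta_mx 0 i : 'rV[algC]_n).
Local Notation root i w := (row i (rho w)).
Implicit Types (u w g x : gT) (i j : 'I_n).

Lemma mem_sv i : sv i \in S. Proof. exact: imset_f. Qed.

Lemma sv_W i : sv i \in W. Proof. by rewrite mem_gen ?mem_sv. Qed.

Lemma svK i : (sv i * sv i = 1)%g.
Proof. by have := expg_order (sv i); rewrite (cox_order cox) expgS expg1. Qed.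

Lemma svKl i w : (sv i * (sv i * w) = w)%g.
Proof. by rewrite mulgA svK mul1g. Qed.

Lemma svV i : ((sv i)^-1 = sv i)%g.
Proof. by apply/eqP; rewrite eq_invg_mul svK. Qed.

Lemma parabolic_ind (L : {set gT}) (P : gT -> Prop) : L \subset S ->
    P 1%g -> (forall i w, sv i \in L -> w \in <<L>>%g -> P w -> P (sv i * w)%g) ->
  forall w, w \in <<L>>%g -> P w.
Proof.
move=> LS P1 PM; apply: gen_ind => // a w aL; have /imsetP[i _ aE] := subsetP LS a aL.
by move: aL; rewrite aE; apply: PM.
Qed.

Lemma rhoM x y : x \in W -> y \in W -> rho (x * y)%g = rho x *m rho y.
Proof. by have [morph _] := cox_geom cox; apply: morph. Qed.

Lemma Gram_sym i j : G i j = G j i.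
Proof. by rewrite !mxE -[in LHS]orderV invMg !svV. Qed.

Lemma tr_Gram : G^T = G.
Proof. by apply/matrixP => i j; rewrite mxE Gram_sym. Qed.

Lemma Gram_diag i : G i i = 1.
Proof. by rewrite mxE svK order1 root1C raddfN /= opprK (Creal_ReP _ _) ?rpred1. Qed.

Lemma form_alphaE m (v : 'M[algC]_(m, n)) i : v *m (alpha i)^T = col i v.
Proof. by rewrite trmx_delta -colE. Qed.

Lemma alpha_unit i : alpha i *m G *m (alpha i)^T = 1%:M.
Proof.
rewrite -rowE form_alphaE [LHS]mx11_scalar.
by move: (Gram sv) (Gram_diag i) => g g_ii; rewrite !mxE g_ii.
Qed.

Lemma rho_sv i : rho (sv i) = reflmx G (alpha i).
Proof.
have [_ ->] := cox_geom cox; rewrite /refl /reflmx; move: (Gram sv) Gram_sym => g g_sym.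
congr (_ - _); apply/matrixP => j k; rewrite !mxE big_ord1 !mxE eqxx /=.
rewrite (bigD1 i) //= big1 ?addr0 => [|l li]; last by rewrite !mxE (negPf li) andbF mulr0.
by rewrite !mxE !eqxx mulr1 g_sym.
Qed.

Lemma alpha_rho_sv i j : alpha j *m rho (sv i) = alpha j - (2 * G i j) *: alpha i.
Proof.
rewrite rho_sv mul_reflmx -rowE form_alphaE Gram_sym.
by move: (Gram sv) => g; rewrite !mxE.
Qed.

Lemma rho1 : rho 1%g = 1%:M.
Proof.
apply/row_matrixP => i; congr row.
by rewrite -(svK i) rhoM ?sv_W // rho_sv reflmxK ?alpha_unit.
Qed.

Lemma rhoVr x : x \in W -> rho x *m rho x^-1%g = 1%:M.
Proof. by move=> xW; rewrite -rhoM ?groupV // mulgV rho1. Qed.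

Lemma rhoVl x : x \in W -> rho x^-1%g *m rho x = 1%:M.
Proof. by move=> xW; rewrite -rhoM ?groupV // mulVg rho1. Qed.

Lemma rho_unit x : x \in W -> rho x \in unitmx.
Proof. by move=> xW; case: (mulmx1_unit (rhoVr xW)). Qed.

Lemma rhoJ x y : x \in W -> y \in W -> rho (x ^ y)%g = rho y^-1%g *m rho x *m rho y.
Proof. by move=> xW yW; rewrite conjgE !rhoM ?groupM ?groupV // mulmxA. Qed.

Lemma rho_isometry w : w \in W -> rho w *m G *m (rho w)^T = G.
Proof.
move: w; apply: parabolic_ind => // [|i w _ wW IHw]; first by rewrite rho1 mul1mx trmx1 mulmx1.
rewrite rhoM ?sv_W // trmx_mul -!mulmxA (mulmxA G) 2!(mulmxA (rho w)) IHw.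
by rewrite rho_sv mulmxA reflmx_isometry ?alpha_unit ?tr_Gram.
Qed.

Lemma det_rho_sv i : \det (rho (sv i)) = -1.
Proof. by rewrite rho_sv det_reflmx ?alpha_unit. Qed.

Lemma det_rho_words k w : w \in words S k -> \det (rho w) = (-1) ^+ k.
Proof.
elim: k w => [|k IHk] w /=; first by move/set1P->; rewrite rho1 det1.
case/mulsgP=> s v /imsetP[i _ ->] vk ->.
by rewrite rhoM ?sv_W ?(words_gen vk) // det_mulmx (IHk v) // det_rho_sv exprS.
Qed.

Lemma det_rho w : w \in W -> \det (rho w) = (-1) ^+ len S w.
Proof. by move=> wW; apply/det_rho_words/len_words. Qed.

Lemma det_rhoJ u g : u \in W -> g \in W -> \det (rho (u ^ g)%g) = \det (rho u).
Proof.
move=> uW gW; rewrite rhoJ // !det_mulmx mulrAC -det_mulmx rhoVl //.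
by rewrite det1 mul1r.
Qed.

Lemma len_sv_neq i v : v \in W -> len S (sv i * v)%g != len S v.
Proof.
move=> vW; apply/eqP => e; have := det_rho (groupM (sv_W i) vW).
rewrite e rhoM ?sv_W // det_mulmx det_rho_sv det_rho // mulN1r => /eqP.
by rewrite -subr_eq0 -opprD oppr_eq0 -mulr2n mulrn_eq0 signr_eq0.
Qed.

Lemma len_sv_desc i v : v \in W -> (len S (sv i * v)%g <= len S v)%N ->
  len S v = (len S (sv i * v)%g).+1.
Proof.
move=> vW; rewrite leq_eqVlt (negPf (len_sv_neq i vW)) /= => desc.
have := len_genl (mem_sv i) (groupM (sv_W i) vW); rewrite svKl => le.
by apply/eqP; rewrite eqn_leq le desc.
Qed.

Lemma exists_descent w : w \in W -> w != 1%g -> exists i, (len S (sv i * w)%g < len S w)%N.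
Proof.
move=> wW w1; have := len_words wW.
case e: (len S w) => [|k] /=; first by move/set1P=> we; rewrite we eqxx in w1.
by case/mulsgP=> s v /imsetP[i _ ->] vk ->; exists i; rewrite svKl ltnS len_le.
Qed.

(* Take the longest alternating prefix of [w] which can be stripped without loss of length:
   its last letter and the next one are both ascents of the remaining [v]. *)
Lemma alternating_prefix i j w : w \in W -> (len S (sv i * w)%g < len S w)%N ->
  exists k v, [/\ v \in W, w = (alternating (sv i) (sv j) k.+1 * v)%g,
    len S w = (k.+1 + len S v)%N,
    (len S v < len S (sv i * v)%g)%N & (len S v < len S (sv j * v)%g)%N].
Proof.
move=> wW desc; set a := alternating _ _.
pose reduced k := (k + len S ((a k)^-1 * w)%g == len S w)%N.
have aW k : a k \in W by apply: words_gen; apply: alternating_words; apply: mem_sv.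
have reduced1 : reduced 1.
  by rewrite /reduced /a /= mulg1 svV; apply/eqP/esym/len_sv_desc => //; apply: ltnW.
have bound k : reduced k -> (k <= len S w)%N by move/eqP<-; apply: leq_addr.
case: (ex_maxnP (ex_intro reduced 1%N reduced1) bound) => -[|k] red_k kmax.
  by have := kmax _ reduced1.
pose v := ((a k.+1)^-1 * w)%g; pose c (b : bool) := if b then j else i.
have vW : v \in W by rewrite groupM ?groupV.
have wE : w = (a k.+1 * v)%g by rewrite mulKVg.
have lenw : len S w = (k.+1 + len S v)%N by apply/esym/eqP.
have aS l : a l.+1 = (a l * sv (c (odd l)))%g by rewrite /a alternatingSr /c; case: odd.
have next_ascent : (len S v < len S (sv (c (odd k.+1)) * v)%g)%N.
  rewrite ltnNge; apply/negP => /(len_sv_desc vW) lenv.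
  suff /kmax : reduced k.+2 by rewrite ltnn.
  by rewrite /reduced aS invMg svV -mulgA -/v lenw lenv addnS.
have last_ascent : (len S v < len S (sv (c (odd k)) * v)%g)%N.
  have : (len S w <= k + len S (sv (c (odd k)) * v)%g)%N.
    rewrite wE aS -mulgA; apply: len_mull; last by rewrite groupM ?sv_W.
    by apply: alternating_words; apply: mem_sv.
  by rewrite lenw addSn ltn_add2l.
exists k, v; split=> //; move: next_ascent last_ascent => /=; by case: (odd k).
Qed.

Lemma order_sv_gt1 i j : i != j -> (1 < #[sv i * sv j]%g)%N.
Proof.
move=> ij; rewrite ltn_neqAle order_gt0 andbT eq_sym order_eq1.
apply: contra ij => /eqP e; apply/eqP/(cox_inj cox)/eqP.
by rewrite -[sv j]svV eq_mulgV1 invgK e.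
Qed.

Lemma rho_alternating i j k : i != j ->
  root i (alternating (sv j) (sv i) k) =
    chebU (- G i j) k.+1 *: alpha (if odd k then j else i) +
    chebU (- G i j) k *: alpha (if odd k then i else j).
Proof.
move=> ij; have altW a b l : alternating (sv a) (sv b) l \in W.
  by apply: words_gen; apply: alternating_words; apply: mem_sv.
elim: k => [|k IHk]; first by rewrite rho1 scale1r scale0r addr0 row1.
rewrite alternatingSr rhoM //; last by case: odd; rewrite sv_W.
rewrite row_mul IHk chebUSS [odd k.+1]/=.
move: (chebU _ k.+1) (chebU _ k) => a b.
case: (odd k); rewrite /= mulmxDl -!scalemxAl !alpha_rho_sv Gram_diag ?(Gram_sym j i);
  by move: (G i j) => c; apply/rowP => l; rewrite !mxE; ring.
Qed.

(* Otherwise the braid relation would let [w] start with [sv i]. *)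
Lemma ascent_alternating_lt i j k v w :
    v \in W -> w = (alternating (sv j) (sv i) k * v)%g -> len S w = (k + len S v)%N ->
    (len S w < len S (sv i * w)%g)%N ->
  (k < #[sv i * sv j]%g)%N.
Proof.
move=> vW wE lenw; set m := #[_]%g; apply: contraTT; rewrite -!leqNgt => mk.
have alt_word a b l : alternating (sv a) (sv b) l \in words S l.
  by apply: alternating_words; apply: mem_sv.
pose b := if odd m then alternating (sv i) (sv j) (k - m) else alternating (sv j) (sv i) (k - m).
have b_word : b \in words S (k - m) by rewrite /b; case: odd.
have -> : (sv i * w = alternating (sv j) (sv i) m.-1 * (b * v))%g.
  apply: (mulgI (sv i)); rewrite svKl wE -(subnK mk) addnC alternatingD -/b !mulgA.
  congr (_ * _ * _)%g; rewrite alternating_swap ?svK //.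
  have -> : ((sv j * sv i) ^+ m = 1)%g.
    by rewrite -[(sv j * sv i)%g]invgK invMg !svV expgVn expg_order invg1.
  by rewrite mul1g -[X in alternating _ _ X](prednK (order_gt0 _)).
rewrite lenw; apply: leq_trans (_ : (m.-1 + ((k - m) + len S v) <= _)%N).
  by apply: len_le; do 2!apply: words_mul => //; apply: len_words.
by rewrite addnA leq_add2r -[X in (_ <= X)%N](subnKC mk) leq_add2r leq_pred.
Qed.

(* Tits: strip from [w] a maximal alternating word in [sv j], [sv i]. It is shorter than the
   order of [sv i * sv j], so its Chebyshev coefficients are nonnegative. *)
Lemma nonneg_root_ascent i w : w \in W -> (len S w < len S (sv i * w)%g)%N -> nonneg (root i w).
Proof.
have [N] := ubnP (len S w); elim: N i w => // N IHN i w lenw wW ascent.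
have [->|w1] := eqVneq w 1%g; first by rewrite rho1 row1 nonneg_delta.
have [j desc] := exists_descent wW w1.
have ij : i != j by apply: contraTneq desc => <-; rewrite -leqNgt ltnW.
have [k [v [vW wE wl v_j v_i]]] := alternating_prefix i wW desc.
have km := ascent_alternating_lt vW wE wl ascent.
rewrite wE rhoM //; last by apply: words_gen; apply: alternating_words; apply: mem_sv.
rewrite row_mul rho_alternating // mulmxDl -!scalemxAl -!rowE.
have -> : - G i j = 'Re (#[sv i * sv j]%g.-root (-1)) by rewrite mxE opprK.
have lenv : (len S v < N)%N by rewrite -ltnS (leq_trans _ lenw) // wl; lia.
apply: nonnegD; apply: nonnegZ; rewrite ?chebU_ge0 ?order_sv_gt1 // 1?ltnW //;
  by case: odd; apply: IHN.
Qed.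

Lemma root_neq0 i w : w \in W -> root i w != 0.
Proof.
move=> wW; apply/eqP => r0; have := mulmxA (alpha i) (rho w) (rho w^-1%g).
rewrite rhoVr // mulmx1 -rowE r0 mul0mx => /rowP/(_ i)/eqP.
by rewrite !mxE !eqxx oner_eq0.
Qed.

Lemma root_sv_mul i w : w \in W -> root i (sv i * w)%g = - root i w.
Proof.
move=> wW; rewrite rhoM ?sv_W // row_mul [row i (rho (sv i))]rowE rho_sv.
by rewrite mul_reflmx_id ?alpha_unit // mulNmx -rowE.
Qed.

Lemma root_mulV i w : w \in W -> root i w *m rho w^-1%g = alpha i.
Proof. by move=> wW; rewrite -row_mul rhoVr // row1. Qed.

Lemma root_unit i w : w \in W -> root i w *m G *m (root i w)^T = 1%:M.
Proof.
move=> wW; rewrite (rowE i) trmx_mul -(alpha_unit i).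
by rewrite -!mulmxA (mulmxA G) 2!(mulmxA (rho w)) rho_isometry.
Qed.

Lemma root_nonnegE i w : w \in W -> nonneg (root i w) = (len S w < len S (sv i * w)%g)%N.
Proof.
move=> wW; apply/idP/idP => [pos|]; last exact: nonneg_root_ascent.
rewrite ltnNge leq_eqVlt negb_or len_sv_neq //=; apply/negP => desc.
have := root_neq0 i wW; rewrite (nonneg_anti pos) ?eqxx // -root_sv_mul //.
by apply: nonneg_root_ascent; rewrite ?svKl ?groupM ?sv_W.
Qed.

Lemma root_nonnegN i w : w \in W -> nonneg (- root i w) = ~~ nonneg (root i w).
Proof.
move=> wW; rewrite -root_sv_mul // !root_nonnegE ?groupM ?sv_W // svKl.
by rewrite -leqNgt [RHS]leq_eqVlt (negPf (len_sv_neq i wW)).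
Qed.

Lemma nonneg_roots_eq1 w : w \in W -> (forall i, nonneg (root i w)) -> w = 1%g.
Proof.
move=> wW pos; apply/eqP/contraT => /(exists_descent wW)[i desc].
by have := pos i; rewrite root_nonnegE // ltnNge ltnW.
Qed.

Lemma rho_inj : {in W &, injective rho}.
Proof.
move=> x y xW yW e; apply/eqP; rewrite eq_mulgV1; apply/eqP.
apply: nonneg_roots_eq1 => [|i]; first by rewrite groupM ?groupV.
by rewrite rhoM ?groupV // e rhoVr // row1 nonneg_delta.
Qed.

Lemma rho_svJ i w : w \in W -> rho (sv i ^ w)%g = reflmx G (root i w).
Proof.
move=> wW; rewrite rhoJ ?sv_W // rho_sv /reflmx mulmxBr mulmx1 mulmxBl rhoVl //.
congr (_ - _); rewrite !mulmxA -(mulmxA _ (alpha i)) -rowE; congr (_ *m _).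
rewrite -scalemxAr (rowE i (rho w)) trmx_mul !mulmxA; congr (_ *: (_ *m _)).
by rewrite -{1}(rho_isometry wW) !mulmxA rhoVl // mul1mx.
Qed.

Lemma root_conj i j w : w \in W -> (sv i ^ w)%g = sv j ->
  root i w = alpha j \/ root i w = - alpha j.
Proof.
move=> wW /(congr1 rho); rewrite rho_svJ // rho_sv.
exact: reflmx_inj (root_unit i wW) (alpha_unit j).
Qed.

Lemma conj_root i j w : w \in W -> root i w = alpha j \/ root i w = - alpha j ->
  (sv i ^ w)%g = sv j.
Proof.
move=> wW root_j; apply: rho_inj; rewrite ?groupJ ?sv_W // rho_svJ // rho_sv.
by case: root_j => ->; rewrite ?reflmxN.
Qed.

Lemma refl_W t : t \in Tset S -> t \in W.
Proof. by case/imset2P=> s w sS wW ->; rewrite groupJ // mem_gen. Qed.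

Lemma refl_J t w : t \in Tset S -> w \in W -> (t ^ w)%g \in Tset S.
Proof.
case/imset2P=> s v sS vW -> wW; rewrite -conjgM.
by apply/imset2P; exists s (v * w)%g; rewrite ?groupM.
Qed.

Lemma sv_refl i : sv i \in Tset S.
Proof. by apply/imset2P; exists (sv i) 1%g; rewrite ?mem_sv ?group1 ?conjg1. Qed.

Lemma refl_reflmx t : t \in Tset S ->
  exists2 b : 'rV[algC]_n, rho t = reflmx G b & b *m G *m b^T = 1%:M.
Proof.
case/imset2P=> s w /imsetP[i _ ->] wW ->.
by exists (root i w); [apply: rho_svJ | apply: root_unit].
Qed.

Lemma sub_ker_rho m (A : 'M[algC]_(m, n)) w : (A <= kermx (rho w - 1%:M))%MS = (A *m rho w == A).
Proof. by rewrite sub_kermx mulmxBr mulmx1 subr_eq0. Qed.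

(** * Parabolic subgroups *)

Lemma XsetP (L : {set gT}) w : L \subset S ->
  reflect (w \in W /\ forall i, sv i \in L -> nonneg (root i w)) (w \in Xset S L).
Proof.
move=> LS; rewrite inE; apply: (iffP andP) => -[wW pos]; split=> //.
  by move=> i iL; rewrite root_nonnegE //; move/forall_inP: pos; apply.
apply/forall_inP => s sL; have /imsetP[i _ sE] := subsetP LS s sL.
by rewrite sE -root_nonnegE // pos // -sE.
Qed.

Definition root_span (L : {set gT}) : 'M[algC]_n := (\sum_(k | sv k \in L) <<alpha k>>)%MS.

Section RootSpan.
Variable L : {set gT}.
Local Notation VL := (root_span L).

Lemma alpha_span i : sv i \in L -> (alpha i <= VL)%MS.
Proof. by move=> iL; rewrite (sumsmx_sup i) // genmxE. Qed.

Lemma root_span_coord (v : 'rV[algC]_n) i : (v <= VL)%MS -> sv i \notin L -> v 0 i = 0.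
Proof.
move=> vL iL; suff : (VL <= kermx (delta_mx i 0 : 'cV_n))%MS.
  move/(submx_trans vL); rewrite sub_kermx -colE => /eqP/colP/(_ 0).
  by rewrite !mxE.
apply/sumsmx_subP => k kL; rewrite genmxE sub_kermx mul_delta_mx_0 //.
by apply: contra iL => /eqP <-.
Qed.

Lemma root_span_mul m (v : 'rV[algC]_n) (A : 'M[algC]_(n, m)) : (v <= VL)%MS ->
  v *m A = \sum_(k | sv k \in L) v 0 k *: row k A.
Proof.
move=> vL; rewrite {1}[v]row_sum_delta mulmx_suml [RHS]big_mkcond; apply: eq_bigr => k _.
rewrite -scalemxAl -rowE; case: ifP => // /negbT kL.
by rewrite (root_span_coord vL kL) scale0r.
Qed.

Lemma rank_root_span : L \subset S -> \rank VL = #|L|.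
Proof.
move=> LS; rewrite (mxdirectP (mxdirect_delta _ (f := id) _)) /=; last by move=> ? ? ? ?.
rewrite (eq_bigr (fun=> 1%N)) => [|k _]; last by rewrite mxrank_gen mxrank_delta.
rewrite sum1_card -(card_imset _ (cox_inj cox)); apply: eq_card => s.
apply/imsetP/idP => [[k kL ->] //|sL].
by have /imsetP[k _ sE] := subsetP LS s sL; exists k; rewrite // unfold_in -sE.
Qed.

End RootSpan.

Section ParabolicDecomposition.
Variable L : {set gT}.
Hypothesis LS : L \subset S.
Local Notation WL := <<L>>%g.
Local Notation VL := (root_span L).
Local Notation XL := (Xset S L).

Lemma parabolic_sub u : u \in WL -> u \in W.
Proof. by move=> uL; apply: (subsetP (genS LS)). Qed.

Lemma rho_sub_span u : u \in WL -> (rho u - 1%:M <= VL)%MS.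
Proof.
move: u; apply: parabolic_ind => // [|i u iL uL IHu]; first by rewrite rho1 subrr sub0mx.
rewrite rhoM ?sv_W ?parabolic_sub //.
have -> : rho (sv i) *m rho u - 1%:M = rho (sv i) *m (rho u - 1%:M) + (rho (sv i) - 1%:M).
  by rewrite mulmxBr mulmx1 addrA subrK.
rewrite addmx_sub ?(mulmx_sub _ IHu) // rho_sv addrC addKr eqmx_opp mulmx_sub //.
exact: alpha_span.
Qed.

Lemma root_span_stable u : u \in WL -> stablemx VL (rho u).
Proof.
move=> /rho_sub_span uV; rewrite -[rho u](subrK 1%:M) mulmxDr mulmx1.
by rewrite addmx_sub ?mulmx_sub.
Qed.

Lemma root_parabolic_span i u : sv i \in L -> u \in WL -> (root i u <= VL)%MS.
Proof.
move=> iL uL; rewrite rowE.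
exact: submx_trans (submxMr _ (alpha_span iL)) (root_span_stable uL).
Qed.

(* Outside [L] the diagonal coefficients of [rho w] are [1], so the roots [root k w] stay
   positive. *)
Lemma Xset_eq1 w : w \in XL -> (rho w - 1%:M <= VL)%MS -> w = 1%g.
Proof.
case/(XsetP _ LS) => wW pos triv; apply: nonneg_roots_eq1 => // k.
have [/pos//|kL] := boolP (sv k \in L).
have : (alpha k *m (rho w - 1%:M) <= VL)%MS by rewrite mulmx_sub.
move/root_span_coord/(_ kL)/eqP; rewrite mulmxBr mulmx1 -rowE !mxE !eqxx subr_eq0 => /eqP wkk.
apply: contraT; rewrite -root_nonnegN // => /nonnegP/(_ k).
by rewrite !mxE wkk oppr_ge0 ler10.
Qed.

Lemma parabolic_Xset_eq1 u : u \in WL -> u \in XL -> u = 1%g.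
Proof. by move=> uL uX; apply: Xset_eq1 (rho_sub_span uL). Qed.

Lemma nonneg_mul_Xset (v : 'rV[algC]_n) d : (v <= VL)%MS -> nonneg v -> d \in XL ->
  nonneg (v *m rho d).
Proof.
move=> vL /nonnegP v_ge0 /(XsetP _ LS)[_ pos]; rewrite (root_span_mul _ vL).
by apply: nonneg_sum => k kL; rewrite nonnegZ ?pos.
Qed.

Lemma nonneg_root_mul i u d : sv i \in L -> u \in WL -> d \in XL ->
  nonneg (root i (u * d)%g) = nonneg (root i u).
Proof.
move=> iL uL dX; have uW := parabolic_sub uL; have [dW _] := XsetP _ LS dX.
have uE := root_parabolic_span iL uL.
have rE : root i (u * d)%g = root i u *m rho d by rewrite rhoM // row_mul.
apply/idP/idP => [|pos]; last by rewrite rE nonneg_mul_Xset.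
apply: contraTT; rewrite -!root_nonnegN ?groupM // rE -mulNmx => neg.
by rewrite nonneg_mul_Xset // eqmx_opp.
Qed.

Lemma Xset_mul_eq1 u d : u \in WL -> d \in XL -> (u * d)%g \in XL -> u = 1%g.
Proof.
move=> uL dX /(XsetP _ LS)[_ pos]; apply: parabolic_Xset_eq1 => //; apply/XsetP => //.
by split=> [|i iL]; rewrite ?parabolic_sub // -(nonneg_root_mul iL uL dX) pos.
Qed.

Lemma Xset_decomp w : w \in W -> exists u d, [/\ u \in WL, d \in XL & w = (u * d)%g].
Proof.
move=> wW; case: (@arg_minnP _ 1%g (mem WL) (fun u => len S (u * w)%g) (group1 _)) => u uL umin.
have uW := parabolic_sub uL; exists u^-1%g, (u * w)%g; rewrite groupV mulKg; split=> //.
apply/XsetP => //; split=> [|i iL]; first by rewrite groupM.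
rewrite root_nonnegE ?groupM // ltn_neqAle eq_sym len_sv_neq ?groupM //= mulgA.
exact: umin (groupM (mem_gen iL) uL).
Qed.

Lemma sum_Xset_decomp (M : nmodType) (F : gT -> M) :
  \sum_(w in W) F w = \sum_(u in WL) \sum_(d in XL) F (u * d)%g.
Proof.
have mul_inj : {in setX WL XL &, injective (fun p : gT * gT => p.1 * p.2)%g}.
  move=> [u d] [u' d'] /setXP[/= uL dX] /setXP[/= u'L d'X] /= e.
  have dE : (u^-1 * u' * d' = d)%g by rewrite -mulgA -e mulKg.
  have u1 : (u^-1 * u' = 1)%g.
    by apply: (Xset_mul_eq1 (groupM (groupVr uL) u'L) d'X); rewrite dE.
  by move: dE; rewrite u1 mul1g => ->; rewrite -[u'](mulKVg u) u1 mulg1.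
have -> : \sum_(w in W) F w = \sum_(w in [set (p.1 * p.2)%g | p in setX WL XL]) F w.
  apply: eq_bigl => w; apply/idP/imsetP => [wW|[[u d] /setXP[/= uL dX] ->]].
    have [u [d [uL dX ->]]] := Xset_decomp wW.
    by exists (u, d) => //; apply/setXP.
  by have [dW _] := XsetP _ LS dX; rewrite groupM // parabolic_sub.
rewrite big_imset //= pair_big /=; apply: eq_bigl => -[u d].
by rewrite in_setX.
Qed.

Lemma card_Xset_decomp : #|W| = (#|WL| * #|XL|)%N.
Proof.
rewrite -!sum1_card sum_Xset_decomp big_distrl /=; apply: eq_bigr => u _.
by rewrite mul1n sum1_card.
Qed.

End ParabolicDecomposition.

Lemma sub_FixP (A : {set gT}) m (v : 'M[algC]_(m, n)) :
  (v <= Fix rho A)%MS <-> (forall a, a \in A -> v *m rho a = v).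
Proof.
split=> [/sub_bigcapmxP fixA a aA|fixA]; first by apply/eqP; rewrite -sub_ker_rho fixA.
by apply/sub_bigcapmxP => a aA; rewrite sub_ker_rho fixA.
Qed.

Lemma Fix_mul (A : {set gT}) a : a \in A -> Fix rho A *m rho a = Fix rho A.
Proof. by have /sub_FixP := submx_refl (Fix rho A); apply. Qed.

Definition reynolds (L : {set gT}) : 'M[algC]_n := #|<<L>>%g|%:R^-1 *: \sum_(u in <<L>>%g) rho u.

Section Reynolds.
Variable L : {set gT}.
Hypothesis LS : L \subset S.
Local Notation WL := <<L>>%g.
Local Notation VL := (root_span L).
Local Notation FixL := (Fix rho WL).
Local Notation PL := (reynolds L).

Lemma rho_reynolds u : u \in WL -> rho u *m PL = PL.
Proof.
move=> uL; rewrite /reynolds -scalemxAr mulmx_sumr; congr (_ *: _).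
rewrite [RHS](reindex_inj (mulgI u)) /=.
by apply: eq_big => w; rewrite ?groupMl // => wL; rewrite rhoM ?(parabolic_sub LS).
Qed.

Lemma reynolds_rho u : u \in WL -> PL *m rho u = PL.
Proof.
move=> uL; rewrite /reynolds -scalemxAl mulmx_suml; congr (_ *: _).
rewrite [RHS](reindex_inj (mulIg u)) /=.
by apply: eq_big => w; rewrite ?groupMr // => wL; rewrite rhoM ?(parabolic_sub LS).
Qed.

Lemma sub_Fix_gen m (v : 'M[algC]_(m, n)) :
  (v <= FixL)%MS <-> (forall i, sv i \in L -> v *m rho (sv i) = v).
Proof.
split=> [/sub_FixP fixL i iL|fixL]; first by rewrite fixL ?mem_gen.
apply/sub_FixP; apply: parabolic_ind => // [|i u iL uL IHu]; first by rewrite rho1 mulmx1.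
by rewrite rhoM ?sv_W ?(parabolic_sub LS) // mulmxA fixL.
Qed.

Lemma reynolds_sub_Fix : (PL <= FixL)%MS.
Proof. by apply/sub_FixP => u; apply: reynolds_rho. Qed.

Lemma mul_reynolds_Fix m (v : 'M[algC]_(m, n)) : (v <= FixL)%MS -> v *m PL = v.
Proof.
move/sub_FixP=> fixL; rewrite /reynolds -scalemxAr mulmx_sumr (eq_bigr (fun=> v)) //.
by rewrite sumr_const -scaler_nat scalerA mulVf ?scale1r ?neq0CG.
Qed.

Lemma reynolds_sub_span : (1%:M - PL <= VL)%MS.
Proof.
have -> : 1%:M - PL = - (#|WL|%:R^-1 *: \sum_(u in WL) (rho u - 1%:M)).
  rewrite sumrB scalerBr opprB sumr_const -scaler_nat scalerA mulVf ?neq0CG // scale1r.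
  by congr (_ - _).
by rewrite eqmx_opp scalemx_sub // summx_sub // => u; apply: rho_sub_span.
Qed.

Lemma mul_reynolds_span m (v : 'M[algC]_(m, n)) : (v <= VL)%MS -> v *m PL = 0.
Proof.
move=> vL; apply/eqP; rewrite -sub_kermx (submx_trans vL) //.
apply/sumsmx_subP => k kL; rewrite genmxE sub_kermx; apply/eqP.
have : alpha k *m PL = - (alpha k *m PL).
  rewrite -{1}(rho_reynolds (mem_gen kL)) mulmxA alpha_rho_sv Gram_diag mulr1 scaler_nat mulr2n.
  by rewrite opprD addrA subrr add0r mulNmx.
by move/eqP; rewrite -addr_eq0 -mulr2n -scaler_nat scaler_eq0 pnatr_eq0 => /eqP.
Qed.

Lemma Fix_cap_span : (FixL :&: VL = 0)%MS.
Proof.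
apply/eqP; rewrite -submx0 -(mul_reynolds_Fix (capmxSl FixL VL)).
by rewrite (mul_reynolds_span (capmxSr FixL VL)).
Qed.

Lemma Fix_add_span : (FixL + VL :=: 1%:M)%MS.
Proof.
apply/eqmxP; rewrite submx1 -[1%:M](subrK PL) addrC.
by rewrite addmx_sub_adds ?reynolds_sub_Fix ?reynolds_sub_span.
Qed.

Lemma rank_Fix : \rank FixL = (n - #|L|)%N.
Proof.
have := mxrank_disjoint_sum Fix_cap_span; rewrite Fix_add_span mxrank1 => rank_sum.
by rewrite [X in (X - _)%N]rank_sum (rank_root_span LS) addnK.
Qed.

Lemma Fix_form_alpha i (x : 'rV[algC]_n) : sv i \in L -> (x <= FixL)%MS ->
  x *m G *m (alpha i)^T = 0.
Proof.
move=> iL /sub_Fix_gen/(_ i iL)/eqP.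
by rewrite -sub_ker_rho rho_sv sub_ker_reflmx ?alpha_unit // => /eqP.
Qed.

Lemma Fix_form_span : FixL *m G *m VL^T = 0.
Proof.
apply/row_matrixP => k; rewrite !row_mul row0; set x := row k FixL.
have xF : (x <= FixL)%MS by apply: row_sub.
apply: trmx_inj; apply/eqP; rewrite trmx_mul trmxK trmx0 -sub_kermx.
apply/sumsmx_subP => i iL; rewrite genmxE sub_kermx; apply/eqP/trmx_inj.
by rewrite trmx_mul trmxK trmx0 Fix_form_alpha.
Qed.

End Reynolds.

(* No nonzero vector is fixed by all of [W], but [W] fixes the radical of [G]. *)
Lemma Gram_unit : G \in unitmx.
Proof.
rewrite -row_free_unit -kermx_eq0 -submx0; set K := kermx G.
have KS : (K <= Fix rho W)%MS.
  apply/(sub_Fix_gen (subxx _)) => i _; apply/eqP.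
  by rewrite -sub_ker_rho rho_sv sub_ker_reflmx ?alpha_unit // mulmx_ker mul0mx.
have V1 : (1%:M <= root_span S)%MS.
  by apply/row_subP => i; rewrite row1 alpha_span ?mem_sv.
by rewrite -(mul_reynolds_Fix KS) (mul_reynolds_span (subxx _) (submx_trans (submx1 K) V1)).
Qed.

(** * Normalizers of parabolic subgroups *)

Section ParabolicStabilizer.
Variable L : {set gT}.
Hypothesis LS : L \subset S.
Local Notation WL := <<L>>%g.
Local Notation VL := (root_span L).
Local Notation FixL := (Fix rho WL).
Local Notation PL := (reynolds L).
Local Notation N := 'N_W(WL)%g.

Lemma span_form_Fix : VL *m G *m FixL^T = 0.
Proof. by apply: form_tr_eq0; rewrite ?tr_Gram ?Fix_form_span. Qed.

Lemma perp_Fix : (perpB sv FixL :=: VL)%MS.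
Proof.
apply/eqmxP/andP; split; last by rewrite sub_kermx mulmxA span_form_Fix.
set K := perpB _ _; have KF : K *m G *m FixL^T = 0 by rewrite -mulmxA mulmx_ker.
suff KP0 : K *m PL = 0.
  by rewrite -[K]subr0 -KP0 -{1}[K]mulmx1 -mulmxBr mulmx_sub ?reynolds_sub_span.
have KP_Fix : K *m PL *m G *m FixL^T = 0.
  have /submxP[D PE] := reynolds_sub_span LS.
  have -> : K *m PL = K - K *m (D *m VL) by rewrite -PE mulmxBr mulmx1 subKr.
  by rewrite !mulmxBl KF sub0r -!mulmxA (mulmxA VL) span_form_Fix !mulmx0 oppr0.
have KP_span : K *m PL *m G *m VL^T = 0.
  have /submxP[D ->] : (K *m PL <= FixL)%MS by rewrite mulmx_sub ?reynolds_sub_Fix.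
  by rewrite -!mulmxA (mulmxA FixL) (Fix_form_span LS) mulmx0.
apply: (row_free_inj (_ : row_free G)); first by rewrite row_free_unit Gram_unit.
have /sub_addsmxP[[A B] /= one] : (1%:M <= FixL + VL)%MS by rewrite (Fix_add_span LS).
rewrite mul0mx -[LHS]mulmx1 -trmx1 one linearD /= !trmx_mul mulmxDr !mulmxA KP_Fix KP_span.
by rewrite !mul0mx addr0.
Qed.

Lemma Fix_stabilizer p : p \in W -> FixL *m rho p = FixL -> p \in WL.
Proof.
move=> pW pFix; have [u [d [uL dX pE]]] := Xset_decomp LS pW.
have [dW _] := XsetP _ LS dX; have uVL : u^-1%g \in WL by rewrite groupV.
suff d1 : d = 1%g by rewrite pE d1 mulg1.
have stable_p : (VL *m rho p <= VL)%MS.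
  rewrite -perp_Fix sub_kermx mulmxA -pFix trmx_mul !mulmxA.
  by rewrite -2!(mulmxA VL) rho_isometry // span_form_Fix.
have p_sub : (rho p - 1%:M <= VL)%MS.
  have -> : rho p - 1%:M = (1%:M - PL) *m (rho p - 1%:M).
    have /submxP[D PE] := reynolds_sub_Fix LS.
    by rewrite mulmxBl mul1mx [PL *m _]mulmxBr mulmx1 PE -mulmxA pFix subrr subr0.
  rewrite mulmxBr mulmx1 addmx_sub ?eqmx_opp ?(reynolds_sub_span LS) //.
  exact: submx_trans (submxMr _ (reynolds_sub_span LS)) stable_p.
apply: (Xset_eq1 LS dX); have -> : d = (u^-1 * p)%g by rewrite pE mulKg.
rewrite rhoM ?(parabolic_sub LS uVL) //.
have -> : rho u^-1%g *m rho p - 1%:M = rho u^-1%g *m (rho p - 1%:M) + (rho u^-1%g - 1%:M).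
  by rewrite mulmxBr mulmx1 addrA subrK.
by rewrite addmx_sub ?rho_sub_span // mulmx_sub.
Qed.

Lemma cuspidalP w :
  reflect (w \in WL /\ forall v : 'rV[algC]_n, (v <= VL)%MS -> v *m rho w = v -> v = 0)
          (cuspidal sv rho L w).
Proof.
rewrite /cuspidal mxrank_eq0 -submx0; apply: (iffP andP) => -[wL fix0]; split=> //.
  move=> v vL vw; apply/eqP; rewrite -submx0 (submx_trans _ fix0) //.
  by rewrite sub_capmx sub_ker_rho vw eqxx perp_Fix.
apply/row_subP => k; set v := row k _; rewrite (fix0 v) ?sub0mx //.
  by rewrite -perp_Fix (submx_trans (row_sub _ _)) ?capmxSr.
by apply/eqP; rewrite -sub_ker_rho (submx_trans (row_sub _ _)) ?capmxSl.
Qed.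

Lemma cent_cuspidal w : cuspidal sv rho L w -> 'C_W[w]%g \subset N.
Proof.
case/cuspidalP=> wL cusp; have wW := parabolic_sub LS wL.
have fixed_sub_Fix m (Y : 'M[algC]_(m, n)) : Y *m rho w = Y -> (Y <= FixL)%MS.
  move=> Yw; apply/row_subP => k; set y := row k Y.
  have yw : y *m rho w = y by rewrite -row_mul Yw.
  suff /eqP : y - y *m PL = 0.
    by rewrite subr_eq0 => /eqP->; rewrite mulmx_sub ?reynolds_sub_Fix.
  apply: cusp; last by rewrite mulmxBl yw -mulmxA reynolds_rho.
  by rewrite -{1}[y]mulmx1 -mulmxBr mulmx_sub ?reynolds_sub_span.
apply/subsetP => g /setIP[gW /cent1P gw]; rewrite inE gW; apply/normP/eqP.
rewrite eqEcard cardJg leqnn andbT; apply/subsetP => _ /imsetP[u uL ->].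
have uW := parabolic_sub LS uL.
have /sub_FixP fix_gV : (FixL *m rho g^-1%g <= FixL)%MS.
  apply: fixed_sub_Fix; rewrite -mulmxA -rhoM ?groupV //.
  have -> : (g^-1 * w = w * g^-1)%g by apply: (mulgI g); rewrite mulKVg mulgA gw mulgK.
  by rewrite rhoM ?groupV // mulmxA Fix_mul.
apply: Fix_stabilizer; first by rewrite groupJ.
by rewrite rhoJ // !mulmxA fix_gV // -mulmxA rhoVl // mulmx1.
Qed.

Lemma norm_parabolicP g : g \in N -> g \in W /\ (forall u, (u ^ g \in WL)%g = (u \in WL)).
Proof. by case/setIP=> gW gN; split=> // u; rewrite memJ_norm. Qed.

Lemma parabolic_norm u : u \in WL -> u \in N.
Proof. by move=> uL; rewrite inE (parabolic_sub LS) // (subsetP (normG _)). Qed.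

Lemma root_norm_span i g : sv i \in L -> g \in N -> (root i g <= VL)%MS.
Proof.
move=> iL /norm_parabolicP[gW gJ].
have gL : (sv i ^ g)%g \in WL by rewrite gJ mem_gen.
have : (root i g *m (rho (sv i ^ g)%g - 1%:M) <= VL)%MS by rewrite mulmx_sub ?rho_sub_span.
rewrite mulmxBr mulmx1 rho_svJ // mul_reflmx_id ?root_unit // -opprD eqmx_opp -mulr2n.
by rewrite -scaler_nat eqmx_scale ?pnatr_eq0.
Qed.

Lemma root_span_norm g : g \in N -> stablemx VL (rho g).
Proof.
move=> gN; rewrite sumsmxMr; apply/sumsmx_subP => k kL.
by rewrite (eqmxMr _ (genmxE _)) -rowE root_norm_span.
Qed.

Lemma Fix_norm g : g \in N -> stablemx FixL (rho g).
Proof.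
case/norm_parabolicP=> gW gJ; apply/sub_FixP => u uL.
have [uW ugL] := (parabolic_sub LS uL, uL); rewrite -[u](conjgKV g) gJ in ugL *.
rewrite -mulmxA -rhoM ?groupJ ?groupV // -conjgC rhoM ?groupJ ?groupV //.
by rewrite mulmxA Fix_mul.
Qed.

Lemma epsilon_norm g : g \in N -> epsilon rho g = alphaL rho L g * \det (restr VL (rho g)).
Proof.
move=> gN; apply: det_restr_direct; rewrite ?Fix_norm ?root_span_norm ?Fix_cap_span //.
exact: Fix_add_span.
Qed.

Lemma norm_decomp g : g \in N ->
  exists u d, [/\ u \in WL, d \in N, d \in Xset S L & g = (u * d)%g].
Proof.
move=> gN; have [gW _] := norm_parabolicP gN; have [u [d [uL dX e]]] := Xset_decomp LS gW.
exists u, d; split=> //; have -> : d = (u^-1 * g)%g by rewrite e mulKg.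
by rewrite groupM ?groupV // parabolic_norm.
Qed.

End ParabolicStabilizer.

(** For [b = false] this says that [w] is a shortest element of [W_L w]. *)
Definition signed_dominant (L : {set gT}) (b : bool) w : Prop :=
  forall i, sv i \in L -> nonneg ((-1) ^+ b *: root i w).

Definition longest (L : {set gT}) : gT := [arg max_(w > 1%g in <<L>>%g) len S w]%N.

Section SignedDominance.
Variable L : {set gT}.
Hypothesis LS : L \subset S.
Local Notation WL := <<L>>%g.
Local Notation VL := (root_span L).
Local Notation N := 'N_W(WL)%g.
Local Notation w0 := (longest L).

Lemma Xset_dominant d : d \in W -> (d \in Xset S L) <-> signed_dominant L false d.
Proof.
move=> dW; split=> [/(XsetP _ LS)[_ pos] i iL|pos]; first by rewrite scale1r pos.
by apply/(XsetP _ LS); split=> // i iL; have := pos i iL; rewrite scale1r.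
Qed.

Lemma signed_dominant1 : signed_dominant L false 1%g.
Proof. by move=> i _; rewrite rho1 row1 scale1r nonneg_delta. Qed.

Lemma root_nonneg_signN (b : bool) i w : w \in W ->
  nonneg ((-1) ^+ (~~ b) *: root i w) = ~~ nonneg ((-1) ^+ b *: root i w).
Proof.
move=> wW; case: b; rewrite ?expr0 ?expr1 scale1r scaleN1r root_nonnegN //.
by rewrite negbK.
Qed.

Lemma nonneg_mul_signed (b c : bool) w (v : 'rV[algC]_n) : (v <= VL)%MS -> signed_dominant L b w ->
  nonneg ((-1) ^+ c *: v) -> nonneg ((-1) ^+ (b (+) c) *: (v *m rho w)).
Proof.
move=> vL wb /nonnegP v_ge0; rewrite signr_addb mulrC -scalerA scalemxAr scalemxAl.
rewrite (root_span_mul _ (scalemx_sub _ vL)); apply: nonneg_sum => k kL.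
by apply: nonnegZ; [apply: v_ge0 | rewrite linearZ; apply: wb].
Qed.

Lemma signed_dominantM (b c : bool) u w : u \in N -> w \in W ->
  signed_dominant L b u -> signed_dominant L c w -> signed_dominant L (b (+) c) (u * w)%g.
Proof.
move=> uN wW ub wc i iL; have [uW _] := norm_parabolicP uN.
rewrite rhoM // row_mul addbC nonneg_mul_signed ?root_norm_span //; exact: ub.
Qed.

Lemma signed_dominantV b w : w \in N -> signed_dominant L b w -> signed_dominant L b w^-1%g.
Proof.
move=> wN wb i iL; have [wW _] := norm_parabolicP wN; have wVN : w^-1%g \in N by rewrite groupV.
apply: contraT; rewrite -root_nonneg_signN ?groupV // => /(nonneg_mul_signed _ wb).
move/(_ (root_norm_span LS iL wVN)); rewrite addbN addbb expr1 scaleN1r -row_mul rhoVl //.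
by rewrite row1 nonneg_deltaN.
Qed.

(* A nonnegative matrix with a nonnegative inverse is monomial. *)
Lemma signed_dominant_simple b w i : w \in N -> signed_dominant L b w -> sv i \in L ->
  exists2 k, sv k \in L & root i w = (-1) ^+ b *: alpha k.
Proof.
move=> wN wb iL; have wVb := signed_dominantV wN wb; have [wW _] := norm_parabolicP wN.
set a : algC := (-1) ^+ b; have aa : a * a = 1 by rewrite -expr2 sqrr_sign.
have iVL := root_norm_span LS iL wN.
have [k kL ck] : exists2 k, sv k \in L & root i w 0 k != 0.
  apply/exists_inP; apply: contraT => /exists_inPn none; case/eqP: (root_neq0 i wW).
  apply/rowP => k; rewrite [RHS]mxE; have [kL|kL] := boolP (sv k \in L).
    by apply/eqP; have := none k kL; rewrite negbK.
  exact: root_span_coord iVL kL.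
have alphaE : \sum_(l | sv l \in L) (a * root i w 0 l) *: (a *: root l w^-1%g) = alpha i.
  rewrite -(root_mulV i wW) (root_span_mul _ iVL); apply: eq_bigr => l _.
  by rewrite scalerA mulrAC aa mul1r.
have term_nonneg l : sv l \in L -> nonneg ((a * root i w 0 l) *: (a *: root l w^-1%g)).
  move=> lL; apply: nonnegZ (wVb l lL); have /nonnegP/(_ l) := wb i iL.
  by rewrite [(_ *: root i w) _ _]mxE.
have zero j : j != i -> (a *: root k w^-1%g) 0 j = 0.
  move=> ji; have /eqP := nonneg_sum_delta term_nonneg alphaE ji kL.
  by rewrite mxE !mulf_eq0 (negPf ck) signr_eq0 /= => /eqP.
set c := (a *: root k w^-1%g) 0 i.
have rootE : a *: root k w^-1%g = c *: alpha i.
  apply/rowP => j; have [->|ji] := eqVneq j i; last by rewrite zero // !mxE (negPf ji) andbF mulr0.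
  by rewrite /c [in RHS]mxE [alpha i _ _]mxE !eqxx mulr1.
have rootE' : root k w^-1%g = (a * c) *: alpha i by rewrite -scalerA -rootE scalerA aa scale1r.
have c1 : c = 1.
  have c_ge0 : 0 <= c by have /nonnegP := wVb k kL; apply.
  have c2 : c ^+ 2 = 1.
    have -> : c ^+ 2 = (a * c) ^+ 2 by rewrite exprMn sqrr_sign mul1r.
    have := form_unit_scale (alpha_unit i) (root_unit k (groupVr wW)) rootE'.
    by case=> ->; rewrite ?sqrrN expr1n.
  by apply/eqP; rewrite -(pexpr_eq1 _ c_ge0 (n := 2)) // c2.
exists k => //; have := congr1 (mulmx^~ (rho w)) rootE'.
rewrite /= c1 mulr1 -row_mul rhoVl // row1 -scalemxAl -rowE => ->.
by rewrite scalerA aa scale1r.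
Qed.

Lemma parabolic_dominant_eq1 u : u \in WL -> signed_dominant L false u -> u = 1%g.
Proof.
move=> uL /(Xset_dominant (parabolic_sub LS uL)); exact: parabolic_Xset_eq1.
Qed.

Lemma longest_parabolic : w0 \in WL.
Proof. by rewrite /longest; case: arg_maxnP => //; apply: group1. Qed.

Lemma longest_norm : w0 \in N.
Proof. exact: parabolic_norm longest_parabolic. Qed.

Lemma longest_dominant : signed_dominant L true w0.
Proof.
move=> i iL; rewrite expr1 scaleN1r /longest.
case: arg_maxnP => [|w wL wmax]; first exact: group1.
have wW := parabolic_sub LS wL.
rewrite root_nonnegN // root_nonnegE // -leqNgt.
exact: wmax (groupM (mem_gen iL) wL).
Qed.

Lemma longest_uniq u : u \in WL -> signed_dominant L true u -> u = w0.
Proof.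
move=> uL u_neg; have w0V : w0^-1%g \in WL by rewrite groupV longest_parabolic.
suff uw1 : (u * w0^-1 = 1)%g by rewrite -[u](mulgKV w0) uw1 mul1g.
apply: parabolic_dominant_eq1; first by rewrite groupM.
apply: (signed_dominantM (b := true) (c := true)) => //; first exact: parabolic_norm.
  exact: (parabolic_sub LS) w0V.
exact: signed_dominantV longest_norm longest_dominant.
Qed.

Lemma longestV : (w0^-1 = w0)%g.
Proof.
apply: longest_uniq; first by rewrite groupV longest_parabolic.
exact: signed_dominantV longest_norm longest_dominant.
Qed.

Lemma longestK : (w0 * w0 = 1)%g.
Proof. by rewrite -{1}longestV mulVg. Qed.

Lemma longest_neq1 i : sv i \in L -> w0 != 1%g.
Proof.
move=> iL; apply: contraTneq (longest_dominant iL) => ->.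
by rewrite rho1 row1 expr1 scaleN1r nonneg_deltaN.
Qed.

Lemma longestJ d : d \in N -> d \in Xset S L -> (w0 ^ d = w0)%g.
Proof.
move=> dN dX; have [dW dJ] := norm_parabolicP dN.
have d_dom : signed_dominant L false d by apply/Xset_dominant.
apply: longest_uniq; first by rewrite dJ longest_parabolic.
rewrite conjgE; apply: (signed_dominantM (b := false) (c := true)); rewrite ?groupV //.
- by rewrite groupM // (parabolic_sub LS) // longest_parabolic.
- exact: signed_dominantV.
apply: (signed_dominantM (b := true) (c := false)) => //; first exact: longest_norm.
exact: longest_dominant.
Qed.

Lemma longestC d : d \in N -> d \in Xset S L -> (w0 * d = d * w0)%g.
Proof. by move=> dN dX; rewrite (conjgC w0) longestJ. Qed.

End SignedDominance.

(** * The elements [e_L] *)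

Lemma Xset_set0 w : (w \in Xset S set0) = (w \in W).
Proof. by rewrite inE andb_idr // => _; apply/forall_inP => x; rewrite inE. Qed.

Lemma sub1_sv i : [set sv i] \subset S. Proof. by rewrite sub1set mem_sv. Qed.

Lemma Xset_sv i w : (w \in Xset S [set sv i]) = (w \in W) && nonneg (root i w).
Proof.
apply/(XsetP _ (sub1_sv i))/andP => -[wW pos]; split=> //; first by rewrite pos ?set11.
by move=> k /set1P/(cox_inj cox)->.
Qed.

Lemma mem1_Xset (K : {set gT}) : K \subset S -> 1%g \in Xset S K.
Proof.
by move=> KS; apply/XsetP => //; split=> [|i _]; rewrite ?group1 // rho1 row1 nonneg_delta.
Qed.

Lemma Xsharp_set0 w : (w \in Xsharp S set0) = (w \in W).
Proof.
rewrite inE Xset_set0 [X in _ && X](_ : _ = true) ?andbT //.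
by apply/subsetP => y; rewrite mem_conjg inE.
Qed.

Lemma Xsharp_svP i x :
  reflect (x \in W /\ exists k, root i x = alpha k) (x \in Xsharp S [set sv i]).
Proof.
rewrite inE Xset_sv conjg_set1 sub1set; apply: (iffP andP) => [[/andP[xW pos] xS]|[xW [k xk]]].
  have /imsetP[k _ xk] := xS; split=> //; exists k.
  by case: (root_conj xW xk) => // e; move: pos; rewrite e nonneg_deltaN.
rewrite xW xk nonneg_delta (conj_root (j := k)) ?mem_sv //; by left.
Qed.

Lemma root_nonneg_longest j x : x \in W ->
  nonneg (root j (x * longest S)%g) = ~~ nonneg (root j x).
Proof.
move=> xW; have SS := subxx S; have w0W := longest_parabolic S.
have spanned (v : 'rV[algC]_n) : (v <= root_span S)%MS.
  rewrite [v]row_sum_delta summx_sub // => k _.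
  by rewrite scalemx_sub ?alpha_span ?mem_sv.
have mul_w0 (b : bool) : nonneg ((-1) ^+ b *: root j x) ->
    nonneg ((-1) ^+ (~~ b) *: root j (x * longest S)%g).
  by rewrite rhoM // row_mul; apply: nonneg_mul_signed (spanned _) (longest_dominant SS).
apply/idP/idP => [|neg]; last first.
  by have := mul_w0 true; rewrite expr1 scaleN1r expr0 scale1r root_nonnegN //; apply.
apply: contraTN => pos; have := mul_w0 false; rewrite expr1 scaleN1r expr0 scale1r.
by rewrite root_nonnegN ?groupM //; apply.
Qed.

Lemma root_nonneg_coord j k x : x \in W -> rho x j k != 0 -> nonneg (root j x) = (0 <= rho x j k).
Proof.
move=> xW xjk; apply/idP/idP => [/nonnegP/(_ k)|ge0]; first by rewrite mxE.
apply: contraNT xjk; rewrite -root_nonnegN // => /nonnegP/(_ k).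
by rewrite !mxE oppr_ge0 eq_le ge0 => ->.
Qed.

(* The two roots differ by a multiple of [alpha k], and neither is a multiple of [alpha k]. *)
Lemma root_nonneg_sv_mul i j k x : i != j -> x \in W -> root i x = alpha k ->
  nonneg (root j (sv i * x)%g) = nonneg (root j x).
Proof.
move=> ij xW xi; have sxW : (sv i * x)%g \in W by rewrite groupM ?sv_W.
have root_sxE : root j (sv i * x)%g = root j x - (2 * G i j) *: alpha k.
  rewrite rhoM ?sv_W // row_mul [row j (rho (sv i))]rowE alpha_rho_sv mulmxBl -scalemxAl.
  by rewrite -!rowE xi.
have [l lk xl] : exists2 l, l != k & rho x j l != 0.
  apply/exists_inP; apply: contraT => /exists_inPn zero.
  have xj : root j x = rho x j k *: root i x.
    apply/rowP => l; rewrite xi [RHS]mxE [LHS]mxE [alpha k _ _]mxE eqxx /=.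
    have [->|lk] := eqVneq l k; first by rewrite mulr1.
    by have := zero l lk; rewrite negbK mulr0 => /eqP.
  have := congr1 (mulmx^~ (rho x^-1%g)) xj; rewrite /= -scalemxAl !root_mulV //.
  by move/rowP/(_ j)/eqP; rewrite !mxE !eqxx eq_sym [j == i]eq_sym (negPf ij) mulr0 eq_sym oner_eq0.
have coordE : rho (sv i * x)%g j l = rho x j l.
  have := congr1 (fun v : 'rV_n => v 0 l) root_sxE; move: (2 * G i j) => c.
  by rewrite !mxE (negPf lk) andbF mulr0 subr0.
by rewrite !(root_nonneg_coord (k := l)) ?coordE.
Qed.

Lemma Xsharp_sv_mul_longest i x :
  x \in Xsharp S [set sv i] -> (sv i * x * longest S)%g \in Xsharp S [set sv i].
Proof.
case/Xsharp_svP=> xW [k xk]; have w0W := longest_parabolic S.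
have [l _ w0k] := signed_dominant_simple (subxx S) (longest_norm (subxx S))
  (longest_dominant (subxx S)) (mem_sv k).
apply/Xsharp_svP; split; first by rewrite !groupM ?sv_W.
exists l; rewrite rhoM ?groupM ?sv_W // row_mul root_sv_mul // xk mulNmx -rowE w0k.
by rewrite expr1 scaleN1r opprK.
Qed.

(* The involution [x |-> sv i * x * w0] exchanges the elements of [Xsharp S [set sv i]] which
   are dominant for [sv j] with the others. *)
Lemma card_Xsharp_half i j : i != j ->
  #|Xsharp S [set sv i]| = (2 * #|[set x in Xsharp S [set sv i] | nonneg (root j x)]|)%N.
Proof.
move=> ij; set X := Xsharp S _; set A := [set x in X | _]; pose f x := (sv i * x * longest S)%g.
have fK : involutive f.
  by move=> x; rewrite /f !mulgA svK mul1g -mulgA longestK ?mulg1.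
have fX x : (f x \in X) = (x \in X).
  apply/idP/idP => [/Xsharp_sv_mul_longest|]; last exact: Xsharp_sv_mul_longest.
  by rewrite -/(f _) fK.
have -> : #|X| = (#|A| + #|X :\: A|)%N.
  by rewrite -(cardsID A X) (setIidPr _) //; apply/subsetP => x; rewrite inE => /andP[].
suff -> : X :\: A = f @^-1: A by rewrite (card_preimset _ (inv_inj fK)) addnn mul2n.
have memA y : (y \in A) = (y \in X) && nonneg (root j y) by rewrite inE.
apply/setP => x; rewrite in_setD [RHS]inE !memA fX.
case: (boolP (x \in X)) => xX; rewrite ?andbF //= andbT.
have [xW [k xk]] := Xsharp_svP _ _ xX; rewrite root_nonneg_longest ?groupM ?sv_W //.
by rewrite (root_nonneg_sv_mul ij xW xk).
Qed.

Lemma mKL_diag (K : {set gT}) : K \subset S -> mKL S K K != 0.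
Proof.
move=> KS; rewrite /mKL subxx pnatr_eq0 -lt0n; apply/card_gt0P; exists 1%g.
by rewrite inE [X in _ && X]inE conjsg1 KS mem1_Xset.
Qed.

Lemma Mmat_unit : Mmat S \in unitmx.
Proof.
rewrite -row_free_unit; apply: inj_row_free => v vM; apply/rowP => p; rewrite mxE.
apply/eqP/contraT => vp.
case: (@arg_maxnP _ p (fun q => v 0 q != 0) (fun q => #|enum_val q|) vp) => q vq qmax.
have := congr1 (fun M : 'rV_#|Pset S| => M 0 q) vM; rewrite /= [RHS]mxE mxE (bigD1 q) //= big1.
  move/eqP; rewrite addr0 mulf_eq0 (negPf vq) mxE /= => /eqP.
  by move/eqP; rewrite (negPf (mKL_diag _)) // -powersetE enum_valP.
move=> k kq; have [->|vk] := eqVneq (v 0 k) 0; first by rewrite mul0r.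
rewrite mxE /mKL; case: ifP => [sub|_]; last by rewrite mulr0.
by case/eqP: kq; apply: enum_val_inj; apply/esym/eqP; rewrite eqEcard sub; apply: qmax.
Qed.

Lemma eL_sum (K : {set gT}) : K \subset S ->
  xJ S K = \sum_(J in powerset K) mKL S K J *: eL S J.
Proof.
move=> KS; have KP : K \in Pset S by rewrite powersetE.
transitivity (\sum_(J in Pset S) mKL S K J *: eL S J); last first.
  rewrite [RHS]big_mkcond [LHS]big_mkcond; apply: eq_bigr => J _; rewrite /Pset !powersetE.
  have [JK|JK] := boolP (J \subset K); first by rewrite (subset_trans JK KS).
  by rewrite /mKL (negPf JK) scale0r if_same.
pose k := enum_rank_in (set0_Pset S) K.
have kE : enum_val k = K by rewrite enum_rankK_in.
have term p : mKL S K (enum_val p) *: eL S (enum_val p) =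
    \sum_(l < #|Pset S|) (Mmat S k p * invmx (Mmat S) p l) *: xJ S (enum_val l).
  rewrite /eL big_enum_val /= scaler_sumr; apply: eq_bigr => l _.
  by rewrite !enum_valP /= !enum_valK_in scalerA [Mmat S k p]mxE kE.
rewrite [RHS]big_enum_val /= (eq_bigr _ (fun p _ => term p)) exchange_big /=.
rewrite (eq_bigr (fun l => (1%:M : 'M[algC]_#|Pset S|) k l *: xJ S (enum_val l))) => [|l _].
  rewrite (bigD1 k) //= big1 => [|l lk]; last by rewrite mxE eq_sym (negPf lk) scale0r.
  by rewrite mxE eqxx scale1r addr0 kE.
by rewrite -scaler_suml -(mulmxV Mmat_unit) mxE.
Qed.

Lemma mKL_set0 (K : {set gT}) : mKL S K set0 = #|Xset S K|%:R.
Proof.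
rewrite /mKL sub0set; congr (_%:R); apply: eq_card => w.
by rewrite inE Xsharp_set0 andb_idr // inE => /andP[].
Qed.

Lemma mKL_self (K : {set gT}) : mKL S K K = #|Xsharp S K|%:R.
Proof.
rewrite /mKL subxx; congr (_%:R); apply: eq_card => w.
by rewrite inE andb_idl // inE => /andP[].
Qed.

Lemma xJ_set0 : xJ S set0 = #|W|%:R *: eL S set0.
Proof.
rewrite eL_sum ?sub0set // powerset0 big_set1 mKL_set0; congr (_%:R *: _).
by apply: eq_card => w; rewrite Xset_set0.
Qed.

Lemma xJ_sv i : xJ S [set sv i] =
  #|Xsharp S [set sv i]|%:R *: eL S [set sv i] + #|Xset S [set sv i]|%:R *: eL S set0.
Proof.
rewrite eL_sum ?sub1_sv // -{1}[[set sv i]]setU0 sum_powersetU1 ?inE // powerset0 !big_set1.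
by rewrite setU0 mKL_set0 mKL_self addrC.
Qed.

(** * A parabolic subgroup of rank two *)

Section RankTwo.
Variables i0 j0 : 'I_n.
Hypothesis ij : i0 != j0.
Local Notation s := (sv i0).
Local Notation t := (sv j0).
Local Notation r := (sv i0 * sv j0)%g.
Local Notation R := <[(sv i0 * sv j0)%g]>%g.
Local Notation L := [set sv i0; sv j0].
Local Notation WL := <<[set sv i0; sv j0]>>%g.
Local Notation VL := (root_span L).
Local Notation FixL := (Fix rho WL).
Local Notation N := 'N_W(WL)%g.
Local Notation w0 := (longest L).
Implicit Types (c d y z : gT).

Lemma pair_sub : L \subset S.
Proof. by rewrite subUset !sub1set !mem_sv. Qed.

Lemma sv_pairP i : reflect (i = i0 \/ i = j0) (sv i \in L).
Proof. by rewrite !inE !(inj_eq (cox_inj cox)); apply: pred2P. Qed.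

Lemma pair_s : s \in L. Proof. by rewrite set21. Qed.

Lemma pair_t : t \in L. Proof. by rewrite set22. Qed.

Lemma pair_W u : u \in WL -> u \in W. Proof. exact: (parabolic_sub pair_sub). Qed.

Lemma pair_N u : u \in WL -> u \in N. Proof. exact: (parabolic_norm pair_sub). Qed.

Lemma s_WL : s \in WL. Proof. by rewrite mem_gen ?pair_s. Qed.

Lemma r_WL : r \in WL. Proof. by rewrite groupM ?mem_gen ?pair_s ?pair_t. Qed.

Lemma rot_WL x : x \in R -> x \in WL.
Proof. by move=> xR; apply: (subsetP _ _ xR); rewrite cycle_subG r_WL. Qed.

Lemma s_rot_WL x : x \in R -> (s * x)%g \in WL.
Proof. by move=> xR; rewrite groupM ?s_WL ?rot_WL. Qed.

Lemma rotC x y : x \in R -> y \in R -> (x * y = y * x)%g.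
Proof. by move=> xR yR; apply: (centsP (cycle_abelian r)). Qed.

Lemma rotJ x y : x \in R -> y \in R -> (x ^ y = x)%g.
Proof. by move=> xR yR; rewrite conjgE (rotC xR yR) mulKg. Qed.

Lemma rotJs x : x \in R -> (x ^ s = x^-1)%g.
Proof.
case/cycleP=> k ->; rewrite conjXg -expgVn; congr (_ ^+ _)%g.
by rewrite conjgE invMg !svV !mulgA svK mul1g.
Qed.

Lemma rot_mul_s x : x \in R -> (x * s = s * x^-1)%g.
Proof. by move=> xR; rewrite -rotJs // conjgE svV !mulgA svK mul1g. Qed.

Lemma s_rotK x : x \in R -> (s * x * (s * x) = 1)%g.
Proof. by move=> xR; rewrite mulgA -(mulgA s) rot_mul_s // mulgA svK mul1g mulVg. Qed.

Lemma dihedral_cases u : u \in WL -> u \in R \/ (s * u)%g \in R.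
Proof.
move: u; apply: parabolic_ind; rewrite ?pair_sub //; first by left; apply: group1.
move=> i u /sv_pairP[]-> uL [] uR.
- by right; rewrite svKl.
- by left.
- by right; rewrite mulgA groupM ?cycle_id.
left; have -> : (t * u = r^-1 * (s * u))%g by rewrite invMg !svV -mulgA svKl.
by rewrite groupM ?groupV ?cycle_id.
Qed.

Lemma det_rot x : x \in R -> \det (rho x) = 1.
Proof.
case/cycleP=> k ->; have rW := pair_W r_WL; elim: k => [|k IHk].
  by rewrite expg0 rho1 det1.
rewrite expgS rhoM ?groupX // det_mulmx IHk mulr1.
by rewrite rhoM ?sv_W // det_mulmx !det_rho_sv mulrNN mulr1.
Qed.

Lemma det_s_rot x : x \in R -> \det (rho (s * x)%g) = -1.
Proof.
move=> xR; rewrite rhoM ?sv_W ?(pair_W (rot_WL xR)) // det_mulmx det_rho_sv.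
by rewrite (det_rot xR) mulr1.
Qed.

Lemma mem_rot u : u \in WL -> (u \in R) = (\det (rho u) == 1).
Proof.
move=> uL; apply/idP/idP => [/det_rot->//|]; case: (dihedral_cases uL) => // /det_s_rot.
by rewrite svKl => ->; rewrite oppr1_eq1.
Qed.

Lemma mem_s_rot u : u \in WL -> ((s * u)%g \in R) = (\det (rho u) == -1).
Proof.
move=> uL; apply/idP/idP => [/det_s_rot|]; first by rewrite svKl => ->.
by case: (dihedral_cases uL) => // /det_rot->; rewrite eq_sym oppr1_eq1.
Qed.

Lemma s_rot_notin x : x \in R -> (s * x)%g \notin R.
Proof. by move=> xR; rewrite mem_rot ?s_rot_WL // det_s_rot // oppr1_eq1. Qed.

Lemma sum_dihedral (V : nmodType) (F : gT -> V) :
  \sum_(u in WL) F u = \sum_(x in R) F x + \sum_(x in R) F (s * x)%g.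
Proof.
rewrite (bigID (mem R)) /=; congr (_ + _).
  by apply: eq_bigl => u; apply: andb_idl => /rot_WL.
rewrite (reindex_inj (mulgI s)) /=; apply: eq_bigl => x.
apply/andP/idP => [[sxL sxR]|xR]; last by rewrite s_rot_WL // s_rot_notin.
by case: (dihedral_cases sxL) => [h|]; [rewrite h in sxR | rewrite svKl].
Qed.

Definition pair_index (k : 'I_2) : 'I_n := if k == 0 then i0 else j0.

Definition plane_basis : 'M[algC]_(2, n) := \matrix_(k < 2) alpha (pair_index k).

Definition plane_mx g : 'M[algC]_2 := \matrix_(k, l) rho g (pair_index k) (pair_index l).

Lemma card_pair : #|L| = 2%N.
Proof. by rewrite cards2 (inj_eq (cox_inj cox)) ij. Qed.

Lemma pair_indexP k : sv (pair_index k) \in L.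
Proof. by rewrite /pair_index; case: eqP => _; rewrite ?pair_s ?pair_t. Qed.

Lemma plane_basis_span : (plane_basis :=: VL)%MS.
Proof.
apply/eqmxP/andP; split.
  by apply/row_subP => k; rewrite rowK alpha_span ?pair_indexP.
apply/sumsmx_subP => k /sv_pairP[]->; rewrite genmxE.
  by have := row_sub 0 plane_basis; rewrite rowK.
by have := row_sub 1 plane_basis; rewrite rowK.
Qed.

Lemma plane_basis_free : row_free plane_basis.
Proof. by rewrite /row_free plane_basis_span rank_root_span ?pair_sub ?card_pair. Qed.

Lemma plane_decomp (v : 'rV[algC]_n) : (v <= VL)%MS ->
  v = v 0 i0 *: alpha i0 + v 0 j0 *: alpha j0.
Proof.
move=> vL; rewrite {1}[v]row_sum_delta (bigD1 i0) //= (bigD1 j0) /=; last by rewrite eq_sym.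
rewrite big1 ?addr0 // => k /andP[ki kj]; rewrite (root_span_coord vL) ?scale0r //.
by apply/sv_pairP => -[] k_eq; [rewrite k_eq eqxx in ki | rewrite k_eq eqxx in kj].
Qed.

Lemma plane_basis_rho g : g \in N -> plane_basis *m rho g = plane_mx g *m plane_basis.
Proof.
move=> gN; apply/row_matrixP => k; rewrite !row_mul rowK -rowE.
have rootL := root_norm_span pair_sub (pair_indexP k) gN.
rewrite [RHS](_ : _ = plane_mx g k 0 *: alpha i0 + plane_mx g k 1 *: alpha j0).
  by rewrite [LHS](plane_decomp rootL) !mxE.
rewrite [row k _]row_sum_delta mulmx_suml !big_ord_recl big_ord0 addr0.
by rewrite -!scalemxAl -!rowE !rowK !mxE; congr (rho g _ _ *: _ + rho g _ _ *: _).
Qed.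

Lemma plane_mxM g h : g \in N -> h \in N -> plane_mx (g * h)%g = plane_mx g *m plane_mx h.
Proof.
move=> gN hN; have [gW _] := norm_parabolicP gN; have [hW _] := norm_parabolicP hN.
apply: (row_free_inj plane_basis_free).
by rewrite -plane_basis_rho ?groupM // rhoM // mulmxA !plane_basis_rho // -!mulmxA plane_basis_rho.
Qed.

Lemma plane_mx1 : plane_mx 1%g = 1.
Proof.
apply: (row_free_inj plane_basis_free).
by rewrite -plane_basis_rho ?group1 // rho1 mulmx1 mul1mx.
Qed.

Lemma plane_mxX g k : g \in N -> plane_mx (g ^+ k)%g = plane_mx g ^+ k.
Proof.
move=> gN; elim: k => [|k IHk]; first by rewrite expg0 plane_mx1.
by rewrite expgS plane_mxM ?groupX // IHk exprS.
Qed.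

Lemma det_restr_plane g : g \in N -> \det (restr VL (rho g)) = \det (plane_mx g).
Proof.
by move=> gN; apply: (det_restr_basis plane_basis_free plane_basis_span); apply: plane_basis_rho.
Qed.

Lemma det_plane_mx g : \det (plane_mx g) = rho g i0 i0 * rho g j0 j0 - rho g i0 j0 * rho g j0 i0.
Proof. by rewrite det_mx22 !mxE. Qed.

Lemma det_plane_fix g a b : root i0 g = a *: alpha i0 -> root j0 g = b *: alpha j0 ->
  \det (plane_mx g) = a * b.
Proof.
move=> /rowP ei /rowP ej; rewrite det_plane_mx.
have := (ei i0, ei j0, ej i0, ej j0); rewrite !mxE !eqxx /= [j0 == i0]eq_sym (negPf ij).
by move=> -[[[-> ->] ->] ->]; rewrite !mulr1 !mulr0 subr0.
Qed.

Lemma det_plane_swap g a b : root i0 g = a *: alpha j0 -> root j0 g = b *: alpha i0 ->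
  \det (plane_mx g) = - (a * b).
Proof.
move=> /rowP ei /rowP ej; rewrite det_plane_mx.
have := (ei i0, ei j0, ej i0, ej j0); rewrite !mxE !eqxx /= [j0 == i0]eq_sym (negPf ij).
by move=> -[[[-> ->] ->] ->]; rewrite !mulr1 !mulr0 sub0r.
Qed.

Lemma alphaL_parabolic u : u \in WL -> alphaL rho L u = 1.
Proof.
move=> uL; rewrite /alphaL (det_restr_basis (B := row_base FixL) (A := 1%:M)) ?det1 //.
- exact: row_base_free.
- exact: eq_row_base.
have /sub_FixP -> // : (row_base FixL <= FixL)%MS by rewrite eq_row_base.
by rewrite mul1mx.
Qed.

Lemma det_plane_parabolic u : u \in WL -> \det (plane_mx u) = \det (rho u).
Proof.
move=> uL; have uN := pair_N uL.
rewrite -det_restr_plane // -[RHS]/(epsilon rho u) (epsilon_norm pair_sub uN).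
by rewrite alphaL_parabolic ?mul1r.
Qed.

Lemma signed_dominant_pair b w : w \in N -> signed_dominant L b w ->
  (root i0 w = (-1) ^+ b *: alpha i0 /\ root j0 w = (-1) ^+ b *: alpha j0) \/
  (root i0 w = (-1) ^+ b *: alpha j0 /\ root j0 w = (-1) ^+ b *: alpha i0).
Proof.
move=> wN wb; have [wW _] := norm_parabolicP wN.
have [k /sv_pairP k_eq ek] := signed_dominant_simple pair_sub wN wb pair_s.
have [l /sv_pairP l_eq el] := signed_dominant_simple pair_sub wN wb pair_t.
have kl : k != l.
  apply: contra ij => /eqP kl; have : root i0 w = root j0 w by rewrite ek el kl.
  move/(congr1 (mulmx^~ (rho w^-1%g))); rewrite /= !root_mulV // => /rowP/(_ j0)/eqP.
  by rewrite !mxE !eqxx /= [j0 == i0]eq_sym; case: (i0 == j0); rewrite //= eq_sym oner_eq0.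
by case: k_eq => k_eq; case: l_eq => l_eq; rewrite k_eq l_eq ?eqxx // in kl ek el; [left | right].
Qed.

Definition delta g : algC := epsilon rho g * alphaL rho L g.

Lemma conj_cases g : g \in N ->
  (\det (plane_mx g) = 1 /\ forall x, x \in R -> (x ^ g = x)%g) \/
  (\det (plane_mx g) = -1 /\ forall x, x \in R -> (x ^ g = x^-1)%g).
Proof.
move=> gN; have [u [d [uL dN dX ->]]] := norm_decomp pair_sub gN.
have uN := pair_N uL; have [dW _] := norm_parabolicP dN.
have u_cases : (\det (plane_mx u) = 1 /\ forall x, x \in R -> (x ^ u = x)%g) \/
    (\det (plane_mx u) = -1 /\ forall x, x \in R -> (x ^ u = x^-1)%g).
  rewrite det_plane_parabolic //; case: (dihedral_cases uL) => uR.
    by left; split=> [|x xR]; rewrite ?det_rot ?rotJ.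
  right; rewrite -[u](svKl i0) det_s_rot //; split=> // x xR.
  by rewrite conjgM rotJs // rotJ ?groupV.
have d_cases : (\det (plane_mx d) = 1 /\ forall x, x \in R -> (x ^ d = x)%g) \/
    (\det (plane_mx d) = -1 /\ forall x, x \in R -> (x ^ d = x^-1)%g).
  have d_dom : signed_dominant L false d by apply/(Xset_dominant pair_sub dW).
  case: (signed_dominant_pair dN d_dom) => -[ei ej].
    left; rewrite (det_plane_fix ei ej) mulr1; split=> // x /cycleP[k ->].
    have sd : (s ^ d = s)%g by apply: conj_root => //; left; rewrite ei scale1r.
    have td : (t ^ d = t)%g by apply: conj_root => //; left; rewrite ej scale1r.
    by rewrite conjXg conjMg sd td.
  right; rewrite (det_plane_swap ei ej) mulr1; split=> // x /cycleP[k ->].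
  have sd : (s ^ d = t)%g by apply: conj_root => //; left; rewrite ei scale1r.
  have td : (t ^ d = s)%g by apply: conj_root => //; left; rewrite ej scale1r.
  by rewrite conjXg conjMg sd td -expgVn invMg !svV.
rewrite plane_mxM // det_mulmx.
case: u_cases d_cases => -[-> Ju] [] [-> Jd]; rewrite ?mulr1 ?mulrNN ?mul1r.
- by left; split=> // x xR; rewrite conjgM Ju ?Jd.
- by right; split=> // x xR; rewrite conjgM Ju ?Jd.
- by right; split=> // x xR; rewrite conjgM Ju // Jd ?groupV.
by left; split; rewrite ?mulr1 // => x xR; rewrite conjgM Ju // Jd ?groupV // invgK.
Qed.

Lemma delta_det_plane g : g \in N -> delta g = \det (plane_mx g).
Proof.
move=> gN; have [gW _] := norm_parabolicP gN.
have eE : epsilon rho g = alphaL rho L g * \det (plane_mx g).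
  by rewrite (epsilon_norm pair_sub gN) det_restr_plane.
have epsilon_sqr : epsilon rho g * epsilon rho g = 1.
  by rewrite /epsilon det_rho // -expr2 sqrr_sign.
have d2 : \det (plane_mx g) * \det (plane_mx g) = 1.
  by case: (conj_cases gN) => -[-> _]; rewrite ?mulrNN mulr1.
have a2 : alphaL rho L g * alphaL rho L g = 1.
  by move: epsilon_sqr; rewrite eE mulrACA d2 mulr1.
by rewrite /delta eE mulrAC a2 mul1r.
Qed.

Lemma delta_cases g : g \in N ->
  (delta g = 1 /\ forall x, x \in R -> (x ^ g = x)%g) \/
  (delta g = -1 /\ forall x, x \in R -> (x ^ g = x^-1)%g).
Proof. by move=> gN; rewrite delta_det_plane //; apply: conj_cases. Qed.

Lemma deltaM g h : g \in N -> h \in N -> delta (g * h)%g = delta g * delta h.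
Proof. by move=> gN hN; rewrite !delta_det_plane ?groupM // plane_mxM // det_mulmx. Qed.

Lemma delta_parabolic u : u \in WL -> delta u = \det (rho u).
Proof. by move=> uL; rewrite delta_det_plane ?pair_N // det_plane_parabolic. Qed.

Lemma delta1 : delta 1%g = 1.
Proof. by rewrite delta_parabolic ?group1 // rho1 det1. Qed.

Lemma delta_sqr g : g \in N -> delta g * delta g = 1.
Proof. by move=> gN; case: (delta_cases gN) => -[-> _]; rewrite ?mulrNN mulr1. Qed.

Lemma deltaJ g y : g \in N -> y \in N -> delta (g ^ y)%g = delta g.
Proof.
move=> gN yN; have yVN : y^-1%g \in N by rewrite groupV.
by rewrite conjgE !deltaM ?groupM // mulrCA -deltaM // mulVg delta1 mulr1.
Qed.

Lemma rot_norm g x : g \in N -> ((x ^ g)%g \in R) = (x \in R).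
Proof.
move=> gN; have sub h y : h \in N -> y \in R -> (y ^ h)%g \in R.
  by move=> hN yR; case: (delta_cases hN) => -[_ ->]; rewrite ?groupV.
apply/idP/idP => [xR|]; last exact: sub.
by rewrite -(conjgK g x); apply: sub; rewrite ?groupV.
Qed.

Lemma cuspidal_rot w : w \in WL -> cuspidal sv rho L w = (w \in R) && (w != 1%g).
Proof.
move=> wL; have wN := pair_N wL; have wW := pair_W wL.
apply/(cuspidalP pair_sub)/andP => [[_ cusp]|[wR w1]].
  have w1 : w != 1%g.
    apply: contraTneq isT => w1; have := cusp _ (alpha_span pair_s); rewrite w1 rho1 mulmx1.
    by move=> /(_ erefl)/rowP/(_ i0)/eqP; rewrite !mxE !eqxx oner_eq0.
  split=> //; case: (dihedral_cases wL) => // swR.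
  have w2 : (w * w = 1)%g by have := s_rotK swR; rewrite svKl.
  have neg i : sv i \in L -> root i w = -1 *: alpha i.
    move=> iL; apply/eqP; rewrite scaleN1r -addr_eq0; apply/eqP; apply: cusp.
      by rewrite addmx_sub ?root_norm_span ?alpha_span ?pair_sub.
    by rewrite mulmxDl -rowE -row_mul -rhoM // w2 rho1 row1 addrC.
  have := det_plane_fix (neg i0 pair_s) (neg j0 pair_t).
  by rewrite det_plane_parabolic // mulrNN mulr1 mem_rot // => ->.
split=> // v vL vw; apply/eqP; apply: contraNT w1 => v_neq0; apply/eqP.
have detA : \det (plane_mx w) = 1 by rewrite det_plane_parabolic ?det_rot.
have AX : plane_mx w ^+ #[w] = 1 by rewrite -plane_mxX // expg_order plane_mx1.
have detA1 : \det (plane_mx w - 1) = 0.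
  move: vL; rewrite -plane_basis_span => /submxP[c vE]; apply/eqP/det0P; exists c.
    by apply: contra v_neq0 => /eqP c0; rewrite vE c0 mul0mx.
  apply: (row_free_inj plane_basis_free).
  by rewrite mul0mx mulmxBr mulmxBl mulmx1 -mulmxA -plane_basis_rho // mulmxA -vE vw subrr.
have A1 := mx22_finite_order_eq1 (order_gt0 w) AX detA detA1.
apply: (parabolic_dominant_eq1 pair_sub wL) => i iL; rewrite scale1r.
have : plane_basis *m rho w = plane_basis by rewrite plane_basis_rho // A1 mul1mx.
case/sv_pairP: iL => ->; [move/(congr1 (row 0)) | move/(congr1 (row 1))];
  by rewrite row_mul rowK -rowE => ->; rewrite nonneg_delta.
Qed.

Definition cocycle g : gT := (s * s ^ g)%g.

Lemma cocycle_rot g : g \in N -> cocycle g \in R.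
Proof.
move=> gN; have [gW gJ] := norm_parabolicP gN.
by rewrite mem_s_rot ?gJ ?s_WL // det_rhoJ ?sv_W // det_rho_sv.
Qed.

Lemma conj_s g : (s ^ g = s * cocycle g)%g.
Proof. by rewrite svKl. Qed.

Lemma cocycleM g h : cocycle (g * h)%g = (cocycle h * cocycle g ^ h)%g.
Proof.
have sJ2 : (s ^ h * s ^ h = 1)%g by rewrite -conjMg svK conj1g.
by rewrite /cocycle conjgM (conjMg s) -(mulgA s) (mulgA (s ^ h)%g (s ^ h)%g) sJ2 mul1g.
Qed.

Lemma cocycle1 : cocycle 1%g = 1%g.
Proof. by rewrite /cocycle conjg1 svK. Qed.

Lemma cocycle_s : cocycle s = 1%g.
Proof. by rewrite /cocycle conjgE mulKg svK. Qed.

Lemma cocycle_of_rot x : x \in R -> cocycle x = (x ^+ 2)%g.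
Proof.
move=> xR; rewrite /cocycle conjgE (mulgA x^-1%g) (rot_mul_s (groupVr xR)) invgK.
by rewrite -mulgA svKl expg2.
Qed.

Lemma cocycle_rot_conj g x : g \in N -> x \in R ->
  cocycle (x * g * x^-1)%g = (cocycle g * ((x ^+ 2) ^ g * x ^- 2))%g.
Proof.
move=> gN xR; have xVR : x^-1%g \in R by rewrite groupV.
have zR := cocycle_rot gN; have yR : ((x ^+ 2) ^ g)%g \in R by rewrite rot_norm ?groupX.
rewrite !cocycleM (cocycle_of_rot xR) (cocycle_of_rot xVR) expgVn (rotJ (groupM zR yR) xVR).
by rewrite [RHS]mulgA (rotC (groupM zR yR)) // groupV groupX.
Qed.

Lemma cocycle_s_conj g : g \in N -> cocycle (s * g * s^-1)%g = (cocycle g)^-1%g.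
Proof.
move=> gN; rewrite !cocycleM cocycle_s conj1g mulg1 svV cocycle_s mul1g.
by rewrite rotJs ?cocycle_rot.
Qed.

(** [g] permutes the simple roots of [L] up to a common sign. *)
Definition preserves_base g : bool := cocycle g == (if delta g == 1 then 1%g else r).

Lemma signed_dominant_preserves b w : w \in N -> signed_dominant L b w -> preserves_base w.
Proof.
move=> wN wb; have [wW _] := norm_parabolicP wN.
have signed i j : root i w = (-1) ^+ b *: alpha j -> (sv i ^ w)%g = sv j.
  move=> e; apply: conj_root => //; rewrite e.
  by case: (b); rewrite ?expr1 ?expr0 ?scaleN1r ?scale1r; [right | left].
rewrite /preserves_base /cocycle delta_det_plane //.
case: (signed_dominant_pair wN wb) => -[ei ej]; rewrite (signed _ _ ei).
  by rewrite (det_plane_fix ei ej) -expr2 sqrr_sign eqxx svK.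
by rewrite (det_plane_swap ei ej) -expr2 sqrr_sign oppr1_eq1.
Qed.

Lemma preserves_baseM g d : g \in N -> d \in N -> preserves_base d ->
  preserves_base (g * d)%g = preserves_base g.
Proof.
move=> gN dN; have zR := cocycle_rot gN.
rewrite /preserves_base cocycleM deltaM //; case: (delta_cases dN) => -[-> Jd].
  by rewrite eqxx => /eqP->; rewrite Jd // mul1g mulr1.
rewrite oppr1_eq1 => /eqP->; rewrite Jd // mulrN1.
case: (delta_cases gN) => -[-> _]; rewrite ?opprK ?oppr1_eq1 eqxx.
  by rewrite -{2}[r]mulg1 (inj_eq (mulgI r)) invg_eq1.
by rewrite -eq_mulgV1 eq_sym.
Qed.

Lemma preserves_base_roots v : v \in WL -> preserves_base v ->
  exists a b : algC, [/\ a = 1 \/ a = -1, b = 1 \/ b = -1, a * b = 1 &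
    (root i0 v = a *: alpha i0 /\ root j0 v = b *: alpha j0) \/
    (root i0 v = a *: alpha j0 /\ root j0 v = b *: alpha i0)].
Proof.
move=> vL v_pres; have vN := pair_N vL; have vW := pair_W vL.
have signed i j : (sv i ^ v)%g = sv j ->
    exists2 a : algC, a = 1 \/ a = -1 & root i v = a *: alpha j.
  by case/(root_conj vW) => ->; [exists 1 | exists (-1)]; rewrite ?scale1r ?scaleN1r; auto.
have tv : (t ^ v = s ^ v * r ^ v)%g by rewrite -conjMg svKl.
move: v_pres; rewrite /preserves_base; case: (delta_cases vN) => -[dE Jv]; rewrite dE.
  rewrite eqxx => /eqP cv; move: tv (conj_s v); rewrite cv mulg1 (Jv r (cycle_id r)) => tv s_v.
  rewrite s_v svKl in tv.
  have [a ha ea] := signed _ _ s_v; have [b hb eb] := signed _ _ tv.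
  by exists a, b; split; auto; rewrite -(det_plane_fix ea eb) -delta_det_plane.
rewrite oppr1_eq1 => /eqP cv; move: tv (conj_s v); rewrite cv svKl (Jv r (cycle_id r)) => tv s_v.
rewrite s_v invMg !svV svKl in tv.
have [a ha ea] := signed _ _ s_v; have [b hb eb] := signed _ _ tv.
exists a, b; split; auto.
by rewrite -[LHS]opprK -(det_plane_swap ea eb) -delta_det_plane // dE opprK.
Qed.

Lemma preserves_base_parabolic v : v \in WL ->
  preserves_base v = (v == 1%g) || (v == w0).
Proof.
move=> vL; have vN := pair_N vL.
apply/idP/orP => [/(preserves_base_roots vL)[a [b [ha hb ab roots]]] | []/eqP->]; last first.
- exact: signed_dominant_preserves (longest_norm pair_sub) (longest_dominant pair_sub).
- exact: signed_dominant_preserves (group1 _) (@signed_dominant1 L).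
have ba : b = a.
  by move: ab; case: ha hb => -> [] -> //; rewrite ?mulr1 ?mul1r => /eqP; rewrite oppr1_eq1.
have v_dom (e : bool) : a = (-1) ^+ e -> signed_dominant L e v.
  move=> aE i /sv_pairP i_eq; rewrite -aE; have aa : a * a = 1 by rewrite -{2}ba.
  by case: roots i_eq => -[ei ej] [] ->; rewrite ?ei ?ej ?ba scalerA aa scale1r nonneg_delta.
case: ha => aE; [left | right]; apply/eqP.
  exact: (parabolic_dominant_eq1 pair_sub vL (v_dom false aE)).
exact: (longest_uniq pair_sub vL (v_dom true aE)).
Qed.

Lemma preserves_base_coset v d : v \in WL -> d \in N -> d \in Xset S L ->
  preserves_base (v * d)%g = ((v * d)%g == d) || ((v * d)%g == (w0 * d)%g).
Proof.
move=> vL dN dX; have [dW _] := norm_parabolicP dN.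
have d_dom : signed_dominant L false d by apply/(Xset_dominant pair_sub dW).
rewrite (preserves_baseM (pair_N vL) dN (signed_dominant_preserves dN d_dom)).
by rewrite preserves_base_parabolic // -{2}[d]mul1g !(inj_eq (mulIg d)).
Qed.

(** * The component of the Orlik-Solomon algebra at [Fix W_L] *)

Local Notation T := (Tset [set sv i | i : 'I_n]).
Local Notation TL := (T :&: WL).
Local Notation EX2 := (EX rho S 2 FixL).
Local Notation I2 := (OSideal rho S 2).
Local Notation A2 := (EX2 + I2)%MS.

Lemma s_rot_refl x : x \in R -> (s * x)%g \in T.
Proof.
have s_conj k : (s ^ (r ^+ k) = s * r ^+ k.*2)%g.
  by rewrite conj_s cocycle_of_rot ?mem_cycle // -expgM muln2.
have t_conj k : (t ^ (r ^+ k) = s * r ^+ k.*2.+1)%g.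
  by rewrite -{1}[t](svKl i0) conjMg s_conj (rotJ (cycle_id r)) ?mem_cycle // expgSr -(mulgA s).
case/cycleP=> k ->; rewrite -(odd_double_half k); case: odd; rewrite ?add1n ?add0n.
  by rewrite -t_conj; apply: refl_J (sv_refl _) _; rewrite groupX ?pair_W ?r_WL.
by rewrite -s_conj; apply: refl_J (sv_refl _) _; rewrite groupX ?pair_W ?r_WL.
Qed.

Lemma mem_TL a : (a \in TL) = ((s * a)%g \in R).
Proof.
apply/setIP/idP => [[aT aL]|aR]; last first.
  by rewrite -[a](svKl i0) s_rot_WL ?s_rot_refl.
by rewrite mem_s_rot //; have [b -> b_unit] := refl_reflmx aT; rewrite det_reflmx.
Qed.

Lemma memJ_TL g a : g \in N -> ((a ^ g)%g \in TL) = (a \in TL).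
Proof.
move=> gN; have [gW gJ] := norm_parabolicP gN.
rewrite !inE gJ; congr (_ && _); apply/idP/idP => [aT|]; last by move/refl_J; apply.
by rewrite -(conjgK g a) refl_J ?groupV.
Qed.

Lemma s_TL : s \in TL.
Proof. by rewrite mem_TL svK group1. Qed.

Lemma sub_capHP m (A : 'M[algC]_(m, n)) (Q : {set gT}) :
  reflect (forall a, a \in Q -> A *m rho a = A) (A <= capH rho Q)%MS.
Proof.
apply: (iffP sub_bigcapmxP) => fixA a aQ; last by rewrite sub_ker_rho fixA.
by apply/eqP; rewrite -sub_ker_rho fixA.
Qed.

Lemma rank_ker_form m (C : 'M[algC]_(m, n)) : \rank (kermx (G *m C^T)) = (n - \rank C)%N.
Proof.
rewrite mxrank_ker; congr (_ - _)%N.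
by rewrite (eqmxMfull _ _) ?mxrank_tr // row_full_unit Gram_unit.
Qed.

Lemma rank_capH2 a b : a \in T -> b \in T -> a != b -> \rank (capH rho [set a; b]) = (n - 2)%N.
Proof.
move=> aT bT ab; have [u ru u_unit] := refl_reflmx aT; have [v rv v_unit] := refl_reflmx bT.
have uv_rank : \rank (col_mx u v) = 2%N.
  apply/eqP; rewrite eqn_leq rank_leq_row /= -addsmxE.
  have u1 : \rank u = 1%N by rewrite rank_rV (form_unit_neq0 u_unit).
  have : (u < u + v)%MS.
    rewrite ltmxE addsmxSl /=; apply: contra ab => vu; apply/eqP/rho_inj; rewrite ?refl_W //.
    by rewrite ru rv (reflmx_sub u_unit v_unit) // (submx_trans (addsmxSr _ _) vu).
  by rewrite ltmxErank addsmxSl u1.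
rewrite -uv_rank -rank_ker_form.
suff -> : (capH rho [set a; b] :=: kermx (G *m (col_mx u v)^T))%MS by [].
apply: eqmx_of_sub => C.
rewrite sub_kermx tr_col_mx mul_mx_row mul_mx_row row_mx_eq0 !mulmxA.
rewrite -!sub_ker_reflmx // -ru -rv !sub_ker_rho.
apply/sub_capHP/andP => [fixC|[/eqP fix_a /eqP fix_b] c /set2P[]->//].
by split; apply/eqP/fixC; rewrite !inE eqxx ?orbT.
Qed.

Lemma n_gt1 : (1 < n)%N.
Proof.
by rewrite -card_pair (leq_trans (subset_leq_card pair_sub)) // (leq_trans (leq_imset_card _ _))
  ?card_ord.
Qed.

Lemma not_dependent2 (Q : {set gT}) : Q \subset T -> (#|Q| <= 2)%N -> dependent rho Q = false.
Proof.
move=> QT; rewrite leq_eqVlt /dependent => /orP[/cards2P[a [b [ab e]]]|].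
  move: QT; rewrite e subUset !sub1set => /andP[aT bT].
  by rewrite cards2 ab rank_capH2 // subKn ?n_gt1.
rewrite ltnS => Q1; case: (set_0Vmem Q) => [->|[a aQ]]; first by rewrite cards0.
apply/negbTE; rewrite -leqNgt (leq_trans Q1) // subn_gt0 ltnNge; apply/negP => full.
have fix1 : (1%:M <= capH rho Q)%MS by rewrite sub1mx -col_leq_rank.
have := sub_capHP _ _ fix1 a aQ; rewrite mul1mx => rho_a.
have [b rb b_unit] := refl_reflmx (subsetP QT a aQ).
by have := det_reflmx b_unit; rewrite -rb rho_a det1 => /eqP; rewrite eq_sym oppr1_eq1.
Qed.

Lemma rank_FixL : \rank FixL = (n - 2)%N.
Proof. by rewrite rank_Fix ?pair_sub // card_pair. Qed.

Lemma Fix_sub_capH (Q : {set gT}) : Q \subset TL -> (FixL <= capH rho Q)%MS.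
Proof.
move=> QTL; apply/sub_capHP => a /(subsetP QTL)/setIP[_ aL].
exact: Fix_mul.
Qed.

Lemma Fix_sub_capHE (Q : {set gT}) : Q \subset T -> (FixL <= capH rho Q)%MS = (Q \subset TL).
Proof.
move=> QT; apply/idP/idP => [/sub_capHP fixL|]; last exact: Fix_sub_capH.
rewrite subsetI QT; apply/subsetP => a aQ.
by apply: (Fix_stabilizer pair_sub); rewrite ?refl_W ?(subsetP QT) ?fixL.
Qed.

Lemma capH2_eq_Fix a b : a \in T -> b \in T -> a != b ->
  (capH rho [set a; b] == FixL)%MS = ([set a; b] \subset TL).
Proof.
move=> aT bT ab; have abT : [set a; b] \subset T by rewrite subUset !sub1set aT.
rewrite -(Fix_sub_capHE abT); apply/andP/idP => [[]//|fixL]; split=> //.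
by rewrite -(mxrank_leqif_sup fixL).2 rank_FixL rank_capH2.
Qed.

(* Two distinct hyperplanes of a dependent triple already cut out its flat. *)
Lemma dependent3_TL (Q : {set gT}) a b : Q \subset T -> dependent rho Q -> #|Q| = 3%N ->
  a \in Q :&: TL -> b \in Q :&: TL -> a != b -> Q \subset TL.
Proof.
move=> QT dep Q3 /setIP[aQ aTL] /setIP[bQ bTL] ab; rewrite -(Fix_sub_capHE QT).
have abQ : [set a; b] \subset Q by rewrite subUset !sub1set aQ.
have [aT bT] := (subsetP QT a aQ, subsetP QT b bQ).
have abTL : [set a; b] \subset TL by rewrite subUset !sub1set aTL.
have sub : (capH rho Q <= capH rho [set a; b])%MS.
  by apply/sub_capHP => c /(subsetP abQ) cQ; have /sub_capHP := submx_refl (capH rho Q); apply.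
apply: submx_trans (Fix_sub_capH abTL) _.
rewrite -(mxrank_leqif_sup sub).2 eqn_leq mxrankS //= rank_capH2 //.
by move: dep; rewrite /dependent Q3 ltnS !leq_subLR addnC.
Qed.

Lemma EX_subP p (Z : 'M[algC]_(p, eN gT)) :
  (EX2 <= Z)%MS <-> (forall a b, a \in TL -> b \in TL -> (wedge [:: a; b] <= Z)%MS).
Proof.
split=> [/sumsmx_subP EXZ|EXZ].
  apply: enum_rank_wlog => [a _ _|a b ab bT aT|a b lt aTL bTL].
  - by rewrite wedge_diag sub0mx.
  - by rewrite wedgeN eqmx_opp ab.
  have ab : a != b by apply: contraTneq lt => ->; rewrite ltnn.
  have [[aT _] [bT _]] := (setIP aTL, setIP bTL).
  have := EXZ [set a; b]; rewrite powersetE subUset !sub1set aT bT cards2 ab /= capH2_eq_Fix //.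
  by rewrite subUset !sub1set aTL bTL genmxE enum_set2 //; apply.
apply/sumsmx_subP => Q /andP[]; rewrite powersetE => QT /andP[/cards2P[a [b [ab QE]]]].
have [aQ bQ] : a \in Q /\ b \in Q by rewrite QE !inE !eqxx orbT.
have -> : (capH rho Q == FixL)%MS = (Q \subset TL) by rewrite QE capH2_eq_Fix ?(subsetP QT).
move=> QTL; rewrite genmxE.
have : size (enum Q) = 2%N by rewrite -cardE QE cards2 ab.
have enum_TL c : c \in enum Q -> c \in TL by rewrite mem_enum => /(subsetP QTL).
case e: (enum Q) enum_TL => [|x [|y [|? ?]]] // enum_TL _.
by apply: EXZ; apply: enum_TL; rewrite !inE eqxx ?orbT.
Qed.

Lemma wedge_sub_EX a b : a \in TL -> b \in TL -> (wedge [:: a; b] <= EX2)%MS.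
Proof. by have /EX_subP := submx_refl EX2; apply. Qed.

Lemma OSideal_subP p (Z : 'M[algC]_(p, eN gT)) :
  (I2 <= Z)%MS <-> (forall a b c, uniq [:: a; b; c] -> [set a; b; c] \subset T ->
     dependent rho [set a; b; c] -> (boundary3 a b c <= Z)%MS).
Proof.
split=> [/sumsmx_subP IZ a b c abc abcT dep|IZ].
  have := IZ set0; rewrite powersetE sub0set => /(_ isT)/sumsmx_subP/(_ [set a; b; c]).
  by rewrite powersetE abcT dep cards0 cards3_uniq //= genmxE rel_set0_sub //; apply.
apply/sumsmx_subP => U; rewrite powersetE => UT; apply/sumsmx_subP => Q /andP[].
rewrite powersetE => QT /andP[dep /eqP cUQ]; rewrite genmxE.
have Q3 : #|Q| = 3%N.
  apply/eqP; rewrite eqn_leq -{1}cUQ leq_addl ltnNge /=.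
  by apply: contraTN dep => /(not_dependent2 QT)->.
have /eqP/cards0_eq -> : #|U| == 0%N by rewrite -(eqn_add2r 3) -{1}Q3 cUQ.
have := enum_uniq (mem Q); have := cardE Q; rewrite Q3.
case e: (enum Q) => [|a [|b [|c [|? ?]]]] //= _ abc.
have QE : Q = [set a; b; c] by apply/setP => x; rewrite -mem_enum e !inE orbA.
by rewrite (rel_set0 e); apply: IZ; rewrite -?QE.
Qed.

Lemma boundary3_sub_OSideal a b c :
    uniq [:: a; b; c] -> [set a; b; c] \subset T -> dependent rho [set a; b; c] ->
  (boundary3 a b c <= I2)%MS.
Proof. by have /OSideal_subP := submx_refl I2; apply. Qed.

(** [a_u a_v |-> v - u] on products of reflections of [W_L], and [0] on the other products,
    so that the relations of the other flats are killed. *)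
Definition difference_map : 'M[algC]_(eN gT, gN gT) := basis_map (fun Q : {set gT} =>
  if (Q \subset TL) && (#|Q| == 2%N)
  then gvec (nth 1%g (enum Q) 1) - gvec (nth 1%g (enum Q) 0) else 0).

Lemma wedge_difference a b : wedge [:: a; b] *m difference_map =
  if (a \in TL) && (b \in TL) then gvec b - gvec a else 0.
Proof.
move: a b; apply: enum_rank_wlog => [a|a b e|a b lt].
- by rewrite wedge_diag mul0mx subrr; case: ifP.
- by rewrite wedgeN mulNmx e andbC; case: ifP; rewrite ?oppr0 // opprB.
have ab : a != b by apply: contraTneq lt => ->; rewrite ltnn.
by rewrite wedge_lt // ebas_map subUset !sub1set cards2 ab andbT enum_set2.
Qed.

Lemma OSideal_difference : I2 *m difference_map = 0.
Proof.
apply/eqP; rewrite -sub_kermx; apply/OSideal_subP => a b c abc abcT dep.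
rewrite sub_kermx /boundary3 mulmxDl mulmxBl !wedge_difference.
have third x y z : [set a; b; c] = [set x; y; z] -> x \in TL -> y \in TL -> x != y -> z \in TL.
  move=> E xTL yTL xy; rewrite E in abcT dep; have xyz3 : #|[set x; y; z]| = 3%N.
    by rewrite -E cards3_uniq.
  have xQ : x \in [set x; y; z] :&: TL by rewrite in_setI xTL andbT !inE eqxx.
  have yQ : y \in [set x; y; z] :&: TL by rewrite in_setI yTL andbT !inE eqxx orbT.
  by apply: (subsetP (dependent3_TL abcT dep xyz3 xQ yQ xy)); rewrite !inE eqxx orbT.
have /and3P[ab ac bc] : [&& a != b, a != c & b != c].
  by move: abc; rewrite /= !inE negb_or andbT andbA.
case: (boolP (a \in TL)) => aTL; case: (boolP (b \in TL)) => bTL;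
  case: (boolP (c \in TL)) => cTL; rewrite /= ?subr0 ?addr0 ?eqxx //.
- by move: (gvec a) (gvec b) (gvec c) => x y z; apply/eqP/rowP => i; rewrite !mxE; ring.
- by rewrite (third a b c) in cTL.
- by rewrite (third a c b) // -!setUA [[set c] :|: _]setUC in bTL.
- by rewrite (third b c a) // -setUA setUC in aTL.
Qed.

Lemma gvec_perm (f : gT -> gT) x : gvec x *m perm_map f = gvec (f x).
Proof. exact: gvec_map. Qed.

Lemma osact_EX g : g \in N -> stablemx EX2 (osact g).
Proof.
move=> gN; rewrite submxE -mulmxA -sub_kermx; apply/EX_subP => a b aTL bTL.
by rewrite sub_kermx mulmxA -submxE wedge_osact wedge_sub_EX ?memJ_TL.
Qed.

Lemma rank_capHJ (Q : {set gT}) g : g \in W -> Q \subset W ->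
  \rank (capH rho (Q :^ g)%g) = \rank (capH rho Q).
Proof.
move=> gW QW; have gU := rho_unit gW; have gK := rhoVr gW.
rewrite -(mxrankMfree (capH rho Q) (_ : row_free (rho g))) ?row_free_unit //.
suff -> : (capH rho (Q :^ g)%g :=: capH rho Q *m rho g)%MS by [].
apply: eqmx_of_sub => C; have CE : C = C *m rho g^-1%g *m rho g by rewrite -mulmxA rhoVl ?mulmx1.
rewrite {2}CE submxMfree ?row_free_unit //; apply/sub_capHP/sub_capHP => fixC a aQ.
  have aW := subsetP QW a aQ; have := fixC (a ^ g)%g; rewrite memJ_conjg => /(_ aQ).
  by rewrite rhoJ // !mulmxA => Ca; rewrite -{2}Ca -[RHS]mulmxA gK mulmx1.
have aQg : (a ^ g^-1)%g \in Q by rewrite -mem_conjg.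
have := fixC _ aQg; rewrite -{2}[a](conjgKV g) [rho ((a ^ g^-1) ^ g)%g]rhoJ ?(subsetP QW _ aQg) //.
by rewrite !mulmxA => ->; rewrite -CE.
Qed.

Lemma osact_OSideal g : g \in W -> stablemx I2 (osact g).
Proof.
move=> gW; rewrite submxE -mulmxA -sub_kermx; apply/OSideal_subP => a b c abc abcT dep.
rewrite sub_kermx mulmxA -submxE boundary3_osact.
have QJ : [set (a ^ g)%g; (b ^ g)%g; (c ^ g)%g] = ([set a; b; c] :^ g)%g.
  by rewrite !conjUg !conjg_set1.
apply: boundary3_sub_OSideal; rewrite ?QJ.
- by move: abc; rewrite /= !inE !(inj_eq (conjg_inj g)).
- by apply/subsetP => _ /imsetP[x xQ ->]; rewrite refl_J ?(subsetP abcT).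
rewrite /dependent cardJg rank_capHJ //.
by apply/subsetP => x /(subsetP abcT)/refl_W.
Qed.

Lemma osact_EX_OSideal g : g \in N -> stablemx A2 (osact g).
Proof.
move=> gN; have [gW _] := norm_parabolicP gN.
rewrite addsmxMr addsmx_sub (submx_trans (osact_EX gN)) ?addsmxSl //.
by rewrite (submx_trans (osact_OSideal gW)) ?addsmxSr.
Qed.

Lemma boundary3_OSideal a b : a \in TL -> b \in TL -> (boundary3 s a b <= I2)%MS.
Proof.
move=> aTL bTL; have [abs|not_abs] := boolP (uniq [:: s; a; b]).
  have sub : [set s; a; b] \subset TL by rewrite !subUset !sub1set s_TL aTL.
  apply: boundary3_sub_OSideal => //.
    exact: subset_trans sub (subsetIl _ _).
  rewrite /dependent cards3_uniq // ltnS leq_subLR addnC -leq_subLR -rank_FixL.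
  exact: mxrankS (Fix_sub_capH sub).
suff -> : boundary3 s a b = 0 by rewrite sub0mx.
move: not_abs; rewrite /boundary3 /= !inE andbT negb_and !negbK.
case/orP=> [/orP[]/eqP e|/eqP e]; rewrite -?e wedge_diag.
- by rewrite subrr add0r.
- by rewrite subr0 (wedgeN s a) addNr.
by rewrite sub0r addNr.
Qed.

(* [gvec b |-> a_s a_b] is a section of [difference_map] modulo the relations. *)
Lemma ker_difference (v : 'rV[algC]_(eN gT)) :
  (v <= A2)%MS -> v *m difference_map = 0 -> (v <= I2)%MS.
Proof.
pose lift : 'M[algC]_(gN gT, eN gT) := basis_map (fun b => wedge [:: s; b]).
move=> vA v0; suff sub : (A2 *m (1%:M - difference_map *m lift) <= I2)%MS.
  have := submx_trans (submxMr (1%:M - difference_map *m lift) vA) sub.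
  by rewrite mulmxBr mulmx1 mulmxA v0 mul0mx subr0.
rewrite addsmxMr addsmx_sub; apply/andP; split; last first.
  by rewrite mulmxBr mulmx1 mulmxA OSideal_difference mul0mx subr0.
rewrite submxE -mulmxA -sub_kermx; apply/EX_subP => a b aTL bTL.
rewrite sub_kermx mulmxA -submxE mulmxBr mulmx1 mulmxA wedge_difference aTL bTL mulmxBl.
have -> : wedge [:: a; b] - (gvec b *m lift - gvec a *m lift) = boundary3 s a b.
  by rewrite !gvec_map opprB addrA addrAC.
exact: boundary3_OSideal.
Qed.

Lemma difference_equivariant g : g \in N ->
  A2 *m osact g *m difference_map = A2 *m difference_map *m perm_map (fun a => (a ^ g)%g).
Proof.
move=> gN; have [gW _] := norm_parabolicP gN.
apply/eqP; rewrite -subr_eq0 -!mulmxA -mulmxBr -sub_kermx addsmx_sub; apply/andP; split.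
  apply/EX_subP => a b aTL bTL; rewrite sub_kermx mulmxBr !mulmxA wedge_osact.
  by rewrite !wedge_difference !memJ_TL // aTL bTL mulmxBl !gvec_perm subrr.
rewrite sub_kermx mulmxBr !mulmxA OSideal_difference mul0mx subr0.
by have /submxP[D ->] := osact_OSideal gW; rewrite -mulmxA OSideal_difference mulmx0.
Qed.

Lemma difference_image : (zero_sum TL :=: A2 *m difference_map)%MS.
Proof.
apply/eqmxP/andP; split.
  apply/zero_sum_subP => a b aTL bTL.
  have := wedge_difference a b; rewrite aTL bTL /= => <-.
  by rewrite submxMr // (submx_trans _ (addsmxSl _ _)) // wedge_sub_EX.
rewrite addsmxMr OSideal_difference addsmx_sub sub0mx andbT.
rewrite submxE -mulmxA -sub_kermx; apply/EX_subP => a b aTL bTL.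
by rewrite sub_kermx mulmxA -submxE wedge_difference aTL bTL; apply: mem_zero_sum.
Qed.

Lemma PsiT_fixed_reflections g : g \in N ->
  PsiT rho S L g = #|[set a in TL | (a ^ g)%g == a]|%:R - 1.
Proof.
move=> gN; have [gW _] := norm_parabolicP gN; rewrite /PsiT rank_FixL subKn ?n_gt1 //.
rewrite (@tr_restr_quotient _ _ A2 I2 (osact g) difference_map (zero_sum TL)
  (perm_map (fun a => (a ^ g)%g))) ?addsmxSr ?osact_EX_OSideal ?osact_OSideal //.
- by apply: tr_restr_zero_sum s_TL => a; rewrite memJ_TL.
- exact: OSideal_difference.
- exact: ker_difference.
- exact: difference_image.
exact: difference_equivariant.
Qed.

(** * The quasi-idempotent [e_L] in rank two *)

Local Notation XL := (Xset S L).

Lemma mem_XLP d : reflect (d \in W /\ (nonneg (root i0 d) /\ nonneg (root j0 d))) (d \in XL).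
Proof.
apply: (iffP (XsetP _ pair_sub)) => -[dW pos]; split=> //.
  by rewrite !pos ?pair_s ?pair_t.
by move=> i /sv_pairP[]->; case: pos.
Qed.

Lemma mKL_pair_sv i : sv i \in L -> 2 * mKL S L [set sv i] = #|Xsharp S [set sv i]|%:R.
Proof.
move=> iL; pose j := if i == i0 then j0 else i0.
have ji : (j0 == i0) = false by rewrite eq_sym (negPf ij).
have nij : i != j by rewrite /j; case: (sv_pairP i iL) => ->; rewrite ?eqxx ?ji.
rewrite (card_Xsharp_half nij) natrM; congr (_ * _); rewrite /mKL sub1set iL.
congr (_%:R); apply: eq_card => x; rewrite in_setI [RHS]inE andbC.
apply: andb_id2l => /Xsharp_svP[xW [k xk]].
have xi : nonneg (root i x) by rewrite xk nonneg_delta.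
apply/mem_XLP/idP => [[_ []]|xj]; first by rewrite /j; case: ifP.
move: xi xj; rewrite /j; by case: (sv_pairP i iL) => ->; rewrite ?eqxx ?ji.
Qed.

Lemma xJ_pair : xJ S L = mKL S L L *: eL S L + mKL S L [set s] *: eL S [set s]
  + mKL S L [set t] *: eL S [set t] + #|XL|%:R *: eL S set0.
Proof.
have st : s \notin [set t] by rewrite inE (inj_eq (cox_inj cox)).
rewrite eL_sum ?pair_sub // sum_powersetU1 // -[[set t]]setU0 !sum_powersetU1 ?inE //.
rewrite !powerset0 !big_set1 !setU0 mKL_set0.
by rewrite addrC [X in X + _]addrC [X in _ + X]addrC addrA.
Qed.

Lemma eL_formula : mKL S L L *: eL S L =
  xJ S L - 2^-1 *: xJ S [set s] - 2^-1 *: xJ S [set t] + (2^-1 - #|WL|%:R^-1) *: xJ S set0.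
Proof.
have WL_neq0 := neq0CG <<L>>%G.
rewrite xJ_pair !xJ_sv xJ_set0 -!mKL_pair_sv ?pair_s ?pair_t //.
have Xset_sv_card i : #|Xset S [set sv i]|%:R = 2^-1 * #|W|%:R :> algC.
  rewrite (card_Xset_decomp (sub1_sv i)) -[<<_>>%g]/(<[sv i]>%g) -orderE (cox_order cox) natrM.
  by rewrite mulKf // pnatr_eq0.
have XL_card : #|XL|%:R = #|WL|%:R^-1 * #|W|%:R :> algC.
  by rewrite (card_Xset_decomp pair_sub) natrM mulKf.
rewrite !Xset_sv_card XL_card.
move: (mKL S L L) (mKL S L [set s]) (mKL S L [set t]) (#|W|%:R) (#|WL|%:R) WL_neq0.
move: (eL S L) (eL S [set s]) (eL S [set t]) (eL S set0) => v1 v2 v3 v4 a b c w l l0.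
by apply/rowP => k; rewrite !mxE; field; rewrite l0.
Qed.

Definition mul_xL : 'M[algC]_(gN gT) := basis_map (fun u => \sum_(d in XL) gvec (d^-1 * u)%g).

Lemma mul_xL_rmul h : mul_xL *m rmul h = rmul h *m mul_xL.
Proof.
apply: basis_ext => u; rewrite -/(gvec u) !mulmxA gvec_rmul !gvec_map mulmx_suml.
by apply: eq_bigr => d _; rewrite gvec_rmul mulgA.
Qed.

Lemma Xset_mul_pair (K : {set gT}) u d : K \subset L -> u \in WL -> d \in XL ->
  ((u * d)%g \in Xset S K) = (u \in Xset S K).
Proof.
move=> KL uL dX; have KS := subset_trans KL pair_sub; have uW := pair_W uL.
have [dW _] := XsetP _ pair_sub dX.
apply/(XsetP _ KS)/(XsetP _ KS) => -[_ pos]; (split=> [|i iK]; first by rewrite // groupM).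
  by rewrite -(nonneg_root_mul pair_sub (subsetP KL _ iK) uL dX) pos.
by rewrite (nonneg_root_mul pair_sub (subsetP KL _ iK) uL dX) pos.
Qed.

Lemma xJ_mul_xL (K : {set gT}) : K \subset L ->
  xJ S K = \sum_(u in WL) (u \in Xset S K)%:R *: (gvec u^-1%g *m mul_xL).
Proof.
move=> KL; have KS := subset_trans KL pair_sub.
transitivity (\sum_(w in W | w \in Xset S K) gvec w^-1%g).
  by apply: eq_bigl => w; rewrite andb_idl // => /(XsetP _ KS)[].
rewrite big_mkcondr (sum_Xset_decomp pair_sub); apply: eq_bigr => u uL.
rewrite gvec_map scaler_sumr; apply: eq_bigr => d dX.
by rewrite Xset_mul_pair // invMg; case: (_ \in _); rewrite ?scale1r ?scale0r.
Qed.

(** The product [e_L^L u] in the group algebra of [W_L]. *)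
Definition eLL_row u : 'rV[algC]_(gN gT) :=
  2^-1 *: gvec u + 2^-1 *: gvec (w0 * u)%g - #|WL|%:R^-1 *: \sum_(v in WL) gvec v.

Lemma eLL_row_coord u v : v \in WL -> eLL_row u 0 (enum_rank v) =
  2^-1 * ((u == v)%:R + ((w0 * u)%g == v)%:R) - #|WL|%:R^-1.
Proof.
move=> vL; have sum_coord : (\sum_(x in WL) gvec x) 0 (enum_rank v) = 1.
  rewrite summxE (bigD1 v) //= gvec_coord eqxx big1 ?addr0 // => x /andP[_ xv].
  by rewrite gvec_coord (negPf xv).
move: (gvec_coord u v) (gvec_coord (w0 * u)%g v) sum_coord; rewrite /eLL_row.
move: (gvec u) (gvec (w0 * u)%g) (\sum_(x in WL) gvec x) => a b c ea eb ec.
by rewrite !mxE ea eb ec mulr1 mulrDr.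
Qed.

Definition mul_eLL : 'M[algC]_(gN gT) := basis_map (fun u => if u \in WL then eLL_row u else 0).

Lemma gvec_mul_eLL u : gvec u *m mul_eLL = if u \in WL then eLL_row u else 0.
Proof. exact: gvec_map. Qed.

Lemma sum_eq_indicator (V : lmodType algC) (F : gT -> V) a : a \in WL ->
  \sum_(u in WL) (u == a)%:R *: F u = F a.
Proof.
move=> aL; rewrite (bigD1 a) //= eqxx scale1r big1 ?addr0 // => u /andP[_ /negPf->].
exact: scale0r.
Qed.

Lemma parabolic_eq1E u : u \in WL ->
  (u == 1%g) = (u \in Xset S [set s]) && (u \in Xset S [set t]).
Proof.
move=> uL; rewrite !Xset_sv pair_W //=; apply/eqP/andP => [->|[us ut]].
  by rewrite rho1 !row1 !nonneg_delta.
by apply: (parabolic_Xset_eq1 pair_sub uL); apply/mem_XLP; rewrite pair_W.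
Qed.

Lemma parabolic_eq_longestE u : u \in WL ->
  (u == w0) = (u \notin Xset S [set s]) && (u \notin Xset S [set t]).
Proof.
move=> uL; have uW := pair_W uL; rewrite !Xset_sv uW /= -!root_nonnegN //.
apply/eqP/andP => [->|[us ut]].
  have w0_dom := longest_dominant pair_sub.
  by have := w0_dom j0 pair_t; have := w0_dom i0 pair_s; rewrite expr1 !scaleN1r.
by apply: (longest_uniq pair_sub uL) => i /sv_pairP[]->; rewrite expr1 scaleN1r.
Qed.

Lemma eL_mul_eLL : mKL S L L *: eL S L = gvec 1%g *m mul_eLL *m mul_xL.
Proof.
have w0L := longest_parabolic L; have w0V := longestV pair_sub.
have sub_s : [set s] \subset L by rewrite sub1set pair_s.
have sub_t : [set t] \subset L by rewrite sub1set pair_t.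
rewrite eL_formula !xJ_mul_xL ?sub0set // gvec_mul_eLL group1 /eLL_row mulg1.
rewrite mulmxBl mulmxDl -!scalemxAl mulmx_suml.
have -> : \sum_(v in WL) gvec v *m mul_xL = \sum_(u in WL) (gvec u^-1%g *m mul_xL).
  by rewrite (reindex_inj invg_inj) /=; apply: eq_bigl => u; rewrite groupV.
have -> : gvec 1%g *m mul_xL = \sum_(u in WL) (u == 1%g)%:R *: (gvec u^-1%g *m mul_xL).
  by rewrite sum_eq_indicator // invg1.
have -> : gvec w0 *m mul_xL = \sum_(u in WL) (u == w0)%:R *: (gvec u^-1%g *m mul_xL).
  by rewrite sum_eq_indicator // w0V.
rewrite !scaler_sumr -!sumrB -!big_split -sumrB /=; apply: eq_bigr => u uL.
rewrite !scalerA -!scalerBl -!scalerDl -!scalerBl; congr (_ *: _).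
have -> : (u \in XL) = (u == 1%g).
  by apply/idP/eqP => [/(parabolic_Xset_eq1 pair_sub uL)|->]; rewrite ?mem1_Xset ?pair_sub.
have WL_neq0 := neq0CG <<L>>%G.
rewrite Xset_set0 pair_W // parabolic_eq1E // parabolic_eq_longestE //.
move: (#|WL|%:R) WL_neq0 => l l0.
by case: (u \in Xset S [set s]); case: (u \in Xset S [set t]) => /=; field.
Qed.

Lemma sum_WL_mul_eLL : (\sum_(v in WL) gvec v) *m mul_eLL = 0.
Proof.
rewrite mulmx_suml (eq_bigr eLL_row) => [|v vL]; last by rewrite gvec_mul_eLL vL.
rewrite /eLL_row sumrB big_split /= -!scaler_sumr sumr_const.
have -> : \sum_(v in WL) gvec (w0 * v)%g = \sum_(v in WL) gvec v.
  rewrite [RHS](reindex_inj (mulgI w0)) /=; apply: eq_bigl => v.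
  by rewrite groupMl ?longest_parabolic.
rewrite -[_ *+ #|_|]scaler_nat scalerA mulVf ?neq0CG //.
rewrite -scalerDl -scalerBl.
have -> : 2^-1 + 2^-1 - 1 = 0 :> algC by field.
exact: scale0r.
Qed.

Lemma mul_eLLK : mul_eLL *m mul_eLL = mul_eLL.
Proof.
apply: basis_ext => u; rewrite -/(gvec u) mulmxA gvec_mul_eLL.
case: ifP => uL; last by rewrite mul0mx.
have w0L := longest_parabolic L.
rewrite {1}/eLL_row mulmxBl mulmxDl -!scalemxAl sum_WL_mul_eLL scaler0 subr0 !gvec_mul_eLL uL.
rewrite groupM //; have -> : eLL_row (w0 * u)%g = eLL_row u.
  by rewrite /eLL_row mulgA (longestK pair_sub) mul1g [_ *: _ + _]addrC.
rewrite -scalerDl; have -> : 2^-1 + 2^-1 = 1 :> algC by field.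
exact: scale1r.
Qed.

Lemma gvec_mul_xL_proj u : u \in WL -> gvec u *m mul_xL *m coord_proj WL = gvec u.
Proof.
move=> uL; rewrite gvec_map mulmx_suml (bigD1 1%g) /=; last exact: mem1_Xset pair_sub.
rewrite invg1 mul1g [gvec u *m _]gvec_map uL big1 ?addr0 // => d /andP[dX d1].
rewrite [gvec _ *m _]gvec_map groupMr // groupV; case: ifP => // dL.
by case/eqP: d1; apply: (parabolic_Xset_eq1 pair_sub).
Qed.

Lemma mul_eLL_xL_proj : mul_eLL *m mul_xL *m coord_proj WL = mul_eLL.
Proof.
apply: basis_ext => u; rewrite -/(gvec u) !mulmxA gvec_mul_eLL.
case: ifP => uL; last by rewrite !mul0mx.
rewrite /eLL_row !mulmxBl !mulmxDl -!scalemxAl !gvec_mul_xL_proj ?groupM ?longest_parabolic //.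
by rewrite !mulmx_suml; congr (_ - _ *: _); apply: eq_bigr => v vL; apply: gvec_mul_xL_proj.
Qed.

Lemma eLCWL_image : (mul_eLL *m mul_xL :=: eLCWL S L)%MS.
Proof.
have m_neq0 : mKL S L L != 0 by apply: mKL_diag pair_sub.
have eL_rmul h : h \in WL -> eL S L *m rmul h = (mKL S L L)^-1 *: (gvec h *m mul_eLL *m mul_xL).
  move=> hL; have -> : eL S L = (mKL S L L)^-1 *: (gvec 1%g *m mul_eLL *m mul_xL).
    by rewrite -eL_mul_eLL scalerA mulVf // scale1r.
  rewrite -scalemxAl -(mulmxA _ mul_xL) mul_xL_rmul mulmxA; congr (_ *: (_ *m _)).
  rewrite !gvec_mul_eLL group1 hL /eLL_row mulmxBl mulmxDl -!scalemxAl !gvec_rmul mulg1 mul1g.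
  rewrite mulmx_suml; congr (_ - _ *: _); rewrite [RHS](reindex_inj (mulIg h)) /=.
  by apply: eq_big => v; rewrite ?groupMr // => _; rewrite gvec_rmul.
apply/eqmxP/andP; split.
  apply: basis_sub => u; rewrite -/(gvec u) mulmxA; have [uL|uL] := boolP (u \in WL); last first.
    by rewrite gvec_mul_eLL (negPf uL) mul0mx sub0mx.
  rewrite (sumsmx_sup u) // genmxE eL_rmul //.
  by rewrite eqmx_scale ?invr_neq0.
apply/sumsmx_subP => h hL; rewrite genmxE eL_rmul // -mulmxA.
by rewrite scalemx_sub // submxMl.
Qed.

Section TwistedTranslation.
Variables g d : gT.
Hypotheses (dN : d \in N) (dX : d \in XL) (gd : (g * d^-1)%g \in WL).

(* [x_L d = x_L] turns right multiplication of [x_L u] by [g] into [u |-> d^-1 u g]. *)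
Local Notation twist := (perm_map (fun u => (d^-1 * u * g)%g)).

Lemma twist_WL u : ((d^-1 * u * g)%g \in WL) = (u \in WL).
Proof.
have [_ dJ] := norm_parabolicP dN.
have -> : (d^-1 * u * g = (u * (g * d^-1)) ^ d)%g by rewrite conjgE !mulgA mulgKV.
by rewrite dJ groupMr.
Qed.

Lemma Xset_mulVl x : ((d^-1 * x)%g \in XL) = (x \in XL).
Proof.
have [dW _] := norm_parabolicP dN.
have d_dom : signed_dominant L false d by apply/(Xset_dominant pair_sub dW).
have dV_dom := signed_dominantV pair_sub dN d_dom; have dVN : d^-1%g \in N by rewrite groupV.
have mulX c y : c \in N -> signed_dominant L false c -> y \in XL -> (c * y)%g \in XL.
  move=> cN c_dom yX; have [yW _] := XsetP _ pair_sub yX; have [cW _] := norm_parabolicP cN.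
  apply/(Xset_dominant pair_sub (groupM cW yW)).
  apply: (signed_dominantM pair_sub (b := false) (c := false)) => //.
  exact/(Xset_dominant pair_sub yW).
by apply/idP/idP => [/(mulX d _ dN d_dom)|]; [rewrite mulKVg | apply: mulX].
Qed.

Lemma mul_xL_twist : mul_xL *m rmul g = twist *m mul_xL.
Proof.
apply: basis_ext => u; rewrite -/(gvec u) !mulmxA gvec_perm !gvec_map mulmx_suml.
rewrite (reindex_inj (mulgI d)) /=; apply: eq_big => x; first by rewrite -Xset_mulVl mulKg.
by move=> _; rewrite gvec_rmul invMg !mulgA.
Qed.

Lemma sum_WL_twist : (\sum_(v in WL) gvec v) *m twist = \sum_(v in WL) gvec v.
Proof.
rewrite mulmx_suml [RHS](reindex_inj (mulgI d^-1%g)) [RHS](reindex_inj (mulIg g)) /=.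
by apply: eq_big => v; rewrite mulgA ?twist_WL // gvec_perm.
Qed.

Lemma eLL_row_twist u : eLL_row u *m twist = eLL_row (d^-1 * u * g)%g.
Proof.
rewrite /eLL_row mulmxBl mulmxDl -!scalemxAl !gvec_perm sum_WL_twist.
have w0_d : (w0 * d^-1 = d^-1 * w0)%g.
  by apply: (mulgI d); rewrite mulKVg mulgA -(longestC pair_sub dN dX) mulgK.
by rewrite !mulgA w0_d.
Qed.

Lemma mul_eLL_twist : mul_eLL *m twist = twist *m mul_eLL.
Proof.
apply: basis_ext => u; rewrite -/(gvec u) !mulmxA gvec_perm !gvec_mul_eLL twist_WL.
by case: ifP => uL; rewrite ?mul0mx ?eLL_row_twist.
Qed.

Lemma PhiT_coset : PhiT S L g =
  2^-1 * #|[set u in WL | ((u * g * u^-1)%g == d) || ((u * g * u^-1)%g == (w0 * d)%g)]|%:R - 1.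
Proof.
rewrite /PhiT (tr_restr_idem mul_eLLK mul_eLL_twist mul_xL_twist mul_eLL_xL_proj eLCWL_image).
rewrite mul_basis_map tr_basis_map.
have WL_neq0 := neq0CG <<L>>%G.
pose good u := ((u * g * u^-1)%g == d) || ((u * g * u^-1)%g == (w0 * d)%g).
have diagE u : u \in WL -> (eLL_row u *m twist) 0 (enum_rank u) =
    2^-1 * (good u)%:R - #|WL|%:R^-1.
  move=> uL; rewrite eLL_row_twist eLL_row_coord //; congr (_ * _ - _).
  have -> : (d^-1 * u * g == u)%g = ((u * g * u^-1)%g == d).
    by rewrite -(inj_eq (mulgI d)) -[RHS](inj_eq (mulIg u)) !mulgA mulgV mul1g mulgKV.
  have -> : (w0 * (d^-1 * u * g) == u)%g = ((u * g * u^-1)%g == (w0 * d)%g).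
    rewrite -(inj_eq (mulgI w0)) mulgA (longestK pair_sub) mul1g -(inj_eq (mulgI d)).
    by rewrite -[RHS](inj_eq (mulIg u)) !mulgA mulgV mul1g mulgKV (longestC pair_sub dN dX).
  have d_neq : (d == w0 * d)%g = false.
    by rewrite -{1}[d]mul1g (inj_eq (mulIg d)) eq_sym (negPf (longest_neq1 pair_sub pair_s)).
  by rewrite /good; case: eqP => [->|_]; rewrite ?d_neq ?addr0 ?add0r.
transitivity (\sum_(u in WL) (2^-1 * (good u)%:R - #|WL|%:R^-1) : algC).
  rewrite [RHS]big_mkcond; apply: eq_bigr => u _; case: ifP => uL; last by rewrite mul0mx mxE.
  exact: diagE.
rewrite sumrB sumr_const -[_ *+ #|_|]mulr_natr mulVf // -mulr_sumr; congr (_ * _ - _).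
rewrite -[#|[set u in WL | _]|]sum1_card natr_sum big_mkcond [RHS]big_mkcond.
by apply: eq_bigr => u _; rewrite inE; case: (u \in WL) => //=; rewrite -/(good u); case: (good u).
Qed.

End TwistedTranslation.

Lemma PhiT_preserves_base g : g \in N ->
  PhiT S L g = 2^-1 * #|[set u in WL | preserves_base (u * g * u^-1)%g]|%:R - 1.
Proof.
move=> gN; have [v [d [vL dN dX gE]]] := norm_decomp pair_sub gN.
have gd : (g * d^-1)%g \in WL by rewrite gE mulgK.
rewrite (PhiT_coset dN dX gd); congr (_ * _%:R - _); apply: eq_card => u; rewrite !inE.
apply: andb_id2l => uL; have [_ dVJ] := norm_parabolicP (groupVr dN).
have -> : (u * g * u^-1 = (u * v * u^-1 ^ d^-1) * d)%g by rewrite gE conjgE invgK !mulgA mulgKV.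
have uvL : (u * v * u^-1 ^ d^-1)%g \in WL by apply: groupM; [apply: groupM | rewrite dVJ groupV].
by rewrite preserves_base_coset.
Qed.

(** * The two characters as sums over rotations *)

Lemma twisted_power g : g \in N ->
  exists k, forall z c, z \in R -> (c * z ^ g == z)%g = (z ^+ k == c)%g.
Proof.
move=> gN; case: (delta_cases gN) => -[_ Jg]; [exists 0%N | exists 2%N] => z c zR.
  by rewrite Jg // -{2}[z]mul1g (inj_eq (mulIg z)) eq_sym.
by rewrite Jg // -(inj_eq (mulIg z)) mulgKV eq_sym.
Qed.

Lemma PsiT_sum g : g \in N ->
  PsiT rho S L g = \sum_(x in R | ((x ^ g)%g == x) && (x != 1%g)) pairing r x (cocycle g).
Proof.
move=> gN; have cR := cocycle_rot gN; have [k twist] := twisted_power gN.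
rewrite PsiT_fixed_reflections //.
have -> : #|[set a in TL | (a ^ g)%g == a]| = #|[set z in R | (z ^+ k)%g == cocycle g]|.
  rewrite -(card_imset _ (mulgI s)); apply: eq_card => z.
  apply/imsetP/idP => [[a] | ]; rewrite inE.
    move=> /andP[aTL /eqP ag] ->; rewrite inE -mem_TL aTL -twist -?mem_TL //.
    by rewrite conjMg ag /cocycle -(mulgA s) (mulgA (s ^ g)%g) -conjMg svK conj1g mul1g eqxx.
  move=> /andP[zR zk]; exists (s * z)%g; rewrite ?svKl // inE mem_TL svKl zR /=.
  by rewrite conjMg conj_s -mulgA (inj_eq (mulgI s)) twist.
rewrite card_power_fiber // (bigD1 1%g) ?group1 ?expg1n //= pairing1l addrAC subrr add0r.
apply: eq_bigl => x; rewrite -andbA; apply: andb_id2l => xR.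
by rewrite -twist // mul1g.
Qed.

Lemma card_preserves_base g : g \in N ->
  let b := if delta g == 1 then 1%g else r in
  #|[set u in WL | preserves_base (u * g * u^-1)%g]|%:R =
  \sum_(x in R) (cocycle (x * g * x^-1)%g == b)%:R +
  \sum_(x in R) (cocycle (x * g * x^-1)%g == b^-1%g)%:R :> algC.
Proof.
move=> gN b; have deltaV u : u \in WL -> delta (u * g * u^-1)%g = delta g.
  by move=> uL; rewrite -{1}[u]invgK -(mulgA _ g) -conjgE deltaJ // groupV pair_N.
rewrite -sum1dep_card natr_sum big_mkcondr sum_dihedral; congr (_ + _); apply: eq_bigr => x xR.
  by rewrite /preserves_base deltaV ?rot_WL //; case: eqP.
have xgN : (x * g * x^-1)%g \in N by rewrite !groupM ?groupV // pair_N ?rot_WL.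
have sxE : (s * x * g * (s * x)^-1 = s * (x * g * x^-1) * s^-1)%g by rewrite invMg !mulgA.
rewrite /preserves_base deltaV ?s_rot_WL // sxE cocycle_s_conj //.
by rewrite eq_invg_sym; case: eqP.
Qed.

Lemma rotJ_delta1 g x : g \in N -> delta g = 1 -> x \in R -> (x ^ g = x)%g.
Proof.
move=> gN dg xR; case: (delta_cases gN) => -[dE ->] //.
by have := oppr1_eq1; rewrite -dE dg eqxx.
Qed.

Lemma rotJ_deltaN1 g x : g \in N -> delta g = -1 -> x \in R -> (x ^ g = x^-1)%g.
Proof.
move=> gN dg xR; case: (delta_cases gN) => -[dE ->] //.
by have := oppr1_eq1; rewrite -dg dE eqxx.
Qed.

Lemma PhiT_delta1 g : g \in N -> delta g = 1 ->
  PhiT S L g = \sum_(x in R | ((x ^ g)%g == x) && (x != 1%g)) pairing r x (cocycle g).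
Proof.
move=> gN dg; rewrite PhiT_preserves_base // card_preserves_base // dg eqxx.
have Jg x := rotJ_delta1 (x := x) gN dg.
have -> : \sum_(x in R | ((x ^ g)%g == x) && (x != 1%g)) pairing r x (cocycle g) =
    \sum_(x in R) pairing r (cocycle g) x - 1.
  rewrite [X in _ = X - _](bigD1 1%g) ?group1 //= pairing1r addrAC subrr add0r.
  apply: eq_big => [x|x _]; last exact: pairingC.
  by apply: andb_id2l => xR; rewrite Jg // eqxx.
rewrite sum_pairing ?cocycle_rot // invg1.
rewrite (eq_bigr (fun=> (cocycle g == 1%g)%:R)) => [|x xR]; last first.
  by rewrite cocycle_rot_conj // Jg ?groupX // mulgV mulg1.
by rewrite sumr_const -[#|R|]/(#[r]%g) -mulr_natl; congr (_ - _); field.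
Qed.

Lemma PhiT_deltaN1 g : g \in N -> delta g = -1 ->
  PhiT S L g = - \sum_(x in R | ((x ^ g)%g == x) && (x != 1%g)) pairing r x (cocycle g).
Proof.
move=> gN dg; rewrite PhiT_preserves_base // card_preserves_base // dg oppr1_eq1.
have Jg x := rotJ_deltaN1 (x := x) gN dg.
have cR := cocycle_rot gN.
have fiberE b : b \in R -> \sum_(x in R) (cocycle (x * g * x^-1)%g == b)%:R =
    #|[set x in R | (x ^+ 4)%g == (cocycle g * b^-1)%g]|%:R :> algC.
  move=> bR; rewrite -sum1dep_card natr_sum big_mkcondr; apply: eq_bigr => x xR.
  rewrite cocycle_rot_conj // Jg ?groupX // -invMg -expgD.
  rewrite -(inj_eq (mulIg (x ^+ 4)%g)) mulgKV (rotC bR (groupX 4 xR)).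
  by rewrite -[X in _ = (if X then _ else _)](inj_eq (mulIg b)) mulgKV eq_sym; case: eqP.
rewrite !fiberE ?groupV ?cycle_id // invgK card_quartic_fibers // addrAC subrr add0r.
congr (- _); apply: eq_bigl => x; apply: andb_id2l => xR.
by rewrite Jg // eq_invg_mul -expg2.
Qed.

Lemma PhiT_sum g : g \in N -> PhiT S L g =
  \sum_(x in R | ((x ^ g)%g == x) && (x != 1%g)) pairing r x (cocycle g) * delta g.
Proof.
move=> gN; rewrite -mulr_suml; case: (delta_cases gN) => -[dg _]; rewrite dg.
  by rewrite mulr1 PhiT_delta1.
by rewrite mulrN1 PhiT_deltaN1.
Qed.

(** * Linear characters on the centralizers of cuspidal elements *)

Local Notation cusp := (cusp_classes sv rho L).

Lemma cusp_class_mem C x : C \in cusp -> x \in C -> [/\ x \in R, x != 1%g & C = x ^: WL].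
Proof.
rewrite inE => /andP[/imsetP[y yL ->] /forall_inP C_cusp] xC.
have := C_cusp x xC; have xL : x \in WL by case/imsetP: xC => u uL ->; rewrite groupJ.
by rewrite cuspidal_rot // => /andP[-> ->]; split=> //; apply/esym/class_eqP.
Qed.

Lemma mem_cusp_classes x : x \in R -> x != 1%g -> x ^: WL \in cusp.
Proof.
move=> xR x1; rewrite inE mem_classes ?rot_WL //; apply/forall_inP => _ /imsetP[u uL ->].
have xuL : (x ^ u)%g \in WL by apply: groupJ => //; apply: rot_WL.
by rewrite (cuspidal_rot xuL) (rot_norm _ (pair_N uL)) xR conjg_eq1.
Qed.

Lemma class_norm_parabolic x : x \in R -> x ^: N = x ^: WL.
Proof.
move=> xR; apply/setP => y; apply/idP/idP => /imsetP[g gN ->]; last first.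
  by apply: memJ_class; apply: pair_N.
case: (delta_cases gN) => -[_ ->] //; first exact: class_refl.
by rewrite -rotJs //; apply: memJ_class; apply: s_WL.
Qed.

Lemma sum_cusp_classes (V : nmodType) (F : gT -> V) (P : pred gT) :
  \sum_(C in cusp) \sum_(z in C | P z) F z = \sum_(x in R | P x && (x != 1%g)) F x.
Proof.
rewrite [RHS](partition_big (fun x => x ^: WL) (mem cusp)) /=; last first.
  by move=> x /and3P[xR _ x1]; apply: mem_cusp_classes.
apply: eq_bigr => C C_cusp; apply: eq_bigl => x; apply/andP/idP => [[xC Px]|].
  by have [xR x1 ->] := cusp_class_mem C_cusp xC; rewrite xR Px x1 eqxx.
by case/andP=> /and3P[xR Px x1] /eqP <-; rewrite class_refl.
Qed.

Lemma pairingJ g x y : g \in N -> x \in R -> y \in R ->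
  pairing r (x ^ g)%g (y ^ g)%g = pairing r x y.
Proof.
move=> gN xR yR; case: (delta_cases gN) => -[_ Jg]; rewrite !Jg //.
by rewrite pairingVl // pairingVr // invrK.
Qed.

Definition centralizer_character (F : gT -> gT -> algC) : Prop :=
  forall x, x \in R ->
    [/\ F x 1%g = 1,
        {in N &, forall g h, (x ^ h = x)%g -> F x (g * h)%g = F x g * F x h}
      & {in N &, forall g y, ((x ^ y^-1) ^ g = x ^ y^-1)%g -> F x (g ^ y)%g = F (x ^ y^-1)%g g}].

Lemma pairing_cocycleJ x g y : x \in R -> g \in N -> y \in N ->
    ((x ^ y^-1) ^ g = x ^ y^-1)%g ->
  pairing r x (cocycle (g ^ y)%g) = pairing r (x ^ y^-1)%g (cocycle g).
Proof.
move=> xR gN yN; set x' := (x ^ y^-1)%g => x'g; have yVN : y^-1%g \in N by rewrite groupV.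
have x'R : x' \in R by rewrite rot_norm.
have [cR zR] := (cocycle_rot gN, cocycle_rot yVN); set z := cocycle y^-1%g in zR.
have zgR : (z ^ g)%g \in R by rewrite rot_norm.
have cyE : cocycle y = (z^-1 ^ y)%g.
  apply: (mulIg (z ^ y)%g); rewrite -conjMg mulVg conj1g -cocycleM mulVg; exact: cocycle1.
have -> : cocycle (g ^ y)%g = ((z^-1 * (cocycle g * z ^ g)) ^ y)%g.
  by rewrite [(g ^ y)%g]conjgE !cocycleM cyE (conjgM z) !(conjMg _ _ y) -(mulgA (z^-1 ^ y)%g).
have wR : (z^-1 * (cocycle g * z ^ g))%g \in R := groupM (groupVr zR) (groupM cR zgR).
rewrite -{1}(conjgKV y x) -/x' (pairingJ yN x'R wR).
rewrite (pairingMr _ (groupVr zR) (groupM cR zgR)) (pairingMr _ cR zgR).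
have -> : pairing r x' (z ^ g)%g = pairing r x' z by rewrite -{1}x'g pairingJ.
by rewrite pairingVr // mulrCA mulVf ?mulr1 // pairing_neq0.
Qed.

Lemma pairing_centralizer_character : centralizer_character (fun x g => pairing r x (cocycle g)).
Proof.
move=> x xR; split=> [|g h gN hN xh|g y gN yN x'g]; last exact: pairing_cocycleJ.
  by rewrite cocycle1 pairing1r.
rewrite cocycleM pairingMr ?rot_norm ?cocycle_rot // mulrC; congr (_ * _).
by rewrite -{1}xh pairingJ ?cocycle_rot.
Qed.

Lemma centralizer_character_delta F : centralizer_character F ->
  centralizer_character (fun x g => F x g * delta g).
Proof.
move=> F_char x xR; have [F1 FM FJ] := F_char x xR.
split=> [|g h gN hN xh|g y gN yN x'g]; first by rewrite F1 delta1 mulr1.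
  by rewrite FM // deltaM // mulrACA.
by rewrite FJ // deltaJ.
Qed.

Section CuspidalRepresentatives.
Variable rep : {set gT} -> gT.
Hypothesis rep_mem : forall C, C \in cusp -> rep C \in C.

Lemma cent_rep_norm C g : C \in cusp -> g \in 'C_W[rep C]%g -> g \in N /\ (rep C ^ g = rep C)%g.
Proof.
move=> C_cusp gC; have [xR x1 _] := cusp_class_mem C_cusp (rep_mem C_cusp); split; last first.
  by case/setIP: gC => _ /cent1P c; rewrite conjgE -c mulKg.
apply: (subsetP (cent_cuspidal pair_sub _)) gC.
by rewrite cuspidal_rot ?rot_WL ?xR.
Qed.

Lemma centralizer_character_Ind F : centralizer_character F ->
  exists2 xi : forall C, 'CF('C_W[rep C]),
    forall C, C \in cusp -> xi C \is a linear_char /\ {in 'C_W[rep C]%g, xi C =1 F (rep C)} &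
    forall g, g \in N -> \sum_(C in cusp) 'Ind[N] (xi C) g =
      \sum_(x in R | ((x ^ g)%g == x) && (x != 1%g)) F x g.
Proof.
move=> F_char; have [|xi xiP] := @fin_all_exists _ _ (fun C (xi : 'CF('C_W[rep C])) =>
    C \in cusp -> xi \is a linear_char /\ {in 'C_W[rep C]%g, xi =1 F (rep C)}).
  move=> C; case: (boolP (C \in cusp)) => C_cusp; last by exists 0.
  have [xR _ _] := cusp_class_mem C_cusp (rep_mem C_cusp); have [F1 FM _] := F_char _ xR.
  have [g h /cent_rep_norm[]// gN _|xi] := lin_char_exists F1 (K := 'C_W[rep C]%G).
    by move=> /cent_rep_norm[]// hN xh; apply: FM.
  by exists xi.
exists xi => // g gN; rewrite -(sum_cusp_classes (F^~ g) (fun x => (x ^ g)%g == x)).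
apply: eq_bigr => C C_cusp; have [_ xiE] := xiP C C_cusp.
have [xR _ CE] := cusp_class_mem C_cusp (rep_mem C_cusp); have [_ _ FJ] := F_char _ xR.
rewrite [in RHS]CE -class_norm_parabolic //.
apply: cfInd_cent1 => // [||y yN]; first exact: subsetIl.
  by apply/subsetP => h /cent_rep_norm[].
exact: FJ.
Qed.

End CuspidalRepresentatives.

End RankTwo.

End CoxeterGroup.

Theorem theorem5p15 (gT : finGroupType) (n : nat) (sv : 'I_n -> gT)
    (rho : gT -> 'M[algC]_n) :
  injective sv ->
  coxeter_system [set sv i | i : 'I_n] ->
  geom_rep sv rho ->
  (3 <= n)%N ->
  forall L : {set gT}, L \subset [set sv i | i : 'I_n] -> #|L| = 2%N ->
  forall rep : {set gT} -> gT,
    (forall C, C \in cusp_classes sv rho L -> rep C \in C) ->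
  exists phi psi : forall C : {set gT}, 'CF('C_(<<[set sv i | i : 'I_n]>>%g)[rep C]),
    [/\ forall C, C \in cusp_classes sv rho L ->
           phi C \is a linear_char /\ psi C \is a linear_char,
        forall g, g \in 'N_(<<[set sv i | i : 'I_n]>>%g)(<<L>>%g) ->
           PhiT [set sv i | i : 'I_n] L g =
           \sum_(C in cusp_classes sv rho L)
              ('Ind['N_(<<[set sv i | i : 'I_n]>>%g)(<<L>>%g)] (phi C)) g,
        forall g, g \in 'N_(<<[set sv i | i : 'I_n]>>%g)(<<L>>%g) ->
           PsiT rho [set sv i | i : 'I_n] L g =
           \sum_(C in cusp_classes sv rho L)
              ('Ind['N_(<<[set sv i | i : 'I_n]>>%g)(<<L>>%g)] (psi C)) g
      & forall C, C \in cusp_classes sv rho L ->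
           forall g, g \in 'C_(<<[set sv i | i : 'I_n]>>%g)[rep C] ->
             psi C g = phi C g * epsilon rho g * alphaL rho L g].
Proof.
move=> sv_inj [order2 _] geom _ L LS /eqP/cards2P[a [b [ab LE]]] rep repP; subst L.
have cox : coxeter_rep sv rho by split=> // i; apply/order2/imset_f.
move: LS; rewrite subUset !sub1set => /andP[/imsetP[i _ aE] /imsetP[j _ bE]]; subst a b.
have ij : i != j by apply: contra ab => /eqP->.
have psi_char := pairing_centralizer_character cox ij.
have phi_char := centralizer_character_delta cox ij psi_char.
have [phi phiP phi_sum] := centralizer_character_Ind cox ij repP phi_char.
have [psi psiP psi_sum] := centralizer_character_Ind cox ij repP psi_char.
exists phi, psi; split=> [C C_cusp|g gN|g gN|C C_cusp g gC].
- by have [[-> _] [-> _]] := (phiP C C_cusp, psiP C C_cusp).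
- by rewrite phi_sum // (PhiT_sum cox ij).
- by rewrite psi_sum // (PsiT_sum cox ij).
have [gN _] := cent_rep_norm cox ij repP C_cusp gC.
have [[_ ->] // [_ ->] //] := (phiP C C_cusp, psiP C C_cusp).
by rewrite -[RHS]mulrA -[epsilon _ _ * _]/(delta sv rho i j g) -mulrA (delta_sqr cox ij) // mulr1.
Qed.
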